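(* Let $\Omega\subsetneq\mathbb{R}^n$ be open and such that $-\Delta d\ge0$ in $\Omega$ in the sense of distributions. Then for all $u\in C_c^\infty(\Omega)$ and all $s>1$, $$\int_\Omega\frac{|\nabla u|}{d^{s-1}}dx\ \ge\ (s-1)\int_\Omega\frac{|u|}{d^s}dx,$$ and the constant $s-1$ is sharp (it cannot be replaced by a larger constant).
   Context: $d(x):=\operatorname{dist}(x,\mathbb{R}^n\setminus\Omega)$. *)

(* Defs.v *)
From HB Require Import structures.
From mathcomp Require Import all_boot all_order all_algebra.
From mathcomp Require Import all_classical all_reals all_analysis.
Set Implicit Arguments. Unset Strict Implicit. Unset Printing Implicit Defensive.
Import Order.TTheory GRing.Theory Num.Theory.
Import numFieldNormedType.Exports.
Local Open Scope classical_set_scope.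
Local Open Scope ring_scope.

(* Euclidean norm on R^n (the library norm on 'rV is the sup norm). *)
Definition enorm (R : realType) (n : nat) (v : 'rV[R]_n) : R :=
  Num.sqrt (\sum_(i < n) v ord0 i ^+ 2).

Definition dist_compl (R : realType) (n : nat) (Omega : set 'rV[R]_n)
  (x : 'rV[R]_n) : R :=
  inf [set enorm (x - y) | y in ~` Omega].

Definition ebasis (R : realType) (n : nat) (i : 'I_n) : 'rV[R]_n :=
  delta_mx ord0 i.

Definition dpartial (R : realType) (n : nat) (i : 'I_n)
  (f : 'rV[R]_n -> R) : 'rV[R]_n -> R :=
  fun x => derive f x (ebasis R i).

Definition dpartials (R : realType) (n : nat) (l : seq 'I_n)
  (f : 'rV[R]_n -> R) : 'rV[R]_n -> R :=
  foldr (@dpartial R n) f l.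

Definition smooth (R : realType) (n : nat) (f : 'rV[R]_n -> R) : Prop :=
  forall l : seq 'I_n,
    continuous (dpartials l f) /\
    (forall (i : 'I_n) (x : 'rV[R]_n), derivable (dpartials l f) x (ebasis R i)).

Definition fsupport (R : realType) (n : nat) (f : 'rV[R]_n -> R) :
  set 'rV[R]_n := closure [set x | f x != 0].

Definition Cc_infty (R : realType) (n : nat) (Omega : set 'rV[R]_n)
  (u : 'rV[R]_n -> R) : Prop :=
  smooth u /\ compact (fsupport u) /\ fsupport u `<=` Omega.

Definition gradnorm (R : realType) (n : nat) (u : 'rV[R]_n -> R)
  (x : 'rV[R]_n) : R :=
  Num.sqrt (\sum_(i < n) dpartial i u x ^+ 2).

Definition laplacian (R : realType) (n : nat) (u : 'rV[R]_n -> R)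
  (x : 'rV[R]_n) : R :=
  \sum_(i < n) dpartial i (dpartial i u) x.

Definition vcons (R : realType) (n : nat) (t : R) (y : 'rV[R]_n) :
  'rV[R]_n.+1 :=
  \row_(i < n.+1) match unlift ord0 i with Some j => y ord0 j | None => t end.

(* Lebesgue integral over R^n, written as the iterated one-dimensional
   Lebesgue integral (equal to the n-dimensional Lebesgue integral by
   Tonelli/Fubini for the nonnegative resp. integrable integrands used). *)
Fixpoint iint (R : realType) (n : nat) : ('rV[R]_n -> \bar R) -> \bar R :=
  match n with
  | 0 => fun f => f 0
  | m.+1 => fun f =>
      (\int[@lebesgue_measure R]_t @iint R m (fun y => f (vcons t y)))%E
  end.

(* -Delta d >= 0 in Omega in the sense of distributions:
   <-Delta d, phi> = - \int d Delta phi >= 0 for every nonnegative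
   phi in C_c^infinity(Omega). *)
Definition neg_laplacian_dist_ge0 (R : realType) (n : nat)
  (Omega : set 'rV[R]_n) : Prop :=
  forall phi : 'rV[R]_n -> R,
    Cc_infty Omega phi -> (forall x, 0 <= phi x) ->
    (iint (fun x => (dist_compl Omega x * laplacian phi x)%:E) <= 0)%E.

(* Main.v *)
Require Import Defs.
From HB Require Import structures.
From mathcomp Require Import all_boot all_order all_algebra.
From mathcomp Require Import all_classical all_reals all_analysis.
From mathcomp Require Import ring lra.
Import Order.TTheory GRing.Theory Num.Theory.
Import numFieldNormedType.Exports.
Local Open Scope classical_set_scope.
Local Open Scope ring_scope.

(** Both halves rest on a smooth radial kernel K supported in the unit ball. Testing
    the distributional inequality against a suitable radial function shows that the
    average of d over x + h K is at most d(x) whenever h < d(x).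

    Inequality. Integrate the mean value inequality at x with weight |u| d^(1-s) and
    symmetrise over the pairs (x, x + hz): the variation of u contributes at most
    |u(x + hz) - u(x)| d^(1-s) (d(x + hz) - d(x))^+, while convexity of r^(1-s)
    yields (s-1) |u| d^(-s) ((d(x) - d(x + hz))^+)^2. Comparing d with the distance to
    a nearest point of the complement gives d(x + hz) <= d(x) + h e.z + O(h^2) for a
    unit vector e, so that at order h^2 the two sides are half the second moment of K
    times |grad u| d^(1-s) and (s-1) |u| d^(-s): the half comes from the positive
    parts, and no differentiability of d is used.

    Sharpness. In a half-space take a profile f of the distance t which rises on
    [1/4, 1] and falls on [T/4, T], times a wide lateral cut-off: integrating by parts,
    (s-1) times the integral of f t^(-s) is that of f' t^(1-s), and the falling part
    is negligible because its weight is of order T^(1-s). In general, blow up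
    Omega at a boundary point y touched by an interior ball. The rescaled distance is
    at least t - O(lambda), and its mean at a point of the inner normal is at most t;
    hence it converges to t in L^1 on the support of the test function. *)

Set Implicit Arguments.
Unset Strict Implicit.
Unset Printing Implicit Defensive.

(** * Integration of compactly supported continuous functions *)

Section CompactlySupported.
Context {R : realType}.
Implicit Types V W : normedModType R.

(** The formal test function [|u| d^(1-s)] is only Lipschitz, while the hypothesis admits smooth
    ones only. It is therefore used once, on radial functions, to give a pointwise inequality that
    can then be integrated against any continuous nonnegative weight. The radial function is found
    by prescribing its Laplacian as a difference of two rescaled copies of [K]: the averages of [d]
    decrease with the radius, and those of vanishing radius tend to [d(x)].

    Negative powers of [d] are truncated off the support of [u], so that every integrand is
    continuous with compact support. For such functions linearity, exchange of the order, affine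
    substitutions and integration by parts follow from primitives and uniform continuity, by
    induction on the dimension.

    In the blow-up the lower bound for the rescaled distance is pointwise, the upper bound holds
    only in mean. This suffices: the gradient integral needs the lower bound alone, and in the other
    integral the tangent line of [r^(-s)] makes the loss linear in the excess of the distance over
    [t]. *)

Definition proper V := forall M : R, compact [set x : V | `|x| <= M].

(** Compact support is expressed by a radius, which passes to slices and products by mere norm
    inequalities; together with [proper] it gives uniform continuity. *)
Definition cc V (f : V -> R) :=
  continuous f /\ exists M : R, forall x, M < `|x| -> f x = 0.

Lemma closed_norm_le V (M : R) : closed [set x : V | `|x| <= M].
Proof.
have -> : [set x : V | `|x| <= M] = (fun x : V => `|x|) @^-1` [set r : R | r <= M].
  by [].
by move/continuous_closedP: (@norm_continuous R V); apply; exact: closed_le.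
Qed.

Lemma proper_R : proper (R : normedModType R).
Proof.
move=> M; apply: (subclosed_compact _ (@segment_compact R (- M) M)).
  exact: closed_norm_le.
by move=> x /=; rewrite in_itv /= ler_norml.
Qed.

Lemma proper_rV n : proper ('rV[R]_n : normedModType R).
Proof.
move=> M; apply: bounded_closed_compact; last exact: closed_norm_le.
exists M; split; first exact: num_real.
by move=> x Mx y /= yM; apply: le_trans yM (ltW Mx).
Qed.

Lemma prod_norm_lt V W (p : V * W) (e : R) :
  (`|p| < e) = (`|p.1| < e) && (`|p.2| < e).
Proof. by rewrite prod_normE gt_max. Qed.

Lemma prod_norm_le V W (p : V * W) (e : R) :
  (`|p| <= e) = (`|p.1| <= e) && (`|p.2| <= e).
Proof. by rewrite prod_normE ge_max. Qed.

Lemma proper_prod V W : proper V -> proper W -> proper (V * W)%type.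
Proof.
move=> pV pW M.
have := compact_setX (pV M) (pW M).
congr compact; apply/seteqP; split => p /=; rewrite prod_norm_le.
  by case=> /= -> ->.
by move=> /andP[].
Qed.

Lemma continuousP_eps V W (f : V -> W) : continuous f <->
  (forall x (e : R), 0 < e -> exists2 d : R, 0 < d & forall y, `|x - y| < d -> `|f x - f y| < e).
Proof.
split=> [cf x e e0|H x].
  have /cvgrPdist_lt/(_ e e0) := cf x.
  by move=> /nbhs_normP[d /= d0 H]; exists d => // y /H.
apply/cvgrPdist_lt => e e0; have [d d0 Hd] := H x e e0.
by apply/nbhs_normP; exists d => //= y /Hd.
Qed.

(** Heine-Cantor on the ball of radius [M + 1]. The extra unit handles the rest: if [x] is outside
    this ball and [|x - y| < 1], then both points are outside the ball of radius [M], where [f]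
    vanishes. *)
Lemma cc_ucont V (f : V -> R) : proper V -> cc f -> forall e : R, 0 < e ->
  exists2 d : R, 0 < d & forall x y, `|x - y| < d -> `|f x - f y| < e.
Proof.
move=> pV [cf [M fM]] e e0.
have /compact_near_coveringP H := pV (M + 1).
have {}H := H R (0^'+) (fun d x => forall y, `|x - y| < d -> `|f x - f y| < e) _.
have /H : forall x, [set x : V | `|x| <= M + 1] x ->
    \forall x' \near x & i \near 0^'+, forall y, `|x' - y| < i -> `|f x' - f y| < e.
  move=> x _; have [d d0 Hd] := (continuousP_eps f).1 cf x (e / 2) (divr_gt0 e0 (ltr0Sn _ _)).
  have d2 : 0 < d / 2 by rewrite divr_gt0.
  near=> x' i => y /= xy.
  rewrite (splitr e) -(subrKA (f x)).
  have h1 : `|x - x'| < d / 2.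
    by near: x'; apply/nbhs_normP; exists (d / 2) => //=.
  have h2 : `|x' - y| < d / 2.
    apply: lt_le_trans xy _.
    by near: i; exact: nbhs_right_le.
  apply: le_lt_trans (ler_normD _ _) _; apply: ltrD.
    by rewrite distrC; apply: Hd; apply: lt_trans h1 _; rewrite ltr_pdivrMr // ltr_pMr // ltr1n.
  apply: Hd; rewrite (splitr d) -(subrKA x').
  by apply: le_lt_trans (ler_normD _ _) _; exact: ltrD.
move=> K; have [d [d0 Hd]] : exists d : R, 0 < d /\
   [set x : V | `|x| <= M + 1] `<=` (fun x => forall y, `|x - y| < d -> `|f x - f y| < e).
  have : \forall d \near (0:R)^'+, 0 < d /\ [set x : V | `|x| <= M + 1] `<=` (fun x => forall y, `|x - y| < d -> `|f x - f y| < e).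
    by near=> d; split; near: d => //; exact: nbhs_right_gt.
  by move=> /filter_ex.
exists (Num.min d 1); first by rewrite lt_min d0 ltr01.
move=> x y; rewrite lt_min => /andP[xyd xy1].
have [xM|xM] := leP `|x| (M + 1); first exact: Hd.
rewrite (fM x) ?(fM y) ?subrr ?normr0 //; last first.
  by apply: lt_trans xM; rewrite ltrDl.
have : `|x| <= `|x - y| + `|y| by rewrite -{1}(subrK y x) ler_normD.
lra.
Unshelve. all: by end_near. Qed.

(* [cvgD] and [cvgM] fail to infer the filter instance on ['rV[R]_n]; these
   versions over an abstract space do not have the problem. *)
Lemma cont_add (T : topologicalType) (f g : T -> R) :
  continuous f -> continuous g -> continuous (fun x => f x + g x).
Proof. by move=> cf cg x; apply: cvgD; [exact: cf|exact: cg]. Qed.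

Lemma cont_sub (T : topologicalType) (f g : T -> R) :
  continuous f -> continuous g -> continuous (fun x => f x - g x).
Proof. by move=> cf cg x; apply: cvgB; [exact: cf|exact: cg]. Qed.

Lemma cont_mul (T : topologicalType) (f g : T -> R) :
  continuous f -> continuous g -> continuous (fun x => f x * g x).
Proof. by move=> cf cg x; apply: cvgM; [exact: cf|exact: cg]. Qed.

Lemma cont_cst (T : topologicalType) (a : R) : continuous (fun _ : T => a).
Proof. by move=> x; exact: cvg_cst. Qed.

Lemma cont_max (T : topologicalType) (f g : T -> R) :
  continuous f -> continuous g -> continuous (fun x => Num.max (f x) (g x)).
Proof. by move=> cf cg x; apply: (@continuous_max R T f g); [exact: cf|exact: cg]. Qed.

Lemma cont_norm (T : topologicalType) (f : T -> R) :
  continuous f -> continuous (fun x => `|f x|).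
Proof. by move=> cf x; apply: (continuous_comp (cf x)); exact: norm_continuous. Qed.

Lemma cont_comp (T : topologicalType) (f : T -> R) (g : R -> R) :
  continuous f -> continuous g -> continuous (fun x => g (f x)).
Proof. by move=> cf cg x; apply: (continuous_comp (cf x)); exact: cg. Qed.

Lemma cont_sum (T : topologicalType) n (F : 'I_n -> T -> R) :
  (forall i, continuous (F i)) -> continuous (fun x => \sum_(i < n) F i x).
Proof.
elim: n F => [|n IH] F cF.
  by under eq_fun do rewrite big_ord0; exact: cont_cst.
by under eq_fun do rewrite big_ord_recl; apply: cont_add => //; exact: IH.
Qed.

Lemma cc_add V (f g : V -> R) : cc f -> cc g -> cc (fun x => f x + g x).
Proof.
move=> [cf [M fM]] [cg [N gN]]; split.
  by move=> x; apply: cvgD; [exact: cf|exact: cg].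
exists (Num.max M N) => x; rewrite gt_max => /andP[Mx Nx].
by rewrite fM // gN // addr0.
Qed.

Lemma cc_mulr V (f g : V -> R) : continuous f -> cc g -> cc (fun x => f x * g x).
Proof.
move=> cf [cg [N gN]]; split.
  by move=> x; apply: cvgM; [exact: cf|exact: cg].
by exists N => x Nx; rewrite gN // mulr0.
Qed.

Lemma cc_mull V (f g : V -> R) : cc f -> continuous g -> cc (fun x => f x * g x).
Proof.
move=> cf cg; have := cc_mulr cg cf; congr cc.
by apply/funext => x; rewrite mulrC.
Qed.

Lemma cc_scale V (a : R) (f : V -> R) : cc f -> cc (fun x => a * f x).
Proof. by move=> cf; apply: cc_mulr => // x; exact: cvg_cst. Qed.

Lemma cc_opp V (f : V -> R) : cc f -> cc (fun x => - f x).
Proof. by move=> /(cc_scale (-1)); congr cc; apply/funext => x; rewrite mulN1r. Qed.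

Lemma cc_sub V (f g : V -> R) : cc f -> cc g -> cc (fun x => f x - g x).
Proof. by move=> cf cg; apply: cc_add => //; apply: cc_opp. Qed.

Lemma cc0 V : cc (fun _ : V => 0).
Proof. by split; [move=> x; exact: cvg_cst | exists 0]. Qed.

(* The growth condition makes [g] a proper map. *)
Lemma cc_comp V W (f : V -> R) (g : W -> V) (A B : R) :
  cc f -> continuous g -> (forall w, `|w| <= A * `|g w| + B) -> 0 < A ->
  cc (fun w => f (g w)).
Proof.
move=> [cf [M fM]] cg H A0; split.
  by move=> x; apply: (continuous_comp (cg x)); exact: cf.
exists (A * M + B) => w Hw; apply: fM.
have := lt_le_trans Hw (H w).
by rewrite ltrD2r ltr_pM2l.
Qed.

(** Made for slices such as [t -> (v, t)] and for regroupings of coordinates: in the sup norm they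
    neither increase distances nor decrease norms. *)
Lemma cc_comp_isom V W (f : V -> R) (g : W -> V) : cc f ->
  (forall w w', `|g w - g w'| <= `|w - w'|) -> (forall w, `|w| <= `|g w|) ->
  cc (fun w => f (g w)).
Proof.
move=> cf g1 g2; apply: (@cc_comp V W f g 1 0) => // [|w].
  by apply/continuousP_eps => x e e0; exists e => // y; exact: le_lt_trans (g1 _ _).
by rewrite mul1r addr0.
Qed.

(** An integrable majorant: a uniform bound [e] on the ball of radius [M] becomes [e * bump M],
    whose integral is [e] times a constant. *)
Definition bump V (M : R) (x : V) : R := Num.max 0 (M + 1 - `|x|).

Lemma cc_bump V M : cc (@bump V M).
Proof.
split.
  move=> x; apply: (@continuous_max R V (fun=> 0) (fun x => M + 1 - `|x|)).
    exact: cvg_cst.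
  by apply: cvgB; [exact: cvg_cst | exact: norm_continuous].
by exists (M + 1) => x Mx; apply/max_idPl; rewrite subr_le0 ltW.
Qed.

Lemma bump_ge0 V M (x : V) : 0 <= bump M x.
Proof. by rewrite /bump le_max lexx. Qed.

Lemma bump_ge1 V M (x : V) : `|x| <= M -> 1 <= bump M x.
Proof. by move=> xM; rewrite /bump le_max; apply/orP; right; lra. Qed.

End CompactlySupported.

(** * Integrals over the line, computed by primitives *)

Section OneDimensional.
Context {R : realType}.
Implicit Types (h F : R -> R).

Local Notation mu := (@lebesgue_measure R).

Definition primitive F h := forall x : R, is_derive x 1 F (h x).

Definition J h : R := fine (\int[mu]_t (h t)%:E)%E.

Lemma is_derive_continuous F (f : R -> R) :
  primitive F f -> continuous F.
Proof.
move=> dF x; apply: differentiable_continuous; apply/derivable1_diffP.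
by case: (dF x).
Qed.

Lemma derivative_bound F (f : R -> R) (e x y : R) : primitive F f ->
  (forall z, `|x - z| <= `|x - y| -> `|f z| <= e) -> `|F x - F y| <= e * `|x - y|.
Proof.
move=> dF.
have H a b : a <= b -> exists2 c, a <= c <= b & F b - F a = f c * (b - a).
  move=> ab; have [|c + ?] := @MVT_segment R F f a b ab (fun x _ => dF x).
    by apply: continuous_subspaceT; exact: is_derive_continuous dF.
  by rewrite in_itv /=; exists c.
have [xy|/ltW yx] := leP x y => fe.
  have [c /andP[c1 c2] E] := H _ _ xy.
  rewrite distrC E normrM [X in _ * X]distrC; apply: ler_wpM2r => //; apply: fe.
  by rewrite !ler0_norm; lra.
have [c /andP[c1 c2] E] := H _ _ yx.
rewrite E normrM; apply: ler_wpM2r => //; apply: fe.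
by rewrite !ger0_norm; lra.
Qed.

Lemma derivative_nondecreasing F (f : R -> R) (a b : R) : primitive F f ->
  (forall x, a <= x <= b -> 0 <= f x) -> a <= b -> F a <= F b.
Proof.
move=> dF f0 ab.
have [|c cab E] := @MVT_segment R F f a b ab (fun x _ => dF x).
  by apply: continuous_subspaceT; exact: is_derive_continuous dF.
by rewrite -subr_ge0 E mulr_ge0 // ?subr_ge0 // f0 //; move: cab; rewrite in_itv.
Qed.

Lemma derivative_constant F (f : R -> R) (a b : R) : primitive F f ->
  (forall x, a <= x <= b -> f x = 0) -> a <= b -> F a = F b.
Proof.
move=> dF f0 ab; apply/eqP; rewrite eq_le; apply/andP; split.
  by apply: derivative_nondecreasing dF _ ab => x /f0 ->.
rewrite -lerN2; apply: (@derivative_nondecreasing (fun x => - F x) (fun x => - f x)) => //.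
  by move=> x; apply: is_deriveN; exact: dF.
by move=> x /f0 ->; rewrite oppr0.
Qed.

Lemma cc_integrable h : cc h -> mu.-integrable setT (EFin \o h).
Proof.
move=> [ch [M hM]].
have -> : EFin \o h = (EFin \o h) \_ `[- M, M].
  apply/funext => x; rewrite patchE; case: ifPn => //=.
  rewrite notin_setE /= in_itv /= -ler_norml => /negP.
  by rewrite -ltNge => /hM ->.
apply: (integrable_mkcond (mu := mu) (EFin \o h) (measurable_itv `[- M, M])).1.
apply: continuous_compact_integrable; first exact: segment_compact.
exact: continuous_subspaceT.
Qed.

Lemma integral_cc h F (M : R) : cc h -> (forall x : R, M < `|x| -> h x = 0) -> 0 < M ->
  primitive F h ->
  (\int[mu]_t (h t)%:E = (F M - F (- M))%:E)%E.
Proof.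
move=> [ch _] hM M0 dF.
have -> : (\int[mu]_t (h t)%:E = \int[mu]_(t in `[(- M)%R, M]) (h t)%:E)%E.
  rewrite [RHS]integral_mkcond; apply: eq_integral => x _; rewrite patchE.
  case: ifPn => //=.
  rewrite notin_setE /= in_itv /= -ler_norml => /negP.
  by rewrite -ltNge => /hM ->.
rewrite (@continuous_FTC2 _ h F) //.
- by lra.
- exact: continuous_subspaceT.
- have cF := is_derive_continuous dF.
  split; first by move=> x _; case: (dF x).
    exact: cvg_at_right_filter (cF _).
  exact: cvg_at_left_filter (cF _).
- by move=> x _; rewrite derive1E; case: (dF x).
Qed.

Lemma J_FTC h F (M : R) : cc h -> (forall x : R, M < `|x| -> h x = 0) -> 0 < M ->
  primitive F h -> J h = F M - F (- M).
Proof. by move=> ch hM M0 dF; rewrite /J (integral_cc ch hM M0 dF). Qed.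

(** When [h] vanishes on one side of [c], the normalisation makes the primitive vanish there too. *)
Lemma cc_primitive h (c : R) : cc h -> exists F, primitive F h /\ F c = 0.
Proof.
move=> ch.
pose G x := \int[mu]_(t in `]-oo, x]) h t.
have dG : primitive G h.
  move=> x.
  have ih : mu.-integrable `]-oo, x + 1] (EFin \o h).
    by apply: integrableS (cc_integrable ch) => //; exact: subsetT.
  have [] := @continuous_FTC1 R h (BInfty _ true) x (x + 1) _ ih _ (ch.1 x).
  - by rewrite ltrDl.
  - exact: ltNyr.
  - by move=> d <-; rewrite derive1E; exact: derivableP.
exists (fun x => G x - G c); split; last by rewrite subrr.
move=> x; rewrite -[h x]subr0.
have := @is_deriveB _ _ _ G (cst (G c)) x 1 _ _ (dG x) (is_derive_cst _ _ _).
by congr is_derive.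
Qed.

(** All large [N] are allowed, so that two functions can be integrated over a common interval. *)
Lemma cc_primitive_bound h : cc h -> exists F (M : R),
  [/\ 0 < M, primitive F h & forall N, M <= N ->
      (forall x : R, N < `|x| -> h x = 0) /\ J h = F N - F (- N)].
Proof.
move=> ch; have [F [dF _]] := cc_primitive 0 ch.
have [_ [M hM]] := ch.
exists F, (Num.max M 1); split => //; first by rewrite lt_max ltr01 orbT.
move=> N; rewrite ge_max => /andP[MN N1].
have hN x : N < `|x| -> h x = 0 by move=> Nx; apply: hM; exact: le_lt_trans Nx.
split=> //; apply: J_FTC => //; exact: lt_le_trans N1.
Qed.

Lemma integral_ccE h : cc h -> (\int[mu]_t (h t)%:E = (J h)%:E)%E.
Proof.
move=> ch; have [F [M [M0 dF /(_ M (lexx _))[hM _]]]] := cc_primitive_bound ch.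
by rewrite /J (integral_cc ch hM M0 dF).
Qed.

Lemma J_add h h' : cc h -> cc h' -> J (fun x => h x + h' x) = J h + J h'.
Proof.
move=> ch ch'.
have [F [M [M0 dF HF]]] := cc_primitive_bound ch.
have [G [N [N0 dG HG]]] := cc_primitive_bound ch'.
pose L := Num.max M N.
have [hL ->] := HF L (ltac:(by rewrite /L le_max lexx)).
have [h'L ->] := HG L (ltac:(by rewrite /L le_max lexx orbT)).
rewrite (@J_FTC _ (fun x => F x + G x) L); first ring.
- exact: cc_add.
- by move=> x xL; rewrite hL // h'L // addr0.
- by rewrite /L lt_max M0.
- by move=> x; exact: is_deriveD.
Qed.

Lemma J_scale a h : cc h -> J (fun x => a * h x) = a * J h.
Proof.
move=> ch.
have [F [M [M0 dF /(_ M (lexx _))[hM ->]]]] := cc_primitive_bound ch.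
rewrite (@J_FTC _ (fun x => a * F x) M) //; first ring.
- exact: cc_scale.
- by move=> x xL; rewrite hM // mulr0.
- by move=> x; exact: is_deriveZ.
Qed.

Lemma J_ge0 h : cc h -> (forall x, 0 <= h x) -> 0 <= J h.
Proof.
move=> ch h0.
have [F [M [M0 dF /(_ M (lexx _))[hM ->]]]] := cc_primitive_bound ch.
rewrite subr_ge0; apply: derivative_nondecreasing dF _ _ => //; lra.
Qed.

(** If the integral were zero, the nondecreasing primitive would be constant on [[-M, M]]; the mean
    value theorem on a short interval next to [x0], on the side of the origin, would then give a
    zero of [h] where [h] is positive. *)
Lemma J_gt0 h x0 : cc h -> (forall x, 0 <= h x) -> 0 < h x0 -> 0 < J h.
Proof.
move=> ch h0 hx0.
have [F [M [M0 dF /(_ M (lexx _))[hM E]]]] := cc_primitive_bound ch.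
rewrite lt_neqAle J_ge0 // andbT; apply/eqP => J0.
have x0M : - M <= x0 <= M.
  by rewrite -ler_norml leNgt; apply/negP => /hM x00; rewrite x00 ltxx in hx0.
have MM : - M <= M by lra.
have FE : F M = F (- M) by apply/eqP; rewrite -subr_eq0 -E -J0.
have Fc x : - M <= x <= M -> F x = F M.
  move=> /andP[x1 x2]; apply/eqP; rewrite eq_le; apply/andP; split.
    exact: derivative_nondecreasing dF _ _.
  by rewrite FE; exact: derivative_nondecreasing dF _ _.
have cF := (continuousP_eps h).1 ch.1 x0 (h x0) hx0.
have [d d0 Hd] := cF.
have hd y : `|x0 - y| < d -> 0 < h y.
  by move=> /Hd; rewrite ltr_norml => /andP[_]; lra.
have [y [z [yz yM zM xz]]] : exists y z, [/\ y < z, - M <= y <= M, - M <= z <= M &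
    forall t, y <= t <= z -> `|x0 - t| < d].
  pose r := Num.min (d / 2) M.
  have r0 : 0 < r by rewrite /r lt_min M0 andbT; lra.
  have rd : r <= d / 2 by rewrite /r ge_min lexx.
  have rM : r <= M by rewrite /r ge_min lexx orbT.
  have [x00|x00] := leP x0 0.
    by exists x0, (x0 + r); split; [lra|lra|lra|move=> t; rewrite ltr_norml; lra].
  by exists (x0 - r), x0; split; [lra|lra|lra|move=> t; rewrite ltr_norml; lra].
have [|c + E2] := @MVT R F h y z yz (fun x _ => dF x).
  by apply: continuous_subspaceT; exact: is_derive_continuous dF.
rewrite in_itv /= => /andP[c1 c2].
have : 0 < h c by apply: hd; apply: xz; rewrite !ltW.
move: E2; rewrite !Fc // subrr => /esym/eqP.
by rewrite mulf_eq0 subr_eq0 (gt_eqF yz) orbF => /eqP ->; rewrite ltxx.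
Qed.

(** [F] is constant on either side of the support, so the endpoints can be moved to a symmetric
    interval [[-N, N]], with [N] below the midpoints of [M] with [- a] and with [b]. *)
Lemma J_FTC2 h F (M a b : R) : cc h -> (forall x : R, M < `|x| -> h x = 0) ->
  0 <= M -> primitive F h -> a < - M -> M < b -> J h = F b - F a.
Proof.
move=> ch hM M0 dF aM Mb.
pose N := Num.min ((M - a) / 2) ((M + b) / 2).
have NM : M < N by rewrite /N lt_min; lra.
have Na : N <= (M - a) / 2 by rewrite /N ge_min lexx.
have Nb : N <= (M + b) / 2 by rewrite /N ge_min lexx orbT.
rewrite (@J_FTC _ F N) //; last 2 first.
- by move=> x xN; apply: hM; exact: lt_trans xN.
- exact: le_lt_trans NM.
have -> : F b = F N.
  apply/esym/(derivative_constant dF) => [x xN|]; last lra.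
  apply: hM; rewrite ger0_norm; lra.
have -> // : F a = F (- N).
apply: (derivative_constant dF) => [x xN|]; last lra.
apply: hM; rewrite ler0_norm; lra.
Qed.

Lemma cc_bound_gt0 h : cc h -> exists2 M : R, 0 < M & forall x : R, M < `|x| -> h x = 0.
Proof.
by move=> /cc_primitive_bound[F [M [M0 _ /(_ _ (lexx _))[hM _]]]]; exists M.
Qed.

Lemma primitive_comp F h (c a : R) : primitive F h ->
  primitive (fun x => F (c * x + a)) (fun x => c * h (c * x + a)).
Proof.
move=> dF x; rewrite mulrC.
have -> : (fun x => F (c * x + a)) = F \o (fun x => c * x + a) by [].
apply: is_derive1_comp; first exact: dF.
have := @is_deriveD R R R (fun x => c * x) (cst a) x 1 (c * 1) 0 _ (is_derive_cst _ _ _).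
rewrite addr0 mulr1; apply.
by rewrite -[X in is_derive _ _ _ X]mulr1; exact: (@is_deriveZ R R R id c x 1 1 (is_derive_id _ _)).
Qed.

(** A primitive is [F (c x + a) / c]. For negative [c] the endpoints are exchanged, whence the
    absolute value. *)
Lemma J_affine (c a : R) h : cc h -> c != 0 -> J (fun x => h (c * x + a)) = `|c|^-1 * J h.
Proof.
move=> ch c0.
have [M M0 hM] := cc_bound_gt0 ch.
have [F [dF _]] := cc_primitive 0 ch.
(* With this choice [|c| N - |a| = M + 1], so that [c x + a] sends [N] and [- N] beyond the support
   of [h], on opposite sides. *)
pose N := (M + `|a| + 1) / `|c|.
have ac : 0 < `|c| by rewrite normr_gt0.
have a0 := normr_ge0 a.
have N1 := ler_norm a; have N2 := ler_norm (- a); rewrite normrN in N2.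
have cN : `|c| * N = M + `|a| + 1 by rewrite /N mulrC divfK // gt_eqF.
rewrite (@J_FTC _ (fun x => c^-1 * F (c * x + a)) N).
- rewrite -mulrBr.
  have [c00|c00] := ltP 0 c.
    rewrite gtr0_norm // in cN *; congr (_ * _); apply/esym.
    by apply: (J_FTC2 ch hM (ltW M0) dF); rewrite ?mulrN cN; lra.
  rewrite ler0_norm // in cN *; rewrite invrN mulNr -[RHS]mulrN -[F _ - _]opprB; congr (_ * - _); apply/esym.
  by apply: (J_FTC2 ch hM (ltW M0) dF); move: cN; rewrite ?mulrN mulNr => cN; lra.
- apply: (@cc_comp _ _ _ h (fun x => c * x + a) (`|c|^-1) (`|a| / `|c|)) => //.
  + move=> x; apply: cvgD; last exact: cvg_cst.
    by apply: cvgM; [exact: cvg_cst|exact: cvg_id].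
  + move=> x; rewrite mulrC -mulrDl ler_pdivlMr // mulrC -normrM.
    have {1}-> : c * x = (c * x + a) + (- a) by ring.
    by rewrite -[X in _ <= _ + X]normrN ler_normD.
  + by rewrite invr_gt0.
- move=> x Nx; apply: hM.
  have : `|c| * N < `|c * x + a| + `|a|.
    apply: (@lt_le_trans _ _ (`|c * x|)); first by rewrite normrM ltr_pM2l.
    have {1}-> : c * x = (c * x + a) + (- a) by ring.
    by rewrite -[X in _ <= _ + X]normrN ler_normD.
  by rewrite cN; lra.
- by rewrite /N divr_gt0 //; lra.
- move=> x.
  have := @is_deriveZ R R R (fun x => F (c * x + a)) c^-1 x 1 _ (primitive_comp c a dF x).
  by rewrite /GRing.scale /= mulrA mulVf // mul1r.
Qed.

Lemma J_sub h h' : cc h -> cc h' -> J (fun x => h x - h' x) = J h - J h'.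
Proof.
move=> ch ch'; rewrite -mulN1r -J_scale // -J_add //; last exact: cc_scale.
by congr J; apply/funext => x; rewrite mulN1r.
Qed.

Lemma J_le h h' : cc h -> cc h' -> (forall x, h x <= h' x) -> J h <= J h'.
Proof.
move=> ch ch' H; rewrite -subr_ge0 -J_sub //; apply: J_ge0; first exact: cc_sub.
by move=> x; rewrite subr_ge0.
Qed.

Lemma J_norm_le h h' : cc h -> cc h' -> (forall x, `|h x| <= h' x) -> `|J h| <= J h'.
Proof.
move=> ch ch' H; rewrite ler_norml; apply/andP; split; last first.
  by apply: J_le => // x; apply: le_trans (H x); exact: ler_norm.
rewrite lerNl -mulN1r -J_scale //; apply: J_le => //; first exact: cc_scale.
by move=> x; apply: le_trans (H x); rewrite mulN1r -normrN ler_norm.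
Qed.

Section ParametricIntegral.
Variables (V : normedModType R) (f : V * R -> R).
Hypotheses (pV : proper V) (cf : cc f).

Lemma cc_slice_r (v : V) : cc (fun t => f (v, t)).
Proof.
apply: (@cc_comp _ _ _ f (fun t => (v, t)) 1 0) => //.
- apply/continuousP_eps => t e e0; exists e => // s ts.
  by rewrite prod_norm_lt /= subrr normr0 e0.
- by move=> t; rewrite mul1r addr0 prod_normE /= le_max lexx orbT.
Qed.

(** By uniform continuity two slices with close parameters differ by at most a small multiple of a
    fixed [bump]. *)
Lemma cc_J_param : cc (fun v => J (fun t => f (v, t))).
Proof.
have [M fM] := cf.2.
split; last first.
  exists M => v vM.
  have -> : (fun t : R => f (v, t)) = (fun=> 0 * 0).
    apply/funext => t; rewrite mul0r fM // prod_normE /=.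
    by rewrite lt_max vM.
  by rewrite J_scale ?mul0r //; exact: cc0.
apply/continuousP_eps => v e e0.
pose b := @bump R R M.
have cb : cc b := @cc_bump R R M.
have Jb : 0 <= J b by apply: J_ge0 => // x; exact: bump_ge0.
have e'0 : 0 < e / (J b + 1) by rewrite divr_gt0 // ltr_wpDl.
have [d d0 Hd] := cc_ucont (proper_prod pV (@proper_R R)) cf e'0.
exists d => // w vw.
rewrite -J_sub; try exact: cc_slice_r.
have : `|J (fun t => f (v, t) - f (w, t))| <= J (fun t => e / (J b + 1) * b t).
  apply: J_norm_le => [||t]; [exact: cc_sub (cc_slice_r _) (cc_slice_r _)|exact: cc_scale|].
  have [tM|tM] := leP `|t| M.
    apply: (@le_trans _ _ (e / (J b + 1))).
      apply: ltW; apply: Hd; rewrite prod_norm_lt /= subrr normr0 d0 andbT.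
      exact: vw.
    by apply: ler_peMr; [exact: ltW|exact: bump_ge1].
  rewrite !fM ?subrr ?normr0 ?prod_normE /= ?lt_max ?tM ?orbT //.
  by rewrite mulr_ge0 ?bump_ge0 // ltW.
move=> /le_lt_trans; apply.
rewrite J_scale // mulrAC ltr_pdivrMr; last by rewrite ltr_wpDl.
by rewrite ltr_pM2l //; lra.
Qed.

End ParametricIntegral.

Lemma is_deriveP_eps (V : normedModType R) (F : V -> R) (a v : V) (l : R) :
  (forall e : R, 0 < e -> exists2 d : R, 0 < d &
     forall k : R, `|k| < d -> `|F (a + k *: v) - F a - k * l| <= e * `|k|) ->
  is_derive a v F l.
Proof.
move=> H.
have C : (fun h : R => h^-1 *: ((F \o shift a) (h *: v) - F a)) @ (0:R)^' --> l.
  apply/cvgrPdist_lt => e e0.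
  have [d d0 Hd] := H (e / 2) (divr_gt0 e0 (ltr0Sn _ _)).
  near=> h.
  have h0 : h != 0 by near: h; exact: nbhs_dnbhs_neq.
  have hd : `|h| < d.
    near: h; apply: (@dnbhs0_lt _ R); exact: d0.
  have HH := Hd h hd.
  rewrite distrC /= [h *: v + a]addrC -[_ *: _]/(h^-1 * (F (a + h *: v) - F a)).
  have -> : h^-1 * (F (a + h *: v) - F a) - l = h^-1 * (F (a + h *: v) - F a - h * l).
    by rewrite [RHS]mulrBr mulKf.
  rewrite normrM normfV mulrC ltr_pdivrMr ?normr_gt0 //.
  apply: le_lt_trans HH _; rewrite ltr_pM2r ?normr_gt0 //; lra.
apply: DeriveDef; first by apply/cvg_ex; exists l.
exact: cvg_lim C.
Unshelve. all: by end_near. Qed.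

(** Directional derivatives are derivatives along a line: this gives access to the mean value
    theorem and to the chain rule in one variable. *)
Lemma is_derive_line (V : normedModType R) (f : V -> R) (g : R -> R) (a v : V) (s l : R) :
  (forall h : R, g (h + s) = f (h *: v + a)) -> is_derive a v f l <-> is_derive s 1 g l.
Proof.
move=> gf.
have gs : g s = f a by rewrite -[s]add0r gf scale0r add0r.
have E : (fun h : R => h^-1 *: ((f \o shift a) (h *: v) - f a)) =
         (fun h : R => h^-1 *: ((g \o shift s) (h *: 1) - g s)).
  by apply/funext => h /=; rewrite gs -[h *: 1]/(h * 1) mulr1 gf.
split=> -[d <-].
  by apply: DeriveDef; [rewrite /derivable -E|rewrite /derive -E].
by apply: DeriveDef; [rewrite /derivable E|rewrite /derive E].
Qed.

(** Fubini by differentiation in the upper limit. If [P t a] is the integral of [f (., t)] up to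
    [a], then the integral of [P t a] over [t] has derivative [J (fun t => f (a, t))] in [a];
    evaluating between [- N] and [N] gives both iterated integrals. *)
Lemma J_exchange (f : R * R -> R) : cc f ->
  J (fun s => J (fun t => f (s, t))) = J (fun t => J (fun s => f (s, t))).
Proof.
move=> cf.
have cfl t : cc (fun s => f (s, t)).
  apply: (cc_comp_isom cf) => [s s'|s]; rewrite prod_normE /=.
    by rewrite subrr normr0 ge_max lexx normr_ge0.
  by rewrite le_max lexx.
have cfr := cc_slice_r cf.
have [M0 fM0] := cf.2.
pose M := Num.max M0 1.
have M1 : 1 <= M by rewrite /M le_max lexx orbT.
have fM p : M < `|p| -> f p = 0 by move=> pM; apply: fM0; apply: le_lt_trans pM; rewrite /M le_max lexx.
have fl s t : M < `|s| -> f (s, t) = 0 by move=> sM; apply: fM; rewrite prod_normE lt_max sM.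
have fr s t : M < `|t| -> f (s, t) = 0 by move=> sM; apply: fM; rewrite prod_normE lt_max sM orbT.
pose N := M + 1.
have [P HP] := choice (fun t => cc_primitive (- N) (cfl t)).
have dP t : primitive (P t) (fun s => f (s, t)) := (HP t).1.
have PN t : P t (- N) = 0 := (HP t).2.
have pR := @proper_R R; have pRR := proper_prod pR pR.
have cP a : cc (fun t => P t a).
  split; last first.
    exists M => t tM.
    have := @derivative_bound (P t) (fun s => f (s, t)) 0 a (- N) (dP t).
    rewrite PN mul0r subr0 => H; apply/eqP; rewrite -normr_le0; apply: H => z _.
    by rewrite fr // normr0.
  apply/continuousP_eps => t e e0.
  have K0 : 0 < `|a - - N| + 1 by rewrite ltr_wpDl.
  have [d d0 Hd] := cc_ucont pRR cf (divr_gt0 e0 K0).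
  exists d => // t' tt'.
  have dPP : primitive (fun s => P t s - P t' s) (fun s => f (s, t) - f (s, t')).
    by move=> s; apply: is_deriveB; exact: dP.
  have := @derivative_bound _ _ (e / (`|a - - N| + 1)) a (- N) dPP.
  rewrite !PN subrr subr0 => /(_ _)/le_lt_trans; apply.
    move=> z _; apply/ltW/Hd; rewrite prod_norm_lt /= subrr normr0 d0; exact: tt'.
  by rewrite mulrAC ltr_pdivrMr // ltr_pM2l //; lra.
pose b := @bump R R M.
have cb : cc b := @cc_bump R R M.
have Jb : 0 <= J b by apply: J_ge0 => // x; exact: bump_ge0.
have dA : primitive (fun a => J (fun t => P t a)) (fun a => J (fun t => f (a, t))).
  move=> a; apply: is_deriveP_eps => e e0.
  have e'0 : 0 < e / (J b + 1) by rewrite divr_gt0 // ltr_wpDl.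
  have [d d0 Hd] := cc_ucont pRR cf e'0.
  exists d => // k kd; rewrite -[k *: 1]/(k * 1) mulr1.
  rewrite -J_sub // -J_scale // -J_sub //; [|exact: cc_sub|exact: cc_scale].
  apply: (@le_trans _ _ (J (fun t => e / (J b + 1) * `|k| * b t))); last first.
    rewrite J_scale // mulrAC ler_wpM2r // mulrAC ler_pdivrMr; last by rewrite ltr_wpDl.
    by rewrite ler_wpM2l ?ltW //; lra.
  apply: J_norm_le; [by apply: cc_sub; [exact: cc_sub|exact: cc_scale]|exact: cc_scale|].
  move=> t; have [tM|tM] := leP `|t| M; last first.
    have H0 c : P t c = 0.
      have := @derivative_bound (P t) (fun s => f (s, t)) 0 c (- N) (dP t).
      rewrite PN mul0r subr0 => H; apply/eqP; rewrite -normr_le0; apply: H => z _.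
      by rewrite fr // normr0.
    rewrite !H0 fr // mulr0 !subrr normr0 mulr_ge0 ?bump_ge0 //.
    by rewrite mulr_ge0 // ltW.
  apply: (@le_trans _ _ (e / (J b + 1) * `|k|)); last first.
    by apply: ler_peMr; [rewrite mulr_ge0 // ltW|exact: bump_ge1].
  (* Subtracting the linear part leaves a function whose derivative is an oscillation of [f], small
     by uniform continuity. *)
  have dG : primitive (fun s => P t s - f (a, t) * s) (fun s => f (s, t) - f (a, t) * 1).
    by move=> s; apply: (@is_deriveB R R R (P t) (fun s => f (a, t) * s) s 1 _ _ (dP t s)).
  have := @derivative_bound _ _ (e / (J b + 1)) a (a + k) dG.
  have -> : a - (a + k) = - k by ring.
  rewrite normrN distrC.
  have -> : P t (a + k) - f (a, t) * (a + k) - (P t a - f (a, t) * a) =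
    P t (a + k) - P t a - k * f (a, t) by ring.
  apply=> z zk; rewrite mulr1; apply/ltW/Hd.
  by rewrite prod_norm_lt /= subrr normr0 d0 andbT distrC; exact: le_lt_trans kd.
have N0 : 0 < N by rewrite /N; lra.
rewrite (@J_FTC _ _ N (cc_J_param pR cf) _ N0 dA); last first.
  move=> s sN; have -> : (fun t => f (s, t)) = (fun=> 0 * 0).
    by apply/funext => t; rewrite fl ?mul0r //; rewrite /N in sN; lra.
  by rewrite J_scale ?mul0r //; exact: cc0.
have E t : J (fun s => f (s, t)) = P t N - P t (- N).
  by apply: (J_FTC (cfl t) _ N0 (dP t)) => s sN; apply: fl; rewrite /N in sN; lra.
have -> : (fun t => J (fun s => f (s, t))) = (fun t => P t N - P t (- N)).
  by apply/funext.
by rewrite J_sub.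
Qed.

End OneDimensional.

(** * Iterated integrals over R^n *)

Section MultiDimensional.
Context {R : realType}.

Lemma rV_norm_le n (x : 'rV[R]_n) (e : R) : 0 <= e ->
  (`|x| <= e) = [forall i, `|x ord0 i| <= e].
Proof.
move=> e0; rewrite /Num.Def.normr /= mx_normrE; apply/idP/forallP => H.
  move=> i; apply: le_trans H.
  exact: (@le_bigmax_cond _ _ _ 0 (ord0, i) xpredT (fun k => `|x k.1 k.2|)).
by apply/bigmax_leP; split => // -[i j] _ /=; rewrite (ord1 i); exact: H.
Qed.

Lemma rV_coord_le n (x : 'rV[R]_n) i : `|x ord0 i| <= `|x|.
Proof. by have := rV_norm_le x (normr_ge0 x); rewrite lexx => /esym/forallP. Qed.

Lemma vcons0E n t (y : 'rV[R]_n) : vcons t y ord0 ord0 = t.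
Proof. by rewrite mxE unlift_none. Qed.

Lemma vconsSE n t (y : 'rV[R]_n) i : vcons t y ord0 (lift ord0 i) = y ord0 i.
Proof. by rewrite mxE liftK. Qed.

Lemma vcons_norm n t (y : 'rV[R]_n) : `|vcons t y| = Num.max `|t| `|y|.
Proof.
apply/eqP; rewrite eq_le; apply/andP; split.
  rewrite rV_norm_le; last by rewrite le_max normr_ge0.
  apply/forallP => i; case: (unliftP ord0 i) => [j|] ->.
    by rewrite vconsSE le_max rV_coord_le orbT.
  by rewrite vcons0E le_max lexx.
rewrite ge_max -{1}(vcons0E t y) rV_coord_le /= rV_norm_le //.
by apply/forallP => i; rewrite -(vconsSE t y) rV_coord_le.
Qed.

Lemma vconsD n t s (y z : 'rV[R]_n) : vcons t y + vcons s z = vcons (t + s) (y + z).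
Proof.
by apply/rowP => i; rewrite !mxE; case: unlift => // j; rewrite mxE.
Qed.

Lemma vconsZ n c t (y : 'rV[R]_n) : c *: vcons t y = vcons (c * t) (c *: y).
Proof.
by apply/rowP => i; rewrite !mxE; case: unlift => // j; rewrite mxE.
Qed.

Lemma vconsB n t s (y z : 'rV[R]_n) : vcons t y - vcons s z = vcons (t - s) (y - z).
Proof. by rewrite -scaleN1r vconsZ vconsD mulN1r scaleN1r. Qed.

Lemma vconsP n (x : 'rV[R]_n.+1) : exists t y, x = vcons t y.
Proof.
exists (x ord0 ord0), (\row_i x ord0 (lift ord0 i)).
by apply/rowP => i; rewrite mxE; case: unliftP => [j|] -> //; rewrite mxE.
Qed.

(** The real-valued counterpart of [iint]; [iintE] identifies the two on [cc]. *)
Fixpoint I n : ('rV[R]_n -> R) -> R :=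
  match n with
  | 0 => fun f => f 0
  | m.+1 => fun f => J (fun t => @I m (fun y => f (vcons t y)))
  end.

(** The parameter space is arbitrary because the induction moves the first integration variable into
    it. *)
Lemma cc_I_param n (V : normedModType R) (f : V * 'rV[R]_n -> R) :
  proper V -> cc f -> cc (fun v => I (fun y => f (v, y))).
Proof.
elim: n V f => [|n IH] V f pV cf /=.
  apply: (cc_comp_isom cf) => [w w'|w]; rewrite prod_normE /=.
    by rewrite subrr normr0 ge_max lexx normr_ge0.
  by rewrite le_max lexx.
apply: (@cc_J_param R V (fun p => I (fun y => f (p.1, vcons p.2 y)))) => //.
apply: (IH (V * R)%type (fun q => f (q.1.1, vcons q.1.2 q.2))).
  by apply: proper_prod => //; exact: proper_R.
apply: (cc_comp_isom cf) => [w w'|w]; rewrite !prod_normE /=.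
  by rewrite vconsB vcons_norm maxA.
by rewrite vcons_norm maxA.
Qed.

Lemma cc_vcons n (f : 'rV[R]_n.+1 -> R) : cc f ->
  cc (fun p : R * 'rV[R]_n => f (vcons p.1 p.2)).
Proof.
move=> cf; apply: (cc_comp_isom cf) => [w w'|w]; rewrite ?prod_normE /=.
  by rewrite vconsB vcons_norm.
by rewrite vcons_norm.
Qed.

Lemma cc_I_inner n (f : 'rV[R]_n.+1 -> R) : cc f ->
  cc (fun t => I (fun y => f (vcons t y))).
Proof. by move=> /cc_vcons; apply: cc_I_param; exact: proper_R. Qed.

Lemma cc_slice n (f : 'rV[R]_n.+1 -> R) t : cc f -> cc (fun y => f (vcons t y)).
Proof.
move=> cf; apply: (cc_comp_isom cf) => [w w'|w].
  by rewrite vconsB vcons_norm subrr normr0 ge_max lexx normr_ge0.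
by rewrite vcons_norm le_max lexx orbT.
Qed.

Lemma iintE n (f : 'rV[R]_n -> R) : cc f -> iint (fun x => (f x)%:E) = (I f)%:E.
Proof.
elim: n f => [//|n IH] f cf /=.
rewrite -integral_ccE; last exact: cc_I_inner.
by apply: eq_integral => t _; apply: IH; exact: cc_slice.
Qed.

Lemma I_add n (f g : 'rV[R]_n -> R) : cc f -> cc g ->
  I (fun x => f x + g x) = I f + I g.
Proof.
elim: n f g => [//|n IH] f g cf cg /=.
rewrite -J_add; [|exact: cc_I_inner..].
by congr J; apply/funext => t; rewrite IH //; exact: cc_slice.
Qed.

Lemma I_scale n a (f : 'rV[R]_n -> R) : cc f -> I (fun x => a * f x) = a * I f.
Proof.
elim: n f => [//|n IH] f cf /=.
rewrite -J_scale; last exact: cc_I_inner.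
by congr J; apply/funext => t; rewrite IH //; exact: cc_slice.
Qed.

Lemma I_ge0 n (f : 'rV[R]_n -> R) : cc f -> (forall x, 0 <= f x) -> 0 <= I f.
Proof.
elim: n f => [f _|n IH f cf f0 /=]; first exact.
by apply: J_ge0 => [|t]; [exact: cc_I_inner|apply: IH => //; exact: cc_slice].
Qed.

Lemma I_gt0 n (f : 'rV[R]_n -> R) x0 : cc f -> (forall x, 0 <= f x) -> 0 < f x0 -> 0 < I f.
Proof.
elim: n f x0 => [f x0 _ _|n IH f x0 cf f0 /=]; first by rewrite (thinmx0 x0).
have [t [y ->]] := vconsP x0 => H.
apply: (@J_gt0 _ _ t); first exact: cc_I_inner.
  by move=> s; apply: I_ge0 => //; exact: cc_slice.
by apply: (IH _ y) => //; exact: cc_slice.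
Qed.

Lemma I_sub n (f g : 'rV[R]_n -> R) : cc f -> cc g ->
  I (fun x => f x - g x) = I f - I g.
Proof.
move=> cf cg; rewrite -mulN1r -I_scale // -I_add //; last exact: cc_scale.
by congr I; apply/funext => x; rewrite mulN1r.
Qed.

Lemma I_0 n : I (fun _ : 'rV[R]_n => 0) = 0.
Proof.
have -> : (fun _ : 'rV[R]_n => 0) = (fun _ : 'rV[R]_n => 0 * 0 :> R).
  by apply/funext => x; rewrite mul0r.
by rewrite (@I_scale _ 0 (fun=> 0)) ?mul0r //; exact: cc0.
Qed.

Lemma cc_sum n (V : normedModType R) (F : 'I_n -> V -> R) :
  (forall i, cc (F i)) -> cc (fun x => \sum_(i < n) F i x).
Proof.
elim: n F => [|n IH] F cF.
  by under eq_fun do rewrite big_ord0; exact: cc0.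
under eq_fun do rewrite big_ord_recl.
by apply: cc_add => //; exact: IH.
Qed.

Lemma I_sum n m (F : 'I_m -> 'rV[R]_n -> R) : (forall i, cc (F i)) ->
  I (fun x => \sum_(i < m) F i x) = \sum_(i < m) I (F i).
Proof.
elim: m F => [|m IH] F cF.
  by under eq_fun do rewrite big_ord0; rewrite big_ord0 I_0.
under eq_fun do rewrite big_ord_recl.
by rewrite I_add // ?big_ord_recl ?IH //; exact: cc_sum.
Qed.

Lemma I_le n (f g : 'rV[R]_n -> R) : cc f -> cc g -> (forall x, f x <= g x) -> I f <= I g.
Proof.
move=> cf cg H; rewrite -subr_ge0 -I_sub //; apply: I_ge0; first exact: cc_sub.
by move=> x; rewrite subr_ge0.
Qed.

Lemma I_norm_le n (f g : 'rV[R]_n -> R) : cc f -> cc g ->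
  (forall x, `|f x| <= g x) -> `|I f| <= I g.
Proof.
move=> cf cg H; rewrite ler_norml; apply/andP; split; last first.
  by apply: I_le => // x; apply: le_trans (H x); exact: ler_norm.
rewrite lerNl -mulN1r -I_scale //; apply: I_le => //; first exact: cc_scale.
by move=> x; apply: le_trans (H x); rewrite mulN1r -normrN ler_norm.
Qed.

Lemma I_affine n (c : R) (a : 'rV[R]_n) (f : 'rV[R]_n -> R) : cc f -> c != 0 ->
  I (fun x => f (c *: x + a)) = `|c| ^- n * I f.
Proof.
move=> + c0; elim: n a f => [|n IH] a f cf /=.
  by rewrite scaler0 add0r (thinmx0 a) expr0 invr1 mul1r.
have [s [b ->]] := vconsP a.
under eq_fun => t.
  under eq_fun => y do rewrite vconsZ vconsD.
  rewrite (IH b (fun y => f (vcons (c * t + s) y))); last exact: cc_slice.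
  over.
rewrite (@J_affine _ c s (fun t => `|c| ^- n * I (fun y => f (vcons t y)))) //; last first.
  by apply: cc_scale; exact: cc_I_inner.
rewrite J_scale; last exact: cc_I_inner.
by rewrite mulrA -invfM -exprS.
Qed.

Lemma cc_affine n (c : R) (a : 'rV[R]_n) (f : 'rV[R]_n -> R) : cc f -> c != 0 ->
  cc (fun x => f (c *: x + a)).
Proof.
move=> cf c0; have ac : 0 < `|c| by rewrite normr_gt0.
apply: (@cc_comp _ _ _ f (fun x => c *: x + a) (`|c|^-1) (`|a| / `|c|)) => //.
+ apply/continuousP_eps => x e e0; exists (e / `|c|); first exact: divr_gt0.
  by move=> y; rewrite opprD addrACA subrr addr0 -scalerBr normrZ ltr_pdivlMr // mulrC.
+ move=> x; rewrite mulrC -mulrDl ler_pdivlMr // mulrC -normrZ.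
  have {1}-> : c *: x = (c *: x + a) + (- a) by rewrite addrK.
  by rewrite -[X in _ <= _ + X]normrN ler_normD.
+ by rewrite invr_gt0.
Qed.

Lemma I_trans n (a : 'rV[R]_n) (f : 'rV[R]_n -> R) : cc f -> I (fun x => f (x + a)) = I f.
Proof.
move=> cf; have := I_affine a cf (oner_neq0 R).
rewrite normr1 expr1n invr1 mul1r => <-.
by congr I; apply/funext => x; rewrite scale1r.
Qed.

Lemma I_flip n (f : 'rV[R]_n -> R) : cc f -> I (fun x => f (- x)) = I f.
Proof.
move=> cf; have c0 : (-1 : R) != 0 by rewrite oppr_eq0 oner_neq0.
have := I_affine 0 cf c0; rewrite normrN1 expr1n invr1 mul1r => <-.
by congr I; apply/funext => x; rewrite scaleN1r addr0.
Qed.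

Lemma J_I_exchange n (f : R * 'rV[R]_n -> R) : cc f ->
  J (fun t => I (fun y => f (t, y))) = I (fun y => J (fun t => f (t, y))).
Proof.
elim: n f => [//|n IH] f cf /=.
have cf2 : cc (fun q : (R * R) * 'rV[R]_n => f (q.1.1, vcons q.1.2 q.2)).
  apply: (cc_comp_isom cf) => [w w'|w]; rewrite !prod_normE /=.
    by rewrite vconsB vcons_norm maxA.
  by rewrite vcons_norm maxA.
have pR := @proper_R R.
rewrite (@J_exchange _ (fun p => I (fun y => f (p.1, vcons p.2 y)))); last first.
  by apply: (@cc_I_param _ (R * R)%type _ _ cf2); exact: proper_prod.
congr J; apply/funext => s.
rewrite (IH (fun p => f (p.1, vcons s p.2))) //.
apply: (cc_comp_isom cf) => [w w'|w]; rewrite !prod_normE /= ?vconsB !vcons_norm.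
  by rewrite subrr normr0 (max_idPr (normr_ge0 _)).
by rewrite maxCA le_max lexx orbT.
Qed.

Lemma I_exchange n m (f : 'rV[R]_n * 'rV[R]_m -> R) : cc f ->
  I (fun x => I (fun y => f (x, y))) = I (fun y => I (fun x => f (x, y))).
Proof.
elim: n f => [//|n IH] f cf /=.
have cf2 : cc (fun q : (R * 'rV[R]_m) * 'rV[R]_n => f (vcons q.1.1 q.2, q.1.2)).
  apply: (cc_comp_isom cf) => [w w'|w]; rewrite !prod_normE /= ?vconsB vcons_norm.
    by rewrite maxAC.
  by rewrite maxAC.
have pR := @proper_R R; have pV := @proper_rV R.
rewrite -(@J_I_exchange _ (fun p => I (fun x => f (vcons p.1 x, p.2)))); last first.
  by apply: (@cc_I_param _ (R * 'rV[R]_m)%type _ _ cf2); exact: (proper_prod pR (pV m)).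
congr J; apply/funext => s.
rewrite (IH (fun p => f (vcons s p.1, p.2))) //.
apply: (cc_comp_isom cf) => [w w'|w]; rewrite !prod_normE /= ?vconsB !vcons_norm.
  by rewrite subrr normr0 (max_idPr (normr_ge0 _)).
by rewrite -maxA le_max lexx orbT.
Qed.

(* Integration by parts: by translation invariance the difference quotients of
   [f] have integral zero, and they converge uniformly to [f']. *)
Lemma I_derive n (v : 'rV[R]_n) (f f' : 'rV[R]_n -> R) : cc f -> cc f' ->
  (forall x, is_derive x v f (f' x)) -> I f' = 0.
Proof.
move=> cf cf' df.
apply/eqP; rewrite -normr_le0; apply/ler_addgt0Pl => e e0; rewrite addr0.
have [M fM] := cf.2; have [M' fM'] := cf'.2.
(* The summand [|v|] covers the support of the translate, as the step [h] will be at most 1. *)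
pose N := Num.max M M' + `|v|.
pose b := @bump R ('rV[R]_n) N.
have cb : cc b by exact: cc_bump.
have Ib : 0 <= I b by apply: I_ge0 => // x; exact: bump_ge0.
have e'0 : 0 < e / (I b + 1) by rewrite divr_gt0 // ltr_wpDl.
have [d d0 Hd] := cc_ucont (@proper_rV R n) cf' e'0.
have [h [h0 h1 hd]] : exists h : R, [/\ 0 < h, h <= 1 & h * `|v| < d].
  have v0 := normr_ge0 v.
  exists (Num.min 1 (d / (`|v| + 1))); split.
  - by rewrite lt_min ltr01 divr_gt0 // ltr_wpDl.
  - by rewrite ge_min lexx.
  - apply: (@le_lt_trans _ _ (d / (`|v| + 1) * `|v|)).
      by rewrite ler_wpM2r // ge_min lexx orbT.
    by rewrite mulrAC ltr_pdivrMr ?ltr_wpDl // ltr_pM2l //; lra.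
have cfh : cc (fun x => f (x + h *: v)).
  by have := cc_affine (h *: v) cf (oner_neq0 R); under eq_fun do rewrite scale1r.
have E : I (fun x => h^-1 * (f (x + h *: v) - f x)) = 0.
  by rewrite I_scale ?I_sub ?I_trans ?subrr ?mulr0 //; exact: cc_sub.
rewrite -[I f']subr0 -E -I_sub //; last by apply: cc_scale; exact: cc_sub.
apply: (@le_trans _ _ (I (fun x => e / (I b + 1) * b x))); last first.
  by rewrite I_scale // mulrAC ler_pdivrMr ?ltr_wpDl // ler_wpM2l ?ltW //; lra.
apply: I_norm_le; [|exact: cc_scale|].
  by apply: cc_sub => //; apply: cc_scale; exact: cc_sub.
move=> x; have [xN|xN] := leP `|x| N; last first.
  rewrite fM' ?fM ?(fM x) ?subr0 ?mulr0 ?subrr ?normr0 ?mulr_ge0 ?bump_ge0 //.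
  - exact: ltW.
  - by rewrite invr_ge0; lra.
  - apply: le_lt_trans xN; rewrite /N.
    have : M <= Num.max M M' by rewrite le_max lexx.
    have := normr_ge0 v; lra.
  - have : `|x| <= `|x + h *: v| + `|v|.
      have {1}-> : x = (x + h *: v) + (- (h *: v)) by rewrite addrK.
      apply: le_trans (ler_normD _ _) _; rewrite lerD2l normrN normrZ gtr0_norm //.
      by rewrite ler_piMl.
    have : M <= Num.max M M' by rewrite le_max lexx.
    by move: xN; rewrite /N; lra.
  - apply: le_lt_trans xN; rewrite /N.
    have : M' <= Num.max M M' by rewrite le_max lexx orbT.
    have := normr_ge0 v; lra.
apply: (@le_trans _ _ (e / (I b + 1))); last first.
  by apply: ler_peMr; [exact: ltW|exact: bump_ge1].
have dg (s : R) : is_derive s 1 (fun s : R => f (x + s *: v)) (f' (x + s *: v)).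
  refine ((@is_derive_line R _ f _ (x + s *: v) v s _ _).1 (df _)) => k; congr f.
  by rewrite scalerDl addrCA.
(* The difference quotient is [f'] at an intermediate point, which is within [h |v| < d] of [x]. *)
have [|c + Ec] := @MVT R (fun s => f (x + s *: v)) (fun s => f' (x + s *: v)) 0 h h0 (fun s _ => dg s).
  by apply: continuous_subspaceT; exact: (is_derive_continuous dg).
rewrite in_itv /= => /andP[c0 ch]; move: Ec; rewrite scale0r addr0 subr0 => ->.
rewrite mulrCA mulVf ?gt_eqF // mulr1; apply/ltW/Hd.
have -> : x - (x + c *: v) = - (c *: v) by rewrite opprD addrA subrr add0r.
rewrite normrN normrZ gtr0_norm //; apply: le_lt_trans hd.
by rewrite ler_wpM2r // ltW.
Qed.

End MultiDimensional.

(** * The distance to the complement *)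

Section EuclideanNorm.
Context {R : realType} {n : nat}.
Implicit Types x y z v w e : 'rV[R]_n.

Definition dot x y : R := \sum_(i < n) x ord0 i * y ord0 i.

Definition sqn x : R := \sum_(i < n) x ord0 i ^+ 2.

Lemma sqn_ge0 x : 0 <= sqn x.
Proof. by apply: sumr_ge0 => i _; exact: sqr_ge0. Qed.

Lemma enorm_ge0 x : 0 <= enorm x.
Proof. exact: sqrtr_ge0. Qed.

Lemma enorm_sq x : enorm x ^+ 2 = sqn x.
Proof. by rewrite sqr_sqrtr // sqn_ge0. Qed.

Lemma dotC x y : dot x y = dot y x.
Proof. by apply: eq_bigr => i _; rewrite mulrC. Qed.

Lemma dotDr x y z : dot x (y + z) = dot x y + dot x z.
Proof. by rewrite -big_split; apply: eq_bigr => i _; rewrite mxE mulrDr. Qed.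

Lemma dotZr a x y : dot x (a *: y) = a * dot x y.
Proof. by rewrite mulr_sumr; apply: eq_bigr => i _; rewrite mxE mulrCA. Qed.

Lemma dotNr x y : dot x (- y) = - dot x y.
Proof. by rewrite -scaleN1r dotZr mulN1r. Qed.

Lemma dotZl a x y : dot (a *: x) y = a * dot x y.
Proof. by rewrite dotC dotZr dotC. Qed.

Lemma dotxx x : dot x x = sqn x.
Proof. by apply: eq_bigr => i _; rewrite expr2. Qed.

Lemma sqnD x y : sqn (x + y) = sqn x + 2 * dot x y + sqn y.
Proof.
by rewrite -!dotxx dotDr ![dot (x + y) _]dotC !dotDr [dot y x]dotC; ring.
Qed.

Lemma sqnZ a x : sqn (a *: x) = a ^+ 2 * sqn x.
Proof. by rewrite -!dotxx dotZr dotZl; ring. Qed.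

Lemma sqnN x : sqn (- x) = sqn x.
Proof. by rewrite -scaleN1r sqnZ; ring. Qed.

Lemma enormZ a x : enorm (a *: x) = `|a| * enorm x.
Proof. by rewrite /enorm -/(sqn _) sqnZ sqrtrM ?sqr_ge0 // sqrtr_sqr. Qed.

Lemma enormN x : enorm (- x) = enorm x.
Proof. by rewrite -scaleN1r enormZ normrN1 mul1r. Qed.

Lemma enormB x y : enorm (x - y) = enorm (y - x).
Proof. by rewrite -enormN opprB. Qed.

Lemma sqn_eq0 x : sqn x = 0 -> x = 0.
Proof.
move=> /eqP; rewrite psumr_eq0; last by move=> i _; exact: sqr_ge0.
move=> /allP H; apply/rowP => i; rewrite mxE; apply/eqP.
by rewrite -sqrf_eq0; apply: H; rewrite mem_index_enum.
Qed.

Lemma enorm_eq0 x : enorm x = 0 -> x = 0.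
Proof. by move=> H; apply: sqn_eq0; rewrite -enorm_sq H expr0n. Qed.

Lemma enorm0 : enorm (0 : 'rV[R]_n) = 0.
Proof. by rewrite -(scale0r 0) enormZ normr0 mul0r. Qed.

Lemma Cauchy_Schwarz x y : `|dot x y| <= enorm x * enorm y.
Proof.
rewrite -(ler_pXn2r (n := 2)) ?nnegrE ?mulr_ge0 ?enorm_ge0 //.
rewrite real_normK ?num_real // exprMn !enorm_sq.
have [y0|y0] := eqVneq (sqn y) 0.
  rewrite (sqn_eq0 y0) -(scale0r 0) dotZr mul0r expr0n /=.
  by rewrite mulr_ge0 ?sqn_ge0.
have yp : 0 < sqn y by rewrite lt_neqAle eq_sym y0 sqn_ge0.
rewrite -(ler_pM2l yp) -subr_ge0.
have := sqn_ge0 (sqn y *: x + (- dot x y) *: y).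
rewrite sqnD !sqnZ dotZr dotZl; congr (0 <= _); ring.
Qed.

Lemma enormD x y : enorm (x + y) <= enorm x + enorm y.
Proof.
rewrite -(ler_pXn2r (n := 2)) ?nnegrE ?addr_ge0 ?enorm_ge0 //.
rewrite enorm_sq sqnD sqrrD (enorm_sq x) (enorm_sq y) -mulr_natl.
have := le_trans (ler_norm _) (Cauchy_Schwarz x y); lra.
Qed.

Lemma enorm_triangle z x y : enorm (x - y) <= enorm (x - z) + enorm (z - y).
Proof. by rewrite -{1}(subrKA z x) enormD. Qed.

Lemma norm_le_enorm x : `|x| <= enorm x.
Proof.
rewrite rV_norm_le ?enorm_ge0 //; apply/forallP => i.
rewrite -(ler_pXn2r (n := 2)) ?nnegrE ?enorm_ge0 // enorm_sq.
rewrite real_normK ?num_real // /sqn (bigD1 i) //= lerDl.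
by apply: sumr_ge0 => j _; exact: sqr_ge0.
Qed.

Lemma enorm_le_norm x : enorm x <= n%:R * `|x|.
Proof.
rewrite -(ler_pXn2r (n := 2)) ?nnegrE ?mulr_ge0 ?enorm_ge0 // enorm_sq.
apply: (@le_trans _ _ (\sum_(i < n) `|x| ^+ 2)).
  apply: ler_sum => i _; rewrite -[x ord0 i ^+ 2]real_normK ?num_real //.
  by rewrite ler_pXn2r ?nnegrE // rV_coord_le.
rewrite sumr_const card_ord -[leLHS]mulr_natl exprMn; apply: ler_wpM2r; first exact: sqr_ge0.
rewrite -natrX ler_nat; case: (n) => // k; rewrite expnS expn1.
by rewrite leq_pmulr.
Qed.

(** The topology comes from the sup norm, hence the factor [n%:R] in the modulus. *)
Lemma lipschitz_continuous (W : normedModType R) (f : 'rV[R]_n -> W) (L : R) :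
  (forall x y, `|f x - f y| <= L * enorm (x - y)) -> continuous f.
Proof.
move=> fL; apply/continuousP_eps => x e e0.
pose K := `|L| * n%:R + 1.
have K0 : 0 < K by rewrite ltr_wpDl // mulr_ge0.
exists (e / K); first exact: divr_gt0.
move=> y; rewrite ltr_pdivlMr // => H; apply: le_lt_trans (fL x y) _.
apply: le_lt_trans H.
apply: (@le_trans _ _ (`|L| * enorm (x - y))); first by rewrite ler_wpM2r ?enorm_ge0 // ler_norm.
apply: (@le_trans _ _ (`|L| * (n%:R * `|x - y|))); first by rewrite ler_wpM2l // enorm_le_norm.
rewrite /K mulrDr mulr1 mulrA [_ * `|x - y|]mulrC lerDl //.
Qed.

Lemma enorm_lip x y : `|enorm x - enorm y| <= enorm (x - y).
Proof.
have H (a b : 'rV[R]_n) : enorm a - enorm b <= enorm (a - b).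
  by rewrite lerBlDr -{1}(subrK b a) enormD.
by rewrite ler_norml H andbT lerNl opprB enormB H.
Qed.

Lemma enorm_continuous : continuous (@enorm R n).
Proof.
by apply: (@lipschitz_continuous R _ 1) => x y; rewrite mul1r enorm_lip.
Qed.

Lemma dot_continuous e : continuous (dot e).
Proof.
apply: (@lipschitz_continuous R _ (enorm e)) => x y.
by rewrite -dotNr -dotDr Cauchy_Schwarz.
Qed.

Lemma sqn_continuous : continuous sqn.
Proof.
have -> : sqn = (fun x => enorm x * enorm x).
  by apply/funext => x; rewrite -expr2 enorm_sq.
by apply: cont_mul; exact: enorm_continuous.
Qed.

Section Distance.
Variable Omega : set 'rV[R]_n.
Hypotheses (oO : open Omega) (OT : Omega != setT).

Local Notation d := (dist_compl Omega).

Let A x := [set enorm (x - y) | y in ~` Omega].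

Let A0 x : has_inf (A x).
Proof.
have /existsNP[y Oy] : ~ (forall y, Omega y).
  by move=> H; move/eqP: OT; apply; apply/seteqP; split.
split; first by exists (enorm (x - y)), y.
by exists 0 => _ [z _ <-]; exact: enorm_ge0.
Qed.

Lemma dist_le x y : ~ Omega y -> d x <= enorm (x - y).
Proof. by move=> Oy; apply: ge_inf; [case: (A0 x)|exists y]. Qed.

Lemma dist_ge x m : (forall y, ~ Omega y -> m <= enorm (x - y)) -> m <= d x.
Proof.
move=> H; apply: lb_le_inf; first by case: (A0 x).
by move=> _ [y Oy <-]; exact: H.
Qed.

Lemma dist_ge0 x : 0 <= d x.
Proof. by apply: dist_ge => y _; exact: enorm_ge0. Qed.

Lemma dist_triangle x y : d x <= d y + enorm (x - y).
Proof.
rewrite -lerBlDr; apply: dist_ge => z Oz; rewrite lerBlDr addrC.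
by apply: le_trans (dist_le x Oz) _; exact: enorm_triangle.
Qed.

Lemma dist_lip x y : `|d x - d y| <= enorm (x - y).
Proof.
have := dist_triangle x y; have := dist_triangle y x; rewrite [enorm (y - x)]enormB.
by rewrite ler_norml; lra.
Qed.

Lemma dist_continuous : continuous d.
Proof.
by apply: (@lipschitz_continuous R _ 1) => x y; rewrite mul1r dist_lip.
Qed.

Lemma dist_outside x : ~ Omega x -> d x = 0.
Proof.
by move=> /(dist_le x); rewrite subrr enorm0 => H; apply/eqP; rewrite eq_le H dist_ge0.
Qed.

Lemma dist_nearest x : exists2 y, ~ Omega y & d x = enorm (x - y).
Proof.
have [[_ [y0 Oy0 _]] _] := A0 x.
(* The ball contains the competitor [y0], and every point outside it is farther from [x] than [y0];
   the minimum over this compact part is therefore global. *)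
pose C := ~` Omega `&` [set y | `|y| <= enorm (x - y0) + `|x|].
have Cy0 : C y0.
  split=> //=; rewrite -{1}(subrK x y0); apply: le_trans (ler_normD _ _) _.
  by rewrite lerD2r enormB norm_le_enorm.
have cC : compact C.
  apply: (subclosed_compact _ (@proper_rV R n (enorm (x - y0) + `|x|))).
    apply: closedI; last exact: closed_norm_le.
    exact: open_closedC.
  by move=> y [].
have cf : continuous (fun y => enorm (x - y)).
  apply: (@lipschitz_continuous R _ 1) => y z.
  by rewrite mul1r (le_trans (enorm_lip _ _)) // opprB addrC subrKA enormB.
have [|y /set_mem[Oy _] Hy] := EVT_min_rV (ex_intro _ y0 Cy0) cC (f := fun y => enorm (x - y)).
  exact: continuous_subspaceT.
exists y => //; apply/eqP; rewrite eq_le dist_le //=; apply: dist_ge => z Oz.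
have [zC|zC] := leP `|z| (enorm (x - y0) + `|x|); first by apply: Hy; exact/mem_set.
apply: le_trans (Hy y0 (mem_set Cy0)) _.
have : `|z| <= `|x - z| + `|x|.
  by rewrite -[X in `|X| <= _](subrK x) -[X in _ <= X + _]normrN opprB ler_normD.
have := norm_le_enorm (x - z); lra.
Qed.

Lemma dist_gt0 x : Omega x -> 0 < d x.
Proof.
move=> Ox; rewrite lt_neqAle dist_ge0 andbT; apply/eqP => d0.
have [y Oy E] := dist_nearest x.
apply: Oy; suff -> : y = x by [].
by apply/esym/eqP; rewrite -subr_eq0; apply/eqP/enorm_eq0; rewrite -E.
Qed.

Lemma dist_gt0_in x : 0 < d x -> Omega x.
Proof. by move=> dx; apply: contrapT => /dist_outside E; rewrite E ltxx in dx. Qed.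

(** With [a = d x], [y] a nearest point and [e = (x - y) / a], one has [|x + w - y|^2 = a^2 + 2 a p]
    for [p = dot e w + sqn w / (2 a)], and this is at most [(a + p)^2]. *)
Lemma dist_upper x : 0 < d x -> exists2 e, enorm e = 1 &
  forall w, d (x + w) <= d x + dot e w + sqn w / (2 * d x).
Proof.
move=> dx; have [y Oy E] := dist_nearest x.
set a := d x in dx E *.
have xyE : x - y = a *: (a^-1 *: (x - y)).
  by rewrite scalerA divff ?scale1r // gt_eqF.
set e := a^-1 *: (x - y) in xyE.
have e1 : enorm e = 1 by rewrite /e enormZ -E gtr0_norm ?invr_gt0 // mulVf // gt_eqF.
exists e => // w; apply: le_trans (dist_le _ Oy) _.
have -> : x + w - y = a *: e + w by rewrite -xyE addrAC.
have S : sqn (a *: e + w) = a ^+ 2 + 2 * a * dot e w + sqn w.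
  by rewrite sqnD sqnZ -enorm_sq e1 dotZl; ring.
set p := dot e w + sqn w / (2 * a).
have -> : a + dot e w + sqn w / (2 * a) = a + p by rewrite /p addrA.
have pE : 2 * a * p = 2 * a * dot e w + sqn w.
  by rewrite /p; field; rewrite gt_eqF.
have ap : 0 <= a + p.
  have a2 : 0 < 2 * a by lra.
  rewrite -(pmulr_rge0 _ a2) mulrDr pE.
  have := sqn_ge0 (a *: e + w); rewrite S; have := sqr_ge0 a; lra.
rewrite -(ler_pXn2r (n := 2)) ?nnegrE ?enorm_ge0 // enorm_sq S.
clearbody p; have := sqr_ge0 p; rewrite sqrrD -mulr_natl; lra.
Qed.

End Distance.

End EuclideanNorm.

(** * Smooth functions and the mean value inequality *)

Section FlatFunctions.
Context {R : realType}.

(* The family [r^-k exp(-1/r)] (extended by [0]) is stable under derivation. *)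
Definition flat (k : nat) (r : R) : R :=
  if 0 < r then r^-1 ^+ k * expR (- r^-1) else 0.

Lemma flat_ge0 k r : 0 <= flat k r.
Proof.
rewrite /flat; case: ifPn => // r0.
by rewrite mulr_ge0 ?expR_ge0 // exprn_ge0 // invr_ge0 ltW.
Qed.

Lemma flat_gt0 k r : 0 < r -> 0 < flat k r.
Proof.
by rewrite /flat => r0; rewrite r0 mulr_gt0 ?expR_gt0 // exprn_gt0 // invr_gt0.
Qed.

Lemma flat_le0 k r : r <= 0 -> flat k r = 0.
Proof. by rewrite /flat leNgt => /negbTE ->. Qed.

(** One term of the exponential series, [y^(k+2) / (k+2)! <= exp y] at [y = 1/r]. Order two in [r]
    is what makes the derivative at 0 vanish. *)
Lemma flat_quadratic k r : flat k r <= k.+2`!%:R * r ^+ 2.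
Proof.
have [r0|r0] := ltP 0 r; last by rewrite flat_le0 // mulr_ge0 // sqr_ge0.
rewrite /flat r0; set y := r^-1.
have y0 : 0 < y by rewrite invr_gt0.
have -> : r = y^-1 by rewrite invrK.
clearbody y.
have H : y ^+ k.+2 <= k.+2`!%:R * expR y.
  rewrite mulrC -ler_pdivrMr ?ltr0n ?fact_gt0 //.
  have := expR_ge1Dxn k.+1 (ltW y0); lra.
rewrite expRN ler_pdivrMr ?expR_gt0 // exprVn mulrAC ler_pdivlMr ?exprn_gt0 //.
by rewrite -exprD addn2.
Qed.

Lemma primitive_flat k : primitive (flat k) (fun r => flat k.+2 r - k%:R * flat k.+1 r).
Proof.
move=> r; have [r0|r0|->] := ltgtP r 0.
- rewrite !flat_le0 ?ltW // mulr0 subr0.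
  apply: (@near_eq_is_derive R R R (cst 0) (flat k) r 1 0 _ (is_derive_cst _ _ _)).
  by near=> s; rewrite flat_le0 //; apply: ltW; near: s; exact: lt_nbhsl.
- have nr0 : r != 0 by rewrite gt_eqF.
  have d1 : is_derive r 1 (fun s : R => s^-1) (- r ^- 2).
    have dr : derivable (id : R -> R) r 1 by exact: derivable_id.
    have := @deriveV R R id r 1 nr0 dr; rewrite derive_id => E.
    apply: DeriveDef; first exact: (@derivableV R R id r 1 nr0 dr).
    by rewrite E -[_ *: 1]/(_ * 1) mulr1.
  have d2 : is_derive r^-1 1 (fun y : R => y ^+ k * expR (- y))
     (k%:R * r^-1 ^+ k.-1 * expR (- r^-1) - r^-1 ^+ k * expR (- r^-1)).
    have dk : is_derive r^-1 1 (fun y : R => y ^+ k) (k%:R * r^-1 ^+ k.-1).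
      have := @is_deriveX R R id k r^-1 1 1 (is_derive_id _ _).
      by rewrite exprfctE /GRing.scale /= mulr1.
    have de : is_derive r^-1 1 (fun y : R => expR (- y)) (- expR (- r^-1)).
      have := @is_derive1_comp R expR -%R r^-1 _ _ (is_derive_expR _) (is_deriveNid _ _).
      by rewrite mulrN1.
    have := @is_deriveM R R _ _ r^-1 1 _ _ dk de.
    congr is_derive; rewrite /GRing.scale /=; ring.
  have := @is_derive1_comp R _ _ r _ _ d2 d1.
  move=> /(@near_eq_is_derive _ _ _ _ (flat k)) H.
  have -> : flat k.+2 r - k%:R * flat k.+1 r =
    (k%:R * r^-1 ^+ k.-1 * expR (- r^-1) - r^-1 ^+ k * expR (- r^-1)) * - r ^- 2.
    rewrite /flat r0 -exprVn; case: (k) => [|m] /=; rewrite ?exprS; ring.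
  apply: H; near=> s; rewrite /flat /=.
  have -> // : 0 < s.
  by near: s; exact: lt_nbhsr.
- rewrite !flat_le0 // mulr0 subr0; apply: is_deriveP_eps => e e0.
  have C0 : 0 < k.+2`!%:R :> R by rewrite ltr0n fact_gt0.
  exists (e / k.+2`!%:R); first exact: divr_gt0.
  move=> h hd; rewrite -[h *: 1]/(h * 1) mulr1 add0r (@flat_le0 k 0) // mulr0 !subr0.
  rewrite ger0_norm ?flat_ge0 //; apply: le_trans (flat_quadratic k h) _.
  rewrite -[h ^+ 2]real_normK ?num_real // expr2 mulrA ler_wpM2r //.
  by rewrite mulrC -ler_pdivlMr // ltW.
Unshelve. all: by end_near. Qed.

Lemma flat_continuous k : continuous (flat k).
Proof. exact: is_derive_continuous (primitive_flat k). Qed.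

Let bump0 (r : R) : R := flat 0 (r - 4^-1) * flat 0 (1 - r).

Let cc_bump0 : cc bump0.
Proof.
split.
  apply: cont_mul; apply: cont_comp (@flat_continuous 0); apply: cont_sub => x; first [exact: cvg_cst|exact: cvg_id].
exists 1 => r; rewrite /bump0 ltr_normr => /orP[] r1.
  by rewrite (@flat_le0 0 (1 - r)) ?mulr0 //; lra.
by rewrite flat_le0 ?mul0r //; lra.
Qed.

Let Jbump0_gt0 : 0 < J bump0.
Proof.
apply: (@J_gt0 R _ (2^-1)) => // [r|]; first by rewrite mulr_ge0 ?flat_ge0.
by rewrite mulr_gt0 // flat_gt0 //; lra.
Qed.

(** A smooth probability density on [[1/4, 1]]. It stays away from 0 so that powers of [r] can be
    multiplied in without a singularity. *)
Definition beta (r : R) : R := flat 0 (r - 4^-1) * flat 0 (1 - r) / J bump0.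

Lemma beta_ge0 r : 0 <= beta r.
Proof. by rewrite mulr_ge0 ?invr_ge0 ?(ltW Jbump0_gt0) // mulr_ge0 ?flat_ge0. Qed.

Lemma beta_gt0 r : 4^-1 < r -> r < 1 -> 0 < beta r.
Proof.
by move=> r1 r2; rewrite /beta divr_gt0 // mulr_gt0 // flat_gt0 // subr_gt0.
Qed.

Lemma beta_left r : r <= 4^-1 -> beta r = 0.
Proof. by move=> r1; rewrite /beta flat_le0 ?mul0r // subr_le0. Qed.

Lemma beta_right r : 1 <= r -> beta r = 0.
Proof. by move=> r1; rewrite /beta (@flat_le0 0 (1 - r)) ?mulr0 ?mul0r // subr_le0. Qed.

Lemma cc_beta : cc beta.
Proof. exact: (@cc_mull R R bump0 (fun=> (J bump0)^-1) cc_bump0 (@cont_cst R R _)). Qed.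

Lemma J_beta : J beta = 1.
Proof.
have -> : beta = (fun r => (J bump0)^-1 * bump0 r).
  by apply/funext => r; rewrite /beta mulrC.
by rewrite J_scale // mulVf // gt_eqF.
Qed.

(** The smooth step from 0 to 1; normalising at 0 makes it vanish up to 1/4, since [beta] does. *)
Definition theta : R -> R := sval (cid (cc_primitive 0 cc_beta)).

Lemma theta_primitive : primitive theta beta.
Proof. by rewrite /theta; case: cid => F []. Qed.

Lemma theta_left r : r <= 4^-1 -> theta r = 0.
Proof.
move=> r1; have t0 : theta 0 = 0 by rewrite /theta; case: cid => F [].
have [r0|r0] := leP 0 r; rewrite -t0; last first.
  by apply: (derivative_constant theta_primitive) (ltW r0) => x xr; rewrite beta_left //; lra.
apply/esym.
by apply: (derivative_constant theta_primitive) r0 => x xr; rewrite beta_left //; lra.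
Qed.

Lemma theta_right r : 1 <= r -> theta r = 1.
Proof.
move=> r1.
have : J beta = theta 2 - theta (- 2).
  apply: (J_FTC cc_beta) theta_primitive => // x; rewrite ltr_normr => /orP[] x1.
    by rewrite beta_right //; lra.
  by rewrite beta_left //; lra.
rewrite J_beta (@theta_left (- 2)) ?subr0; last lra.
move=> ->; have [r2|r2] := leP r 2.
  by apply: (derivative_constant theta_primitive) r2 => x xr; rewrite beta_right //; lra.
apply/esym.
by apply: (derivative_constant theta_primitive) (ltW r2) => x xr; rewrite beta_right //; lra.
Qed.

Lemma theta_mono r s : r <= s -> theta r <= theta s.
Proof.
by apply: derivative_nondecreasing theta_primitive _ => x _; exact: beta_ge0.
Qed.

Lemma theta_ge0 r : 0 <= theta r.
Proof.
have [r1|r1] := leP r (4^-1); first by rewrite theta_left.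
by rewrite -(@theta_left (4^-1)) // theta_mono // ltW.
Qed.

Lemma theta_le1 r : theta r <= 1.
Proof.
have [r1|r1] := leP 1 r; first by rewrite theta_right.
by rewrite -(@theta_right 1) // theta_mono // ltW.
Qed.

End FlatFunctions.

Section SmoothFunctions.
Context {R : realType} {n : nat}.

(* A class of formulas closed under derivation: hence its members are smooth. *)
Inductive Sm : ('rV[R]_n -> R) -> Prop :=
| Sm_cst a : Sm (fun _ => a)
| Sm_coord i : Sm (fun x => x ord0 i)
| Sm_add f g : Sm f -> Sm g -> Sm (fun x => f x + g x)
| Sm_mul f g : Sm f -> Sm g -> Sm (fun x => f x * g x)
| Sm_pow a f : Sm f -> (forall x, 0 < f x) -> Sm (fun x => f x `^ a)
| Sm_flat k f : Sm f -> Sm (fun x => flat k (f x))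
| Sm_prim F h f : primitive F h -> Sm (fun x => h (f x)) -> Sm f -> Sm (fun x => F (f x)).

Lemma powR_continuous (a x : R) : 0 < x -> {for x, continuous (fun y => y `^ a)}.
Proof.
move=> x0; apply: differentiable_continuous; apply/derivable1_diffP.
by case: (is_derive1_powR a x0).
Qed.

Lemma cont_pow (T : topologicalType) (f : T -> R) a : continuous f ->
  (forall x, 0 < f x) -> continuous (fun x => f x `^ a).
Proof.
move=> cf f0 x; apply: (@cvg_comp _ _ _ f (fun y => y `^ a) _ _ _ (cf x)); exact: powR_continuous.
Qed.

Lemma Sm_continuous f : Sm f -> continuous f.
Proof.
elim=> {f}.
- by move=> a; exact: cont_cst.
- by move=> i; exact: coord_continuous.
- by move=> f g _ cf _ cg; exact: cont_add.
- by move=> f g _ cf _ cg; exact: cont_mul.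
- by move=> a f _ cf f0; exact: cont_pow.
- by move=> k f _ cf; exact: (cont_comp cf (@flat_continuous R k)).
- by move=> F h f dF _ _ _ cf; exact: (cont_comp cf (is_derive_continuous dF)).
Qed.

Lemma is_derive_comp (V : normedModType R) (F : R -> R) (f : V -> R) (x v : V) (l l' : R) :
  is_derive (f x) 1 F l' -> is_derive x v f l -> is_derive x v (fun y => F (f y)) (l' * l).
Proof.
move=> dF df.
pose g (s : R) := f (s *: v + x).
have dg : is_derive (0 : R) 1 g l.
  by refine ((@is_derive_line R V f g x v 0 l _).1 df) => h; rewrite /g addr0.
refine ((@is_derive_line R V (fun y => F (f y)) (F \o g) x v 0 _ _).2 _).
  by move=> h; rewrite /g /= addr0.
apply: is_derive1_comp => //.
by rewrite /g scale0r add0r.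
Qed.

Lemma is_derive_coord (x v : 'rV[R]_n) i : is_derive x v (fun y => y ord0 i) (v ord0 i).
Proof.
apply: is_deriveP_eps => e e0; exists 1 => // k _.
have -> : (x + k *: v) ord0 i - x ord0 i - k * v ord0 i = 0 by rewrite !mxE; ring.
by rewrite normr0 mulr_ge0 // ltW.
Qed.

Lemma Sm_derive f : Sm f -> forall v, exists2 g, Sm g & forall x, is_derive x v f (g x).
Proof.
elim=> {f}.
- by move=> a v; exists (fun=> 0); [exact: Sm_cst|move=> x; exact: is_derive_cst].
- move=> i v; exists (fun=> v ord0 i); first exact: Sm_cst.
  by move=> x; exact: is_derive_coord.
- move=> f g _ Hf _ Hg v; have [f' sf' df] := Hf v; have [g' sg' dg] := Hg v.
  by exists (fun x => f' x + g' x); [exact: Sm_add|move=> x; exact: is_deriveD].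
- move=> f g sf Hf sg Hg v; have [f' sf' df] := Hf v; have [g' sg' dg] := Hg v.
  exists (fun x => f x * g' x + g x * f' x).
    by apply: Sm_add; exact: Sm_mul.
  by move=> x; exact: is_deriveM.
- move=> a f sf Hf f0 v; have [f' sf' df] := Hf v.
  exists (fun x => (a * f x `^ (a - 1)) * f' x).
    by apply: Sm_mul => //; apply: Sm_mul; [exact: Sm_cst|exact: Sm_pow].
  by move=> x; apply: (@is_derive_comp _ (fun y => y `^ a) f x v _ _ _ (df x)); exact: is_derive1_powR.
- move=> k f sf Hf v; have [f' sf' df] := Hf v.
  exists (fun x => (flat k.+2 (f x) + (- k%:R) * flat k.+1 (f x)) * f' x).
    apply: Sm_mul => //; apply: Sm_add; first exact: Sm_flat.
    by apply: Sm_mul; [exact: Sm_cst|exact: Sm_flat].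
  move=> x; apply: (@is_derive_comp _ (flat k) f x v _ _ _ (df x)); rewrite mulNr; exact: primitive_flat.
- move=> F h f dF sh _ sf Hf v; have [f' sf' df] := Hf v.
  exists (fun x => h (f x) * f' x); first exact: Sm_mul.
  by move=> x; apply: (@is_derive_comp _ F f x v _ _ _ (df x)); exact: dF.
Qed.

Lemma Sm_smooth f : Sm f -> smooth f.
Proof.
move=> sf; suff H l : Sm (dpartials l f).
  move=> l; split; first exact: Sm_continuous.
  by move=> i x; have [g _ /(_ x)[]] := Sm_derive (H l) (ebasis R i).
elim: l => [//|i l IH] /=.
have [g sg dg] := Sm_derive IH (ebasis R i).
have -> // : dpartial i (dpartials l f) = g.
by apply/funext => x; have [_] := dg x.
Qed.

Lemma Sm_ext f g : (forall x, f x = g x) -> Sm f -> Sm g.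
Proof. by move=> /funext ->. Qed.

Lemma Sm_sub f g : Sm f -> Sm g -> Sm (fun x => f x - g x).
Proof.
move=> sf sg; apply: Sm_ext (Sm_add sf (Sm_mul (Sm_cst (-1)) sg)) => x.
by rewrite mulN1r.
Qed.

Lemma Sm_sum m (F : 'I_m -> 'rV[R]_n -> R) : (forall i, Sm (F i)) ->
  Sm (fun x => \sum_(i < m) F i x).
Proof.
elim: m F => [|m IH] F cF.
  by under eq_fun do rewrite big_ord0; exact: Sm_cst.
by under eq_fun do rewrite big_ord_recl; apply: Sm_add => //; exact: IH.
Qed.

Lemma Sm_beta f : Sm f -> Sm (fun x => beta (f x)).
Proof.
move=> sf; apply: Sm_mul; last exact: Sm_cst.
by apply: Sm_mul; apply: Sm_flat; apply: Sm_sub => //; exact: Sm_cst.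
Qed.

Lemma Sm_theta f : Sm f -> Sm (fun x => theta (f x)).
Proof. by move=> sf; apply: (Sm_prim theta_primitive) => //; exact: Sm_beta. Qed.

End SmoothFunctions.

(** * The radial kernel and its moments *)

Section Kernel.
Context {R : realType} {n : nat}.
Implicit Types x y z v : 'rV[R]_n.

Lemma is_derive_sqn x v : is_derive x v sqn (2 * dot x v).
Proof.
apply: is_deriveP_eps => e e0.
have s0 : 0 < sqn v + 1 by rewrite ltr_wpDl // sqn_ge0.
exists (e / (sqn v + 1)); first exact: divr_gt0.
move=> k kd; have -> : sqn (x + k *: v) - sqn x - k * (2 * dot x v) = `|k| * (`|k| * sqn v).
  by rewrite sqnD sqnZ dotZr [RHS]mulrA -[`|k| * `|k|]expr2 real_normK ?num_real //; ring.
have sv := sqn_ge0 v.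
rewrite ger0_norm ?mulr_ge0 // mulrC ler_wpM2r //.
apply: (@le_trans _ _ (`|k| * (sqn v + 1))); first by rewrite ler_wpM2l // lerDl.
by rewrite -ler_pdivlMr // ltW.
Qed.

Lemma dot_ebasis x i : dot x (ebasis R i) = x ord0 i.
Proof.
rewrite /dot (bigD1 i) //= mxE !eqxx mulr1 big1 ?addr0 // => j ji.
by rewrite mxE eqxx /= (negbTE ji) mulr0.
Qed.

Lemma ebasisE (i j : 'I_n) : ebasis R i ord0 j = (i == j)%:R :> R.
Proof. by rewrite mxE eqxx /= eq_sym. Qed.

(* The power [1 - n/2] makes the Laplacian of a radial test function built from
   [theta] a difference of two rescaled copies of [K]; truncating [r] from below
   plays no role where [beta r <> 0]. *)
Definition ker (r : R) : R := 4 * (Num.max r 8^-1) `^ (1 - n%:R / 2) * beta r.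

Definition K z : R := ker (sqn z).

Lemma ker_ge0 r : 0 <= ker r.
Proof. by rewrite mulr_ge0 ?beta_ge0 // mulr_ge0 // powR_ge0. Qed.

Lemma ker_gt0 r : 4^-1 < r -> r < 1 -> 0 < ker r.
Proof.
move=> r1 r2; rewrite mulr_gt0 ?beta_gt0 // mulr_gt0 // powR_gt0 //.
by rewrite lt_max; apply/orP; right; rewrite invr_gt0.
Qed.

Lemma ker_right r : 1 <= r -> ker r = 0.
Proof. by move=> r1; rewrite /ker beta_right // mulr0. Qed.

Lemma ker_left r : r <= 4^-1 -> ker r = 0.
Proof. by move=> r1; rewrite /ker beta_left // mulr0. Qed.

Lemma cont_pow_max (a c : R) : 0 < c -> continuous (fun r : R => (Num.max r c) `^ a).
Proof.
move=> c0; apply: cont_pow; last by move=> r; rewrite lt_max c0 orbT.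
by apply: cont_max => x; [exact: cvg_id|exact: cvg_cst].
Qed.

Lemma ker_continuous : continuous ker.
Proof.
apply: cont_mul cc_beta.1; apply: cont_mul; first exact: cont_cst.
by apply: cont_pow_max; rewrite invr_gt0.
Qed.

Lemma cc_radial (f : R -> R) (c : R) : continuous f -> (forall r, c <= r -> f r = 0) ->
  cc (fun z => f (sqn z)).
Proof.
move=> cf f0; split; first by apply: cont_comp cf; exact: sqn_continuous.
exists (`|c| + 1) => z cz; apply: f0.
have : (`|c| + 1) ^+ 2 <= sqn z.
  rewrite -enorm_sq ler_pXn2r ?nnegrE ?enorm_ge0 ?addr_ge0 //.
  by apply: le_trans (ltW cz) _; exact: norm_le_enorm.
apply: le_trans; apply: le_trans (ler_norm c) _.
have := normr_ge0 c; have := sqr_ge0 `|c|; rewrite sqrrD expr1n mulr1 -mulr_natl; lra.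
Qed.

Lemma cc_K : cc K.
Proof. by apply: cc_radial ker_continuous _ => r; exact: ker_right. Qed.

Lemma K_ge0 z : 0 <= K z.
Proof. exact: ker_ge0. Qed.

Lemma K_even z : K (- z) = K z.
Proof. by rewrite /K sqnN. Qed.

Lemma K_supp z : K z != 0 -> enorm z <= 1.
Proof.
apply: contraNT; rewrite -ltNge => z1; apply/eqP/ker_right.
by rewrite -enorm_sq expr_ge1 ?enorm_ge0 // ltW.
Qed.

Lemma cc_ker : cc (fun r => ker r / 2).
Proof.
apply: cc_mull; last exact: cont_cst.
split; first exact: ker_continuous.
exists 1 => r; rewrite ltr_normr => /orP[] r1; first by rewrite ker_right // ltW.
by rewrite ker_left //; lra.
Qed.

(** The half compensates the gradient [2 z] of [sqn z]: the function [w (sqn z)] has gradient [K z]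
    times [z], and it vanishes outside the unit ball. *)
Lemma K_potential : exists2 w : R -> R, primitive w (fun r => ker r / 2) &
  forall r, 1 <= r -> w r = 0.
Proof.
have [w [dw w1]] := cc_primitive 1 cc_ker.
exists w => // r r1; rewrite -w1; apply/esym.
by apply: (derivative_constant dw) r1 => x /andP[x1 _]; rewrite ker_right ?mul0r.
Qed.

(** The second moment of [K] in any unit direction, as [I_K_dot_sq] shows; in terms of the potential
    it refers to no coordinate. *)
Definition cK : R := - I (fun z => sval (cid2 K_potential) (sqn z)).

Lemma cc_coord_mul (f : 'rV[R]_n -> R) i : cc f -> cc (fun z => f z * z ord0 i).
Proof. by move=> cf; apply: cc_mull cf _; exact: coord_continuous. Qed.

(* [K z * z_i] is the [i]-th derivative of a radial potential [W], and
   integrating by parts [d_i W * z_j] gives all second moments at once. *)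
Lemma K_moment i j : I (fun z => K z * z ord0 i * z ord0 j) = (i == j)%:R * cK.
Proof.
rewrite /cK; case: cid2 => w /= dw w1.
pose W z := w (sqn z).
have cw := is_derive_continuous dw.
have cW : cc W by exact: cc_radial w1.
have dW z : is_derive z (ebasis R i) W (K z * z ord0 i).
  have -> : K z * z ord0 i = ker (sqn z) / 2 * (2 * dot z (ebasis R i)).
    by rewrite dot_ebasis /K; field.
  by apply: (@is_derive_comp R _ w sqn); [exact: dw|exact: is_derive_sqn].
have c1 : cc (fun z => K z * z ord0 i * z ord0 j).
  by do 2 apply: cc_coord_mul; exact: cc_K.
have c2 : cc (fun z => (i == j)%:R * W z) by exact: cc_scale.
have := @I_derive R n (ebasis R i) (fun z => W z * z ord0 j)
  (fun z => K z * z ord0 i * z ord0 j + (i == j)%:R * W z) (cc_coord_mul j cW) (cc_add c1 c2).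
rewrite I_add // I_scale // => H.
apply/eqP; rewrite mulrN -addr_eq0; apply/eqP; apply: H => z.
have := @is_deriveM R _ W (fun z => z ord0 j) z (ebasis R i) _ _ (dW z) (is_derive_coord _ _ _).
congr is_derive.
by rewrite /GRing.scale /= ebasisE; ring.
Qed.

Lemma I_K_dot_sq g : I (fun z => K z * dot g z ^+ 2) = cK * sqn g.
Proof.
have -> : (fun z => K z * dot g z ^+ 2) =
  (fun z => \sum_(i < n) \sum_(j < n) g ord0 i * g ord0 j * (K z * z ord0 i * z ord0 j)).
  apply/funext => z; rewrite expr2 /dot mulr_suml mulr_sumr; apply: eq_bigr => i _.
  by rewrite !mulr_sumr; apply: eq_bigr => j _; ring.
have cij i j : cc (fun z => g ord0 i * g ord0 j * (K z * z ord0 i * z ord0 j)).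
  by apply: cc_scale; do 2 apply: cc_coord_mul; exact: cc_K.
rewrite I_sum; last by move=> i; apply: cc_sum.
rewrite /sqn mulr_sumr; apply: eq_bigr => i _.
rewrite I_sum // (bigD1 i) //= I_scale ?K_moment ?eqxx.
  rewrite [X in _ + X]big1 ?addr0 => [|j ji]; first by rewrite /=; ring.
  rewrite I_scale ?K_moment 1?eq_sym ?(negbTE ji) ?mul0r ?mulr0 //.
  by do 2 apply: cc_coord_mul; exact: cc_K.
by do 2 apply: cc_coord_mul; exact: cc_K.
Qed.

Lemma cK_gt0 (i : 'I_n) : 0 < cK.
Proof.
have -> : cK = I (fun z => K z * dot (ebasis R i) z ^+ 2).
  rewrite I_K_dot_sq -dotxx dot_ebasis ebasisE eqxx mulr1 //.
have E a : dot (ebasis R i) (a *: ebasis R i) = a.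
  by rewrite dotZr dot_ebasis ebasisE eqxx mulr1.
(* At this point [sqn z = 9/16], inside the interval [(1/4, 1)] where [ker] is positive. *)
apply: (@I_gt0 _ _ _ ((3 / 4) *: ebasis R i)).
- apply: cc_mull cc_K _; apply: (@cont_comp R _ (dot (ebasis R i)) (fun r => r ^+ 2)).
    exact: dot_continuous.
  exact: exprn_continuous.
- by move=> z; rewrite mulr_ge0 ?K_ge0 // sqr_ge0.
- rewrite E; apply: mulr_gt0; last by apply: exprn_gt0; lra.
  rewrite /K sqnZ -dotxx dot_ebasis ebasisE eqxx mulr1.
  by apply: ker_gt0; lra.
Qed.

Lemma I_K_even (f : 'rV[R]_n -> R) : continuous f ->
  I (fun z => K z * f (- z)) = I (fun z => K z * f z).
Proof.
move=> cf; rewrite -(I_flip (cc_mull cc_K cf)).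
by congr I; apply/funext => z; rewrite K_even.
Qed.

Lemma I_K_dot g : I (fun z => K z * dot g z) = 0.
Proof.
have := I_K_even (@dot_continuous R n g).
have -> : (fun z => K z * dot g (- z)) = (fun z => (-1) * (K z * dot g z)).
  by apply/funext => z; rewrite dotNr; ring.
rewrite I_scale; [lra|apply: cc_mull cc_K _; exact: dot_continuous].
Qed.

End Kernel.
Arguments K {R n} z.
Arguments ker {R} n r.
Arguments cK {R} n.

(** * A radial test function with prescribed Laplacian *)

Section TestFunction.
Context {R : realType} {n : nat}.
Variables (kappa h : R) (x : 'rV[R]_n).
Hypotheses (kappa0 : 0 < kappa) (kappah : kappa < h).

Let h0 : 0 < h := lt_trans kappa0 kappah.

Let k2 : 0 < kappa ^+ 2. Proof. by rewrite exprn_gt0. Qed.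
Let h2 : 0 < h ^+ 2. Proof. by rewrite exprn_gt0. Qed.
Let kh2 : kappa ^+ 2 < h ^+ 2.
Proof. by rewrite ltr_pXn2r // nnegrE ltW. Qed.

(** If [F' = r^(-n/2) m(r)], then the Laplacian of [- F (sqn (y - x))] is [- 4 r^(1-n/2) m'(r)] at
    [r = sqn (y - x)]: the power is the one that cancels the term in [m]. A difference of two
    rescaled steps gives a difference of two rescaled kernels, and [m >= 0] together with
    [F (h^2) = 0] gives [- F >= 0]. *)
Let mm (r : R) : R := theta (r / kappa ^+ 2) - theta (r / h ^+ 2).

Let mm' (r : R) : R := beta (r / kappa ^+ 2) / kappa ^+ 2 - beta (r / h ^+ 2) / h ^+ 2.

Let pw (r : R) : R := (Num.max r (kappa ^+ 2 / 8)) `^ (- (n%:R / 2)).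

Let p (r : R) : R := pw r * mm r.

Let quarter (r c : R) : 0 < c -> r <= c / 4 -> r / c <= 4^-1.
Proof. by move=> c0 rc; rewrite ler_pdivrMr //; lra. Qed.

Let primitive_theta_scale (c : R) : primitive (fun r => theta (r / c)) (fun r => beta (r / c) / c).
Proof.
have := @primitive_comp R theta beta c^-1 0 theta_primitive.
have -> : (fun r => theta (c^-1 * r + 0)) = (fun r => theta (r / c)).
  by apply/funext => r; rewrite addr0 mulrC.
have -> // : (fun r => c^-1 * beta (c^-1 * r + 0)) = (fun r => beta (r / c) / c).
by apply/funext => r; rewrite addr0 mulrC [c^-1 * r]mulrC.
Qed.

Let mm_primitive : primitive mm mm'.
Proof. by move=> r; apply: is_deriveB; exact: primitive_theta_scale. Qed.

Let mm_left r : r <= kappa ^+ 2 / 4 -> mm r = 0.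
Proof.
by move=> rk; rewrite /mm !theta_left ?subrr //; apply: quarter => //; (have := k2; have := kh2; lra).
Qed.

Let mm'_left r : r <= kappa ^+ 2 / 4 -> mm' r = 0.
Proof.
by move=> rk; rewrite /mm' !beta_left ?mul0r ?subrr //; apply: quarter => //; (have := k2; have := kh2; lra).
Qed.

Let mm_right r : h ^+ 2 <= r -> mm r = 0.
Proof.
by move=> hr; rewrite /mm !theta_right ?subrr //; rewrite ler_pdivlMr // mul1r //; (have := k2; have := kh2; lra).
Qed.

Let mm_ge0 r : 0 <= mm r.
Proof.
have [r0|r0] := leP 0 r; last by rewrite mm_left //; (have := k2; have := kh2; lra).
by rewrite /mm subr_ge0 theta_mono // ler_wpM2l // lef_pV2 ?posrE // ltW.
Qed.

Let pw_continuous : continuous pw.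
Proof. by apply: cont_pow_max; rewrite divr_gt0. Qed.

Let p_continuous : continuous p.
Proof. by apply: cont_mul => //; exact: is_derive_continuous mm_primitive. Qed.

Let cc_p : cc p.
Proof.
split => //; exists (h ^+ 2) => r; rewrite ltr_normr /p => /orP[] r1.
  by rewrite mm_right ?mulr0 // ltW.
by rewrite mm_left ?mulr0 //; (have := k2; have := kh2; lra).
Qed.

Let p' (r : R) : R := - (n%:R / 2) / r * p r + pw r * mm' r.

Let p_primitive : primitive p p'.
Proof.
move=> r; have [rk|rk] := ltP r (kappa ^+ 2 / 4).
  rewrite /p' /p mm_left ?mm'_left ?ltW // !mulr0 addr0.
  apply: (@near_eq_is_derive R R R (cst 0) _ r 1 0 _ (is_derive_cst _ _ _)).
  by near=> s; rewrite mm_left ?mulr0 //; apply: ltW; near: s; exact: lt_nbhsl.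
have r0 : 0 < r by (have := k2; have := kh2; lra).
have pwE s : kappa ^+ 2 / 8 < s -> pw s = s `^ (- (n%:R / 2)).
  by move=> sk; rewrite /pw; congr powR; apply/max_idPl; exact: ltW.
have dpw : is_derive r 1 pw (- (n%:R / 2) / r * pw r).
  have := @is_derive1_powR R (- (n%:R / 2)) r r0.
  have -> : r `^ (- (n%:R / 2) - 1) = r `^ (- (n%:R / 2)) / r.
    by rewrite powRB ?(gt_eqF r0) ?implybT // powRr1 // ltW.
  rewrite pwE; last (have := k2; have := kh2; lra).
  have -> : - (n%:R / 2) / r * r `^ (- (n%:R / 2)) = - (n%:R / 2) * (r `^ (- (n%:R / 2)) / r).
    by ring.
  apply: near_eq_is_derive; near=> s; rewrite pwE //.
  by near: s; apply: lt_nbhsr; (have := k2; have := kh2; lra).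
have := @is_deriveM R R pw mm r 1 _ _ dpw (mm_primitive r).
congr is_derive; rewrite /p' /p /GRing.scale /=; ring.
Unshelve. all: by end_near. Qed.

Let F_ex := cc_primitive (h ^+ 2) cc_p.
Let F := sval (cid F_ex).
Let F_primitive : primitive F p.
Proof. by rewrite /F; case: cid => G []. Qed.
Let F_right r : h ^+ 2 <= r -> F r = 0.
Proof.
move=> hr; have <- : F (h ^+ 2) = 0 by rewrite /F; case: cid => G [].
by apply/esym; apply: (derivative_constant F_primitive) hr => s /andP[hs _]; rewrite /p mm_right ?mulr0.
Qed.

Let S (y : 'rV[R]_n) := sqn (y - x).

Definition test_fun (y : 'rV[R]_n) : R := - F (S y).

Let Sm_S : Sm S.
Proof.
apply: Sm_sum => i; apply: (@Sm_ext _ _ (fun y => (y ord0 i - x ord0 i) * (y ord0 i - x ord0 i))).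
  by move=> y; rewrite !mxE expr2.
by apply: Sm_mul; apply: Sm_sub; first [exact: Sm_coord|exact: Sm_cst].
Qed.

Let Sm_scale a f : Sm f -> @Sm R n (fun y => f y / a).
Proof. by move=> sf; apply: Sm_mul => //; exact: Sm_cst. Qed.

(** A smooth substitute for the truncation by [Num.max]: positive everywhere, and equal to [S] as
    soon as [S >= kappa^2 / 4]; below that value [mm] vanishes. *)
Let T (y : 'rV[R]_n) := S y + (1 - theta (S y / (kappa ^+ 2 / 4))).

Let Sm_T : Sm T.
Proof.
apply: Sm_add => //; apply: Sm_sub; first exact: Sm_cst.
by apply: Sm_theta; exact: Sm_scale.
Qed.

Let T_gt0 y : 0 < T y.
Proof.
have S0 : 0 <= S y by exact: sqn_ge0.
move: S0; rewrite le_eqVlt => /predU1P[S0|S0].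
  by rewrite /T -S0 mul0r theta_left ?subr0 ?add0r.
by rewrite ltr_pwDl // subr_ge0 theta_le1.
Qed.

Let Sm_test : Sm test_fun.
Proof.
apply: (@Sm_ext _ _ (fun y => (-1) * F (S y))); first by move=> y; rewrite mulN1r.
apply: Sm_mul; first exact: Sm_cst.
apply: (Sm_prim F_primitive) => //.
apply: (@Sm_ext _ _ (fun y => T y `^ (- (n%:R / 2)) * mm (S y))); last first.
  apply: Sm_mul; first exact: Sm_pow.
  by apply: Sm_sub; apply: Sm_theta; exact: Sm_scale.
move=> y; rewrite /p; have [Sk|Sk] := leP (S y) (kappa ^+ 2 / 4).
  by rewrite mm_left ?mulr0.
congr (_ * _); rewrite /pw /T theta_right ?subrr ?addr0.
  by congr powR; apply/esym/max_idPl; (have := k2; have := kh2; lra).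
by rewrite ler_pdivlMr ?mul1r ?divr_gt0 // ltW.
Qed.

Lemma test_fun_ge0 y : 0 <= test_fun y.
Proof.
rewrite oppr_ge0; have [hS|/ltW hS] := leP (h ^+ 2) (S y); first by rewrite F_right.
rewrite -(@F_right (h ^+ 2)) //; apply: derivative_nondecreasing F_primitive _ hS => r _.
by rewrite mulr_ge0 ?powR_ge0.
Qed.

Lemma test_fun_supp y : h < enorm (y - x) -> test_fun y = 0.
Proof.
move=> hy; rewrite /test_fun F_right ?oppr0 //.
by rewrite /S -enorm_sq ler_pXn2r ?nnegrE ?enorm_ge0 ?ltW.
Qed.

Lemma closed_ball_compact r : compact [set y : 'rV[R]_n | enorm (y - x) <= r].
Proof.
apply: (subclosed_compact _ (@proper_rV R n (r + `|x|))).
  have /continuous_closedP : continuous (fun y : 'rV[R]_n => enorm (y - x)).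
    by apply: (@lipschitz_continuous R _ R _ 1) => y z; rewrite mul1r (le_trans (enorm_lip _ _)) // opprB addrA subrK.
  by move=> /(_ _ (@closed_le R r)).
move=> y /= yr; rewrite -(subrK x y); apply: le_trans (ler_normD _ _) _.
by rewrite lerD2r; apply: le_trans yr; exact: norm_le_enorm.
Qed.

Lemma fsupport_sub (f : 'rV[R]_n -> R) (A : set 'rV[R]_n) : compact A ->
  (forall y, ~ A y -> f y = 0) -> compact (fsupport f) /\ fsupport f `<=` A.
Proof.
move=> cA fA.
have sub : fsupport f `<=` A.
  have clA : closed A by apply: compact_closed cA; exact: norm_hausdorff.
  rewrite /fsupport (closure_id A).1 //; apply: closureS => y /= fy.
  by apply: contrapT => /fA E; rewrite E eqxx in fy.
split=> //; apply: subclosed_compact cA sub; exact: closed_closure.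
Qed.

Lemma test_fun_Cc (Omega : set 'rV[R]_n) :
  (forall y, enorm (y - x) <= h -> Omega y) -> Cc_infty Omega test_fun.
Proof.
move=> HO; split; first exact: Sm_smooth.
have [|c s] := @fsupport_sub test_fun _ (@closed_ball_compact h).
  by move=> y /negP; rewrite -ltNge; exact: test_fun_supp.
by split=> // y /s /HO.
Qed.

Let dS y v : is_derive y v S (2 * dot (y - x) v).
Proof.
have E k : S (k *: v + y) = sqn (k *: v + (y - x)) by rewrite /S addrA.
have d0 : is_derive (0 : R) 1 (fun k : R => S (k *: v + y)) (2 * dot (y - x) v).
  by refine ((@is_derive_line R _ sqn _ (y - x) v 0 _ _).1 (is_derive_sqn _ _)) => k; rewrite addr0.
by refine ((@is_derive_line R _ S _ y v 0 _ _).2 d0) => k; rewrite addr0.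
Qed.

Let dtest y i : is_derive y (ebasis R i) test_fun (- (p (S y) * (2 * (y - x) ord0 i))).
Proof.
apply: is_deriveN; rewrite -[(y - x) ord0 i]dot_ebasis.
by apply: (@is_derive_comp R _ F S) => //; exact: F_primitive.
Qed.

Let ddtest y i : is_derive y (ebasis R i) (dpartial i test_fun)
  (- (p' (S y) * (4 * (y - x) ord0 i ^+ 2) + 2 * p (S y))).
Proof.
have -> : dpartial i test_fun = (fun y => - (p (S y) * (2 * (y - x) ord0 i))).
  by apply/funext => z; have [_] := dtest z i.
apply: is_deriveN.
have d1 : is_derive y (ebasis R i) (fun y => p (S y)) (p' (S y) * (2 * (y - x) ord0 i)).
  rewrite -[(y - x) ord0 i]dot_ebasis.
  by apply: (@is_derive_comp R _ p S) => //; exact: p_primitive.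
have d2 : is_derive y (ebasis R i) (fun y : 'rV[R]_n => 2 * (y - x) ord0 i) 2.
  apply: is_deriveP_eps => e e0; exists 1 => // k _.
  have -> : 2 * (y + k *: ebasis R i - x) ord0 i - 2 * (y - x) ord0 i - k * 2 = 0.
    by rewrite !mxE !eqxx /=; ring.
  by rewrite normr0 mulr_ge0 // ltW.
have := @is_deriveM R _ _ _ y (ebasis R i) _ _ d1 d2.
congr is_derive; rewrite /GRing.scale /=; ring.
Qed.

Lemma laplacian_test_fun y : laplacian test_fun y =
  h ^- n * ker n (S y / h ^+ 2) - kappa ^- n * ker n (S y / kappa ^+ 2).
Proof.
have -> : laplacian test_fun y = - (4 * S y * p' (S y)) - 2 * n%:R * p (S y).
  rewrite /laplacian.
  have E i : dpartial i (dpartial i test_fun) y =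
      - (p' (S y) * (4 * (y - x) ord0 i ^+ 2) + 2 * p (S y)).
    by have [_] := ddtest y i.
  under eq_bigr => i _ do rewrite E.
  rewrite sumrN big_split /= -!mulr_sumr sumr_const card_ord.
  rewrite -[\sum_(i < n) _]/(S y) -[mm (S y) *+ n]mulr_natl.
  by rewrite /p; ring.
set q := S y; have q0 : 0 <= q by exact: sqn_ge0.
(* Scaling of the power: [c^(-n) (q / c^2)^(1-n/2) = q^(1-n/2) / c^2]. Where [beta] does not vanish,
   [q > c^2 / 4] and both truncations are inactive. *)
have kerE c : 0 < c -> kappa ^+ 2 <= c ^+ 2 ->
    c ^- n * ker n (q / c ^+ 2) = 4 * q * pw q * (beta (q / c ^+ 2) / c ^+ 2).
  move=> c0 kc; have c2 : 0 < c ^+ 2 by rewrite exprn_gt0.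
  have [qc|qc] := leP (q / c ^+ 2) (4^-1).
    by rewrite ker_left // beta_left // mul0r !mulr0.
  have qc' : c ^+ 2 / 4 < q by move: qc; rewrite ltr_pdivlMr //; lra.
  have qp : 0 < q by lra.
  rewrite /ker /pw.
  have -> : Num.max q (kappa ^+ 2 / 8) = q.
    by apply/max_idPl; have := k2; lra.
  have -> : Num.max (q / c ^+ 2) 8^-1 = q / c ^+ 2.
    by apply/max_idPl; lra.
  rewrite powRM ?invr_ge0 ?ltW //.
  have E1 : q `^ (1 - n%:R / 2) = q * q `^ (- (n%:R / 2)).
    by rewrite powRD ?powRr1 // (gt_eqF qp) implybT.
  have E2 : (c ^+ 2)^-1 `^ (1 - n%:R / 2) = c ^+ n / c ^+ 2.
    rewrite -(powR_invn 2 (ltW c0)) -powRrM -(powR_mulrn n (ltW c0)).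
    by rewrite -powRD ?(gt_eqF c0) ?implybT //; congr powR; field.
  rewrite E1 E2.
  have cn : c ^+ n != 0 by rewrite expf_neq0 // gt_eqF.
  by field; rewrite cn andbT gt_eqF.
rewrite !kerE // ?lexx // ?(ltW kh2) // -mulrBr /p'.
have [qk|qk] := leP q (kappa ^+ 2 / 4).
  have := mm'_left qk; rewrite /mm' => E.
  have -> : 4 * q * pw q * (beta (q / h ^+ 2) / h ^+ 2 - beta (q / kappa ^+ 2) / kappa ^+ 2) = 
    - (4 * q * pw q * mm' q) by rewrite /mm'; ring.
  by rewrite E (mm'_left qk) /p (mm_left qk); ring.
have qp : q != 0 by rewrite gt_eqF //; have := k2; lra.
by rewrite /mm'; field; rewrite qp !gt_eqF ?exprn_gt0.
Qed.

End TestFunction.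

(** * The mean value inequality *)

Section MeanValue.
Context {R : realType} {n : nat}.
Variable Omega : set 'rV[R]_n.
Hypotheses (oO : open Omega) (OT : Omega != setT).
Hypothesis superharmonic : neg_laplacian_dist_ge0 Omega.

Local Notation d := (dist_compl Omega).

Lemma cc_scaled_kernel (x : 'rV[R]_n) (c : R) : 0 < c ->
  cc (fun y => ker n (sqn (y - x) / c ^+ 2)).
Proof.
move=> c0; have c2 : 0 < c ^+ 2 by rewrite exprn_gt0.
have -> : (fun y => ker n (sqn (y - x) / c ^+ 2)) =
          (fun y => ker n (sqn (1 *: y - x) / c ^+ 2)).
  by apply/funext => y; rewrite scale1r.
apply: (@cc_affine R n 1 (- x) (fun y => ker n (sqn y / c ^+ 2))) (oner_neq0 R).
apply: (@cc_radial R n (fun r => ker n (r / c ^+ 2)) (c ^+ 2)).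
  apply: (@cont_comp R R (fun r => r / c ^+ 2) (ker n)); last exact: ker_continuous.
  by apply: cont_mul => r; [exact: cvg_id|exact: cvg_cst].
by move=> r cr; apply: ker_right; rewrite ler_pdivlMr // mul1r.
Qed.

(** Substitution [y = c z + x]; the factor [c^(-n)] absorbs the Jacobian. *)
Lemma I_scaled_kernel (f : 'rV[R]_n -> R) (x : 'rV[R]_n) (c : R) : continuous f -> 0 < c ->
  I (fun y => f y * (c ^- n * ker n (sqn (y - x) / c ^+ 2))) =
  I (fun z => K z * f (c *: z + x)).
Proof.
move=> cf c0.
have c2 : 0 < c ^+ 2 by rewrite exprn_gt0.
pose g y := f y * ker n (sqn (y - x) / c ^+ 2).
have cg : cc g by apply: cc_mulr => //; exact: cc_scaled_kernel.
have -> : (fun y => f y * (c ^- n * ker n (sqn (y - x) / c ^+ 2))) = (fun y => c ^- n * g y).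
  by apply/funext => y; rewrite /g; ring.
rewrite I_scale // -{1}(gtr0_norm c0) -(I_affine x cg (lt0r_neq0 c0)).
congr I; apply/funext => z; rewrite /g addrK sqnZ mulrC; congr (ker n _ * _).
by rewrite mulrC mulKf // gt_eqF.
Qed.

(** The difference of the two sides is the integral of [d] against the Laplacian of [test_fun],
    whose support lies in the ball of radius [h] and hence in [Omega]. *)
Lemma dist_mean_mono (x : 'rV[R]_n) (kappa h : R) : 0 < kappa -> kappa < h -> h < d x ->
  I (fun z => K z * d (h *: z + x)) <= I (fun z => K z * d (kappa *: z + x)).
Proof.
move=> k0 kh hd; have h0 := lt_trans k0 kh.
have cd : continuous d := dist_continuous OT.
have ck c : 0 < c -> cc (fun y => d y * (c ^- n * ker n (sqn (y - x) / c ^+ 2))).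
  by move=> c0; apply: cc_mulr => //; apply: cc_scale; exact: cc_scaled_kernel.
rewrite -!I_scaled_kernel // -subr_le0 -I_sub; [|exact: ck..].
have HO y : enorm (y - x) <= h -> Omega y.
  move=> yh; apply: contrapT => /(dist_le OT x); rewrite enormB; lra.
have := superharmonic (test_fun_Cc k0 kh HO) (test_fun_ge0 _ _ _).
have -> : (fun y => (d y * laplacian (test_fun x k0 kh) y)%:E) =
  (fun y => (d y * (h ^- n * ker n (sqn (y - x) / h ^+ 2)) -
             d y * (kappa ^- n * ker n (sqn (y - x) / kappa ^+ 2)))%:E).
  by apply/funext => y; rewrite laplacian_test_fun mulrBr.
by rewrite iintE ?lee_fin //; apply: cc_sub; exact: ck.
Qed.

Lemma cc_K_mul (f : 'rV[R]_n -> R) : continuous f -> cc (fun z => K z * f z).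
Proof. by move=> cf; exact: cc_mull cc_K cf. Qed.

Lemma affine_continuous (c : R) (x : 'rV[R]_n) : continuous (fun z : 'rV[R]_n => c *: z + x).
Proof.
apply: (@lipschitz_continuous R _ _ _ `|c|) => y z.
by rewrite opprD addrACA subrr addr0 -scalerBr normrZ ler_wpM2l // norm_le_enorm.
Qed.

Lemma cont_affine (f : 'rV[R]_n -> R) (c : R) (x : 'rV[R]_n) : continuous f ->
  continuous (fun z : 'rV[R]_n => f (c *: z + x)).
Proof.
by move=> cf z; apply: (continuous_comp (@affine_continuous c x z)); exact: cf.
Qed.

(** The smaller radius tends to 0: on the support of [K], [d (kappa z + x) <= d x + kappa], and
    [kappa] is chosen with [kappa * I K <= e]. *)
Lemma dist_mean_value (x : 'rV[R]_n) (h : R) : 0 < h -> h < d x ->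
  I (fun z => K z * d (h *: z + x)) <= d x * I (@K R n).
Proof.
move=> h0 hd; have cd : continuous d := dist_continuous OT.
have IK0 : 0 <= I (@K R n) by apply: I_ge0; [exact: cc_K|exact: K_ge0].
apply/ler_addgt0Pl => e e0.
pose kappa := Num.min (h / 2) (e / (I (@K R n) + 1)).
have k0 : 0 < kappa by rewrite lt_min !divr_gt0 // ltr_wpDl.
have kh : kappa < h by apply: (@le_lt_trans _ _ (h / 2)); [rewrite ge_min lexx|lra].
apply: le_trans (dist_mean_mono k0 kh hd) _.
apply: (@le_trans _ _ ((kappa + d x) * I (@K R n))); last first.
  rewrite mulrDl lerD2r; apply: (@le_trans _ _ (kappa * (I (@K R n) + 1))).
    by rewrite ler_wpM2l ?ltW //; lra.
  by rewrite -ler_pdivlMr ?ltr_wpDl // ge_min lexx orbT.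
rewrite -I_scale; last exact: cc_K.
apply: I_le => [||z]; [by apply: cc_K_mul; exact: cont_affine|exact: cc_scale cc_K|].
have [->|Kz] := eqVneq (K z) 0; first by rewrite mul0r mulr0.
rewrite mulrC ler_wpM2r ?K_ge0 //.
have := dist_triangle OT (kappa *: z + x) x; rewrite addrK enormZ gtr0_norm //.
have : kappa * enorm z <= kappa by apply: ler_piMr; [exact: ltW|exact: K_supp].
lra.
Qed.

End MeanValue.

(** * The Hardy inequality *)

Section SmoothCompactSupport.
Context {R : realType} {n : nat}.

(** The convex function [r^(-p)] lies above its tangent at [b]. With
    [a^(-p) = b^(-p) exp (- p ln (a / b))] it follows from [exp t >= 1 + t], used once for the power
    and once for the logarithm. *)
Lemma powR_tangent (p a b : R) : 0 < p -> 0 < a -> 0 < b ->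
  b `^ (- p) - p * b `^ (- p - 1) * (a - b) <= a `^ (- p).
Proof.
move=> p0 a0 b0.
have -> : a `^ (- p) = b `^ (- p) * expR (- p * ln (a / b)).
  have -> : expR (- p * ln (a / b)) = (a / b) `^ (- p).
    by rewrite /powR gt_eqF // divr_gt0.
  rewrite -powRM ?(ltW b0) ?divr_ge0 ?(ltW a0) ?(ltW b0) //.
  by congr powR; rewrite mulrC divfK // gt_eqF.
have -> : b `^ (- p - 1) = b `^ (- p) / b.
  by rewrite powRB ?(gt_eqF b0) ?implybT // powRr1 // ltW.
have bp : 0 < b `^ (- p) by exact: powR_gt0.
have -> : b `^ (- p) - p * (b `^ (- p) / b) * (a - b) = b `^ (- p) * (1 - p * (a / b - 1)).
  by field; rewrite gt_eqF.
rewrite ler_pM2l //; apply: le_trans (expR_ge1Dx _).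
rewrite lerD2l mulNr lerN2 ler_pM2l //.
have ab : 0 < a / b by exact: divr_gt0.
by have := expR_ge1Dx (ln (a / b)); rewrite lnK ?posrE //; lra.
Qed.

Variable u : 'rV[R]_n -> R.

Definition grad (x : 'rV[R]_n) : 'rV[R]_n := \row_i dpartial i u x.

Lemma gradnormE x : gradnorm u x = enorm (grad x).
Proof. by congr Num.sqrt; apply: eq_bigr => i _; rewrite mxE. Qed.

Variable Omega : set 'rV[R]_n.
Hypothesis Cu : Cc_infty Omega u.

Lemma Cc_continuous : continuous u.
Proof. by have [/(_ [::])[]] := Cu. Qed.

Lemma Cc_dpartial_continuous i : continuous (dpartial i u).
Proof. by have [/(_ [:: i])[]] := Cu. Qed.

Lemma Cc_derive x i : is_derive x (ebasis R i) u (dpartial i u x).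
Proof.
have [/(_ [::])[_ /(_ i x) H] _] := Cu.
by apply: DeriveDef.
Qed.

Lemma fsupportP x : u x != 0 -> fsupport u x.
Proof. by move=> ux; exact: subset_closure. Qed.

Lemma Cc_bounded : exists2 M : R, 0 < M & forall x, M < `|x| -> ~ fsupport u x.
Proof.
have [_ [/compact_bounded [M [_ HM]] _]] := Cu.
exists (Num.max 1 (M + 1)); first by rewrite lt_max ltr01.
move=> x Mx ux; have := HM (M + 1) (ltac:(by rewrite ltrDl)) x ux.
by move: Mx; rewrite gt_max => /andP[_]; rewrite ltNge => /negP.
Qed.

Lemma cc_Cc : cc u.
Proof.
split; first exact: Cc_continuous.
have [M _ HM] := Cc_bounded; exists M => x /HM ux.
by apply/eqP; apply: contrapT => /negP/fsupportP.
Qed.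

Lemma dpartial_outside i x : ~ fsupport u x -> dpartial i u x = 0.
Proof.
move=> ux.
have H : is_derive x (ebasis R i) u 0.
  apply: (@near_eq_is_derive R _ R (cst 0) u x (ebasis R i) 0 _ (is_derive_cst _ _ _)).
  have : open (~` fsupport u) by apply: closed_openC; exact: closed_closure.
  rewrite openE => /(_ x ux); apply: filterS => y uy /=.
  by apply/esym/eqP; apply: contrapT => /negP/fsupportP.
by case: H.
Qed.

Lemma cc_dpartial i : cc (dpartial i u).
Proof.
split; first exact: Cc_dpartial_continuous.
by have [M _ HM] := Cc_bounded; exists M => x /HM/dpartial_outside.
Qed.

Lemma cc_gradnorm : cc (gradnorm u).
Proof.
split.
  apply: (@cont_comp R _ (fun x => \sum_(i < n) dpartial i u x ^+ 2) Num.sqrt); last first.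
    exact: sqrt_continuous.
  apply: cont_sum => i.
  apply: (@cont_comp R _ (dpartial i u) (fun r => r ^+ 2)).
    exact: Cc_dpartial_continuous.
  exact: exprn_continuous.
have [M _ HM] := Cc_bounded; exists M => x /HM ux; rewrite /gradnorm big1 ?sqrtr0 // => i _.
by rewrite dpartial_outside // expr0n.
Qed.

Lemma Taylor_step (x y : 'rV[R]_n) i (t e : R) :
  (forall r, `|r| <= `|t| -> `|dpartial i u (y + r *: ebasis R i) - dpartial i u x| <= e) ->
  `|u (y + t *: ebasis R i) - u y - t * dpartial i u x| <= e * `|t|.
Proof.
move=> H.
pose g (r : R) := u (y + r *: ebasis R i) - dpartial i u x * r.
have dg : primitive g (fun r => dpartial i u (y + r *: ebasis R i) - dpartial i u x * 1).
  move=> r.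
  have d1 : is_derive r 1 (fun r : R => u (y + r *: ebasis R i)) (dpartial i u (y + r *: ebasis R i)).
    refine ((@is_derive_line R _ u _ (y + r *: ebasis R i) (ebasis R i) r _ _).1 (Cc_derive _ _)) => k.
    by congr u; rewrite scalerDl addrCA.
  apply: (@is_deriveB R R R _ (fun r => dpartial i u x * r) r 1 _ _ d1).
have := @derivative_bound R g _ e 0 t dg.
rewrite /g scale0r addr0 mulr0 subr0 sub0r normrN distrC.
have -> : u (y + t *: ebasis R i) - dpartial i u x * t - u y =
  u (y + t *: ebasis R i) - u y - t * dpartial i u x by ring.
by apply => z; rewrite sub0r normrN mulr1; exact: H.
Qed.

(** Smoothness is given through partial derivatives, so the increment is split along a path from [x]
    to [x + w] that changes one coordinate at a time. Uniform continuity of the partials makes [eta]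
    independent of [x]. *)
Lemma Taylor (e : R) : 0 < e -> exists2 eta : R, 0 < eta &
  forall x w, enorm w < eta -> `|u (w + x) - u x - dot (grad x) w| <= e * enorm w.
Proof.
move=> e0.
have e'0 : 0 < e / (n%:R + 1) by rewrite divr_gt0 // ltr_wpDl.
have H i : exists eta : R, 0 < eta /\ forall x y, `|x - y| < eta ->
    `|dpartial i u x - dpartial i u y| < e / (n%:R + 1).
  by have [d d0 Hd] := cc_ucont (@proper_rV R n) (cc_dpartial i) e'0; exists d.
have [eta Heta] := choice H.
exists (\big[Num.min/1]_(i < n) eta i).
  by apply/bigmin_gtP; split => // i _; case: (Heta i).
move=> x w we.
have wi i : enorm w < eta i.
  by apply: lt_le_trans we _; exact: bigmin_le_cond.
(* The path: [P k] keeps the first [k] coordinates of [w]. *)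
pose P (k : nat) : 'rV[R]_n := \row_j (if (j < k)%N then w ord0 j else 0).
have P0 : P 0%N = 0 by apply/rowP => j; rewrite !mxE.
have Pn : P n = w by apply/rowP => j; rewrite !mxE ltn_ord.
have PS (i : 'I_n) : P i.+1 = P i + w ord0 i *: ebasis R i.
  apply/rowP => j; rewrite !mxE eqxx /= ltnS leq_eqVlt.
  have [ji|ji] := eqVneq j i.
    by rewrite ji eqxx ltnn /= mulr1 add0r.
  by rewrite (negbTE (ji : val j != val i)) mulr0 addr0.
have E : u (w + x) - u x - dot (grad x) w =
  \sum_(i < n) (u (x + P i + w ord0 i *: ebasis R i) - u (x + P i) - w ord0 i * dpartial i u x).
  rewrite sumrB; congr (_ - _); last first.
    by apply: eq_bigr => i _; rewrite mxE mulrC.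
  have -> : u (w + x) - u x = u (x + P n) - u (x + P 0%N) by rewrite Pn P0 addr0 [w + x]addrC.
  rewrite -(@telescope_sumr _ 0%N n (fun k => u (x + P k))) // big_mkord.
  by apply: eq_bigr => i _; rewrite PS addrA.
rewrite E; apply: le_trans (ler_norm_sum _ _ _) _.
apply: (@le_trans _ _ (\sum_(i < n) e / (n%:R + 1) * enorm w)).
  apply: ler_sum => i _.
  apply: (@le_trans _ _ (e / (n%:R + 1) * `|w ord0 i|)); last first.
    by rewrite ler_pM2l //; apply: le_trans (norm_le_enorm w); exact: rV_coord_le.
  apply: Taylor_step => r rw; apply/ltW; apply: (Heta i).2.
  apply: le_lt_trans (wi i); apply: le_trans (norm_le_enorm w).
  have -> : x + P i + r *: ebasis R i - x = P i + r *: ebasis R i by rewrite -[x + P i + _]addrA [x + _]addrC addrK.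
  rewrite rV_norm_le //; apply/forallP => j; rewrite !mxE eqxx /=.
  have [->|ji] := eqVneq j i.
    by rewrite ltnn mulr1 add0r; apply: le_trans rw _; exact: rV_coord_le.
  by rewrite mulr0 addr0; case: ifP => _; rewrite ?normr0 ?rV_coord_le.
rewrite sumr_const card_ord -[leLHS]mulr_natl mulrA ler_wpM2r ?enorm_ge0 //.
rewrite mulrA ler_pdivrMr ?ltr_wpDl // mulrC mulrDr mulr1 lerDl ltW //.
Qed.

Hypotheses (oO : open Omega) (OT : Omega != setT).

(** The factor 2 leaves room: points within [delta] of a point where [u] does not vanish are still
    at distance at least [delta] from the complement. *)
Lemma Cc_dist_gt : exists2 delta : R, 0 < delta &
  forall x, u x != 0 -> 2 * delta <= dist_compl Omega x.
Proof.
have [/set0P[x0 ux0]|/negP/negPn/eqP E] := pselect (fsupport u != set0); last first.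
  by exists 1 => // x /fsupportP; rewrite E.
have [_ [cs sO]] := Cu.
have [|c /set_mem uc Hc] := EVT_min_rV (ex_intro _ x0 ux0) cs (f := dist_compl Omega).
  apply: continuous_subspaceT; exact: dist_continuous.
exists (dist_compl Omega c / 2).
  by rewrite divr_gt0 //; apply: dist_gt0 => //; exact: sO.
move=> x /fsupportP ux; rewrite mulrC divfK //.
by apply: Hc; exact/mem_set.
Qed.

End SmoothCompactSupport.

(** * Integrals over pairs of nearby points *)

Section PairIntegral.
Context {R : realType} {n : nat}.
Local Notation V := 'rV[R]_n.

(** Vanishing is asked only when both points are far, as befits expressions such as [u y - u x]. The
    kernel keeps the two points close, which restores compact support. *)
Definition pair_cc (Phi : V -> V -> R) :=
  continuous (fun p : V * V => Phi p.1 p.2) /\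
  exists M : R, forall x y, M < `|x| -> M < `|y| -> Phi x y = 0.

(** Up to a power of [h], the integral of [Phi x y] against the symmetric weight
    [K ((y - x) / h)]. *)
Definition W (h : R) (Phi : V -> V -> R) : R :=
  I (fun x => I (fun z => K z * Phi x (h *: z + x))).

Lemma cc_pair (h : R) (Phi : V -> V -> R) : pair_cc Phi ->
  cc (fun p : V * V => K p.2 * Phi p.1 (h *: p.2 + p.1)).
Proof.
move=> [cPhi [M HM]]; split.
  apply: cont_mul.
    move=> p; apply: (@continuous_comp _ _ _ (fun p : V * V => p.2) K); first exact: cvg_snd.
    exact: cc_K.1.
  move=> p; apply: (@continuous_comp _ _ _ (fun p : V * V => (p.1, h *: p.2 + p.1))
    (fun p => Phi p.1 p.2)); last exact: cPhi.
  apply: (continuousP_eps (fun p : V * V => (p.1, h *: p.2 + p.1))).2 => q e e0.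
  have h1 : 0 < `|h| + 1 by rewrite ltr_wpDl.
  exists (e / (`|h| + 1)); first exact: divr_gt0.
  move=> r; rewrite !prod_norm_lt /= => /andP[r1 r2].
  have r1e : `|q.1 - r.1| < e.
    by apply: lt_le_trans r1 _; rewrite ler_pdivrMr // ler_peMr ?(ltW e0) // lerDr.
  rewrite r1e /= opprD addrACA -scalerBr.
  apply: le_lt_trans (ler_normD _ _) _; rewrite normrZ.
  have : `|h| * `|q.2 - r.2| + `|q.1 - r.1| < `|h| * (e / (`|h| + 1)) + e / (`|h| + 1).
    by apply: ler_ltD => //; rewrite ler_wpM2l // ltW.
  move=> /lt_le_trans; apply.
  have -> // : `|h| * (e / (`|h| + 1)) + e / (`|h| + 1) = e by field; rewrite gt_eqF.
(* Either [|z| > 1], where [K] vanishes, or [|x| > M + |h|], and then both points are beyond [M]. *)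
exists (Num.max (M + `|h|) 1) => -[x z] /=; rewrite prod_normE lt_max /= !gt_max.
have [->|Kz] := eqVneq (K z) 0; first by rewrite mul0r.
have z1 : `|z| <= 1 by apply: le_trans (norm_le_enorm z) _; exact: K_supp.
case/orP => /andP[Mx x1]; last by move: z1; lra.
have xy : `|x| <= `|h *: z + x| + `|h|.
  have -> : `|x| = `|(h *: z + x) - h *: z| by rewrite addrAC subrr add0r.
  apply: le_trans (ler_normB _ _) _; rewrite lerD2l normrZ.
  by apply: ler_piMr.
rewrite HM ?mulr0 //; have := normr_ge0 h; lra.
Qed.

Lemma cc_pair_inner h Phi x : pair_cc Phi -> cc (fun z => K z * Phi x (h *: z + x)).
Proof.
move=> /(cc_pair h) H; apply: (cc_comp_isom H (g := fun z => (x, z))) => [z z'|z].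
  by rewrite prod_normE /= subrr normr0 ge_max lexx normr_ge0.
by rewrite prod_normE /= le_max lexx orbT.
Qed.

Lemma cc_pair_outer h Phi : pair_cc Phi ->
  cc (fun x => I (fun z => K z * Phi x (h *: z + x))).
Proof. by move=> /(cc_pair h); apply: cc_I_param; exact: proper_rV. Qed.

Lemma W_le h Phi Psi : pair_cc Phi -> pair_cc Psi ->
  (forall x y, Phi x y <= Psi x y) -> W h Phi <= W h Psi.
Proof.
move=> c1 c2 H; apply: I_le => [||x]; [exact: cc_pair_outer..|].
by apply: I_le => [||z]; [exact: cc_pair_inner..|rewrite ler_wpM2l ?K_ge0].
Qed.

Lemma pair_cc_scale a Phi : pair_cc Phi -> pair_cc (fun x y => a * Phi x y).
Proof.
move=> [c1 [M HM]]; split; first by apply: cont_mul => //; exact: cont_cst.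
by exists M => x y Mx My; rewrite HM // mulr0.
Qed.

Lemma pair_cc_add Phi Psi : pair_cc Phi -> pair_cc Psi ->
  pair_cc (fun x y => Phi x y + Psi x y).
Proof.
move=> [c1 [M HM]] [c2 [N HN]]; split; first exact: cont_add.
exists (Num.max M N) => x y; rewrite !gt_max => /andP[? ?] /andP[? ?].
by rewrite HM // HN // addr0.
Qed.

Lemma W_scale h a Phi : pair_cc Phi -> W h (fun x y => a * Phi x y) = a * W h Phi.
Proof.
move=> c1; rewrite /W -I_scale; last exact: cc_pair_outer.
congr I; apply/funext => x; rewrite -I_scale; last exact: cc_pair_inner.
by congr I; apply/funext => z; ring.
Qed.

Lemma W_add h Phi Psi : pair_cc Phi -> pair_cc Psi ->
  W h (fun x y => Phi x y + Psi x y) = W h Phi + W h Psi.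
Proof.
move=> c1 c2; rewrite /W -I_add; [|exact: cc_pair_outer..].
congr I; apply/funext => x; rewrite -I_add; [|exact: cc_pair_inner..].
by congr I; apply/funext => z; ring.
Qed.

Lemma pair_cc_sub Phi Psi : pair_cc Phi -> pair_cc Psi ->
  pair_cc (fun x y => Phi x y - Psi x y).
Proof.
move=> c1 c2; have := pair_cc_add c1 (pair_cc_scale (-1) c2); congr pair_cc.
by apply/funext => x; apply/funext => y; rewrite mulN1r.
Qed.

Lemma W_sub h Phi Psi : pair_cc Phi -> pair_cc Psi ->
  W h (fun x y => Phi x y - Psi x y) = W h Phi - W h Psi.
Proof.
move=> c1 c2; rewrite -mulN1r -W_scale // -W_add //; last exact: pair_cc_scale.
by congr (W h); apply/funext => x; apply/funext => y; rewrite mulN1r.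
Qed.

Lemma W_sub_le h Phi Psi Phi' Psi' :
  pair_cc Phi -> pair_cc Psi -> pair_cc Phi' -> pair_cc Psi' ->
  (forall x y, Phi x y - Psi x y <= Phi' x y - Psi' x y) ->
  W h Phi - W h Psi <= W h Phi' - W h Psi'.
Proof.
by move=> *; rewrite -!W_sub //; apply: W_le => //; exact: pair_cc_sub.
Qed.

Lemma pair_cc_swap Phi : pair_cc Phi -> pair_cc (fun x y => Phi y x).
Proof.
move=> [c1 [M HM]]; split; last by exists M => x y Mx My; exact: HM.
move=> p; apply: (@continuous_comp _ _ _ (fun p : V * V => (p.2, p.1))
  (fun p => Phi p.1 p.2)); last exact: c1.
apply: (continuousP_eps (fun p : V * V => (p.2, p.1))).2 => q e e0.
by exists e => // r; rewrite !prod_norm_lt /= andbC.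
Qed.

(* [K] is even, so the pairs [(x, x + h z)] and [(x + h z, x)] are equally
   distributed. *)
Lemma W_swap h Phi : pair_cc Phi -> W h Phi = W h (fun x y => Phi y x).
Proof.
move=> cP; have cP' := pair_cc_swap cP.
have cp := cc_pair h cP; have cp' := cc_pair h cP'.
rewrite /W (I_exchange (f := fun p => K p.2 * Phi p.1 (h *: p.2 + p.1))) //.
rewrite (I_exchange (f := fun p => K p.2 * Phi (h *: p.2 + p.1) p.1)) //=.
have sl z : cc (fun x => K z * Phi x (h *: z + x)).
  apply: (cc_comp_isom cp (g := fun x => (x, z))) => [x x'|x].
    by rewrite prod_normE /= subrr normr0 ge_max lexx normr_ge0.
  by rewrite prod_normE /= le_max lexx.
rewrite -[RHS]I_flip; last first.
  have := @cc_I_param R n V (fun p => K p.1 * Phi (h *: p.1 + p.2) p.2) (@proper_rV R n).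
  apply; apply: (cc_comp_isom cp' (g := fun p : V * V => (p.2, p.1))) => [p q|p].
    by rewrite !prod_normE /= maxC.
  by rewrite !prod_normE /= maxC.
congr I; apply/funext => z; rewrite -(I_trans (- (h *: z)) (sl z)).
by congr I; apply/funext => x; rewrite K_even scalerN addrCA subrr addr0 addrC.
Qed.

End PairIntegral.

(** * Symmetrisation and the limit of order [h^2] *)

Section HardyInequality.
Context {R : realType} {n : nat}.
Variable Omega : set 'rV[R]_n.
Hypotheses (oO : open Omega) (OT : Omega != setT).
Hypothesis superharmonic : neg_laplacian_dist_ge0 Omega.
Variable (i0 : 'I_n).

Local Notation d := (dist_compl Omega).
Local Notation V := 'rV[R]_n.

Let pos (r : R) : R := Num.max 0 r.

Let pos_ge0 r : 0 <= pos r. Proof. by rewrite le_max lexx. Qed.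

Let pos_ge r : r <= pos r. Proof. by rewrite le_max lexx orbT. Qed.

Let pos_mono r s : r <= s -> pos r <= pos s.
Proof.
by move=> rs; rewrite /pos ge_max le_max lexx /= le_max rs orbT.
Qed.

Let posB r : pos r - pos (- r) = r.
Proof.
rewrite /pos; have [r0|/ltW r0] := leP 0 r.
  by rewrite (max_idPl _) ?subr0 //; rewrite oppr_le0.
by rewrite (max_idPr _) ?oppr_ge0 // sub0r opprK.
Qed.

Let pos_pos r : 0 <= r -> pos r = r.
Proof. by move=> r0; exact/max_idPr. Qed.

Let pos_neg r : r <= 0 -> pos r = 0.
Proof. by move=> r0; exact/max_idPl. Qed.

Let cont_pos (T : topologicalType) (f : T -> R) : continuous f -> continuous (fun x => pos (f x)).
Proof. by move=> cf; apply: cont_max => //; exact: cont_cst. Qed.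

Lemma dot_abs_le (e z : V) : enorm z <= 1 -> `|dot e z| <= enorm e.
Proof.
move=> z1; apply: le_trans (Cauchy_Schwarz e z) _.
by apply: ler_piMr => //; exact: enorm_ge0.
Qed.

(* By the symmetry [z -> - z]. *)
Lemma I_K_half_sq (e : V) : enorm e = 1 ->
  I (fun z => K z * pos (- dot e z) ^+ 2) = cK n / 2.
Proof.
move=> e1.
have cp : continuous (fun z : V => pos (dot e z) ^+ 2).
  apply: (@cont_comp R _ (fun z => pos (dot e z)) (fun r => r ^+ 2)); last exact: exprn_continuous.
  by apply: cont_pos; exact: dot_continuous.
have E : I (fun z => K z * pos (- dot e z) ^+ 2) = I (fun z => K z * pos (dot e z) ^+ 2).
  by rewrite -(I_K_even cp); congr I; apply/funext => z; rewrite dotNr.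
have cp' : continuous (fun z : V => pos (- dot e z) ^+ 2).
  apply: (@cont_comp R _ (fun z => pos (- dot e z)) (fun r => r ^+ 2)); last exact: exprn_continuous.
  apply: cont_pos; apply: (@cont_comp R _ (dot e) -%R); first exact: dot_continuous.
  exact: opp_continuous.
have : I (fun z => K z * pos (- dot e z) ^+ 2) + I (fun z => K z * pos (dot e z) ^+ 2) = cK n.
  rewrite -I_add; [|exact: cc_K_mul..].
  rewrite -[cK n]mulr1 -(expr1n R 2) -e1 enorm_sq -I_K_dot_sq.
  congr I; apply/funext => z; rewrite -mulrDr; congr (_ * _).
  rewrite -{3}(posB (dot e z)); set r := dot e z.
  have [r0|/ltW r0] := leP 0 r.
    by rewrite (@pos_neg (- r)) ?oppr_le0 //; ring.
  by rewrite (@pos_neg r) //; ring.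
rewrite -E; lra.
Qed.

(** Adding the integral with [- e] in place of [e] turns the positive part into [|dot e z|]. Then [2
    |g| |g.z| |e.z| <= (g.z)^2 + |g|^2 (e.z)^2], and both terms on the right integrate to
    [cK n * |g|^2]. *)
Lemma I_K_half_abs (g e : V) : enorm e = 1 ->
  I (fun z => K z * (`|dot g z| * pos (dot e z))) <= cK n / 2 * enorm g.
Proof.
move=> e1.
have cg : continuous (fun z : V => `|dot g z|) by apply: cont_norm; exact: dot_continuous.
have cp : continuous (fun z : V => `|dot g z| * pos (dot e z)).
  by apply: cont_mul => //; apply: cont_pos; exact: dot_continuous.
have cN : continuous (fun z : V => - dot e z).
  by apply: (@cont_comp R _ (dot e) -%R); [exact: dot_continuous|exact: opp_continuous].
have cp' : continuous (fun z : V => `|dot g z| * pos (- dot e z)).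
  by apply: cont_mul => //; exact: cont_pos.
have E : I (fun z => K z * (`|dot g z| * pos (- dot e z))) =
         I (fun z => K z * (`|dot g z| * pos (dot e z))).
  by rewrite -(I_K_even cp); congr I; apply/funext => z; rewrite !dotNr normrN.
have g0 := enorm_ge0 g.
suff : I (fun z => K z * (`|dot g z| * pos (dot e z))) +
       I (fun z => K z * (`|dot g z| * pos (- dot e z))) <= cK n * enorm g.
  by rewrite E; lra.
rewrite -I_add; [|exact: cc_K_mul..].
have -> : (fun z => K z * (`|dot g z| * pos (dot e z)) + K z * (`|dot g z| * pos (- dot e z))) =
  (fun z => K z * (`|dot g z| * `|dot e z|)).
  apply/funext => z; rewrite -!mulrDr; congr (_ * (_ * _)).
  have [r0|/ltW r0] := leP 0 (dot e z).
    by rewrite (@pos_neg (- _)) ?oppr_le0 // pos_pos // ger0_norm // addr0.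
  by rewrite (@pos_neg (dot e z)) // pos_pos ?oppr_ge0 // ler0_norm // add0r.
have [g00|g00] := eqVneq (enorm g) 0.
  have -> : (fun z => K z * (`|dot g z| * `|dot e z|)) = (fun z : V => 0).
    apply/funext => z; rewrite (enorm_eq0 g00) -(scale0r 0) dotZl mul0r normr0.
    by rewrite mul0r mulr0.
  by rewrite I_0 g00 mulr0.
have gp : 0 < enorm g by rewrite lt_neqAle eq_sym g00.
rewrite -(ler_pM2l gp) -I_scale; last first.
  by apply: cc_K_mul; apply: cont_mul => //; apply: cont_norm; exact: dot_continuous.
have csq (a : V) : cc (fun z => K z * dot a z ^+ 2).
  apply: cc_K_mul; apply: (@cont_comp R _ (dot a) (fun r => r ^+ 2)).
    exact: dot_continuous.
  exact: exprn_continuous.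
apply: (@le_trans _ _ (I (fun z => 2^-1 * (K z * dot g z ^+ 2 + enorm g ^+ 2 * (K z * dot e z ^+ 2))))).
  apply: I_le => [||z].
  - apply: cc_scale; apply: cc_K_mul; apply: cont_mul => //.
    by apply: cont_norm; exact: dot_continuous.
  - by apply: cc_scale; apply: cc_add => //; exact: cc_scale.
  have -> : enorm g * (K z * (`|dot g z| * `|dot e z|)) =
            K z * (`|dot g z| * (enorm g * `|dot e z|)) by ring.
  have -> : 2^-1 * (K z * dot g z ^+ 2 + enorm g ^+ 2 * (K z * dot e z ^+ 2)) =
     K z * (2^-1 * (dot g z ^+ 2 + (enorm g ^+ 2 * dot e z ^+ 2))) by ring.
  rewrite ler_wpM2l ?K_ge0 // -[dot g z ^+ 2]real_normK ?num_real //.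
  rewrite -[dot e z ^+ 2]real_normK ?num_real //.
  have := sqr_ge0 (`|dot g z| - enorm g * `|dot e z|).
  rewrite sqrrB exprMn -mulr_natl; lra.
rewrite I_scale; last by apply: cc_add => //; exact: cc_scale.
rewrite I_add ?I_scale ?I_K_dot_sq //; last exact: cc_scale.
rewrite -!enorm_sq e1 expr1n; lra.
Qed.

Variables (u : V -> R) (s : R).
Hypotheses (Cu : Cc_infty Omega u) (s1 : 1 < s).
Variable delta : R.
Hypotheses (delta0 : 0 < delta) (udelta : forall x, u x != 0 -> 2 * delta <= d x).

(* Truncating the distance makes its negative powers continuous everywhere,
   without changing it near the support of [u]. *)
Let D (x : V) : R := Num.max (d x) delta.

Let D_gt0 x : 0 < D x. Proof. by rewrite lt_max delta0 orbT. Qed.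

Let D_continuous : continuous D.
Proof. by apply: cont_max; [exact: dist_continuous|exact: cont_cst]. Qed.

Let DE x : delta <= d x -> D x = d x.
Proof. by move=> dx; exact/max_idPl. Qed.

Let v x := `|u x|.

Let v_ge0 x : 0 <= v x. Proof. exact: normr_ge0. Qed.

Let v_continuous : continuous v.
Proof. by apply: cont_norm; exact: Cc_continuous Cu. Qed.

Let Dp_continuous p : continuous (fun x => D x `^ p).
Proof. exact: cont_pow. Qed.

Let dist_shift (h : R) z x : 0 < h -> enorm z <= 1 ->
  `|d (h *: z + x) - d x| <= h.
Proof.
move=> h0 z1; apply: le_trans (dist_lip OT _ _) _.
by rewrite addrK enormZ gtr0_norm //; apply: ler_piMr => //; exact: ltW.
Qed.

Let cV (f : V -> R) : continuous f -> continuous (fun p : V * V => f p.1).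
Proof. by move=> cf p; apply: (@continuous_comp _ _ _ fst f); [exact: cvg_fst|exact: cf]. Qed.

Let cV2 (f : V -> R) : continuous f -> continuous (fun p : V * V => f p.2).
Proof. by move=> cf p; apply: (@continuous_comp _ _ _ snd f); [exact: cvg_snd|exact: cf]. Qed.

Let psi x := v x * D x `^ (1 - s).

(** [Phi1 - Phi2] is [psi x * (D x - D y)], split by sign. [A] carries the variation of [u], [B] the
    gain from convexity. *)
Let Phi1 x y := psi x * pos (D x - D y).
Let Phi2 x y := psi x * pos (D y - D x).
Let A x y := `|u y - u x| * D x `^ (1 - s) * pos (D y - D x).
Let B x y := v x * D x `^ (- s) * pos (D x - D y) ^+ 2.

Let usupp : exists M : R, forall x, M < `|x| -> u x = 0.
Proof. by case: (cc_Cc Cu). Qed.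

Let psi_continuous : continuous psi.
Proof. exact: cont_mul. Qed.

Let c_Phi1 : pair_cc Phi1.
Proof.
split.
  apply: cont_mul; first exact: cV.
  by apply: cont_pos; apply: cont_sub; [exact: cV|exact: cV2].
have [M HM] := usupp; exists M => x y Mx _.
by rewrite /Phi1 /psi /v HM // normr0 !mul0r.
Qed.

Let c_Phi2 : pair_cc Phi2.
Proof.
split.
  apply: cont_mul; first exact: cV.
  by apply: cont_pos; apply: cont_sub; [exact: cV2|exact: cV].
have [M HM] := usupp; exists M => x y Mx _.
by rewrite /Phi2 /psi /v HM // normr0 !mul0r.
Qed.

Let c_A : pair_cc A.
Proof.
have cu := Cc_continuous Cu.
split.
  apply: cont_mul; first apply: cont_mul.
  - by apply: cont_norm; apply: cont_sub; [exact: cV2|exact: cV].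
  - exact: (@cV (fun x => D x `^ (1 - s))).
  - by apply: cont_pos; apply: cont_sub; [exact: cV2|exact: cV].
have [M HM] := usupp; exists M => x y Mx My.
by rewrite /A !HM // subrr normr0 !mul0r.
Qed.

Let c_B : pair_cc B.
Proof.
split.
  apply: cont_mul; first apply: cont_mul.
  - exact: cV.
  - exact: (@cV (fun x => D x `^ (- s))).
  - apply: (@cont_comp R _ (fun p : V * V => pos (D p.1 - D p.2)) (fun r => r ^+ 2)).
      by apply: cont_pos; apply: cont_sub; [exact: cV|exact: cV2].
    exact: exprn_continuous.
have [M HM] := usupp; exists M => x y Mx _.
by rewrite /B /v HM // normr0 !mul0r.
Qed.

(** Write the difference of weights as [(vb - va) a^(1-s) + vb (b^(1-s) - a^(1-s))]. For [a < b] the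
    tangent at [b] bounds the last bracket by [- (s - 1) b^(-s) (b - a)]. *)
Let pair_pointwise (va vb a b du : R) : 0 < a -> 0 < b -> 0 <= vb -> vb - va <= du ->
  vb * b `^ (1 - s) * pos (b - a) - va * a `^ (1 - s) * pos (b - a) <=
  du * a `^ (1 - s) * pos (b - a) - (s - 1) * (vb * b `^ (- s) * pos (b - a) ^+ 2).
Proof.
move=> a0 b0 vb0 vu.
have [ba|ab] := leP b a.
  have -> : pos (b - a) = 0 by apply: pos_neg; rewrite subr_le0.
  by rewrite expr0n /= !mulr0.
rewrite pos_pos ?subr_ge0 ?(ltW ab) //.
have := @powR_tangent R (s - 1) a b (ltac:(by rewrite subr_gt0)) a0 b0.
rewrite opprB; have -> : 1 - s - 1 = - s by ring.
have -> : a - b = - (b - a) by rewrite opprB.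
have r0 : 0 <= b - a by rewrite subr_ge0 ltW.
move: (b - a) r0 => r r0; move: (b `^ (1 - s)) (b `^ (- s)) => p q H.
have := powR_ge0 a (1 - s); move: (a `^ (1 - s)) H => w H w0.
have H1 : vb * (p - w) * r <= - ((s - 1) * (vb * q * r ^+ 2)).
  have -> : - ((s - 1) * (vb * q * r ^+ 2)) = (vb * (- ((s - 1) * q * r))) * r by ring.
  by rewrite ler_wpM2r // ler_wpM2l //; lra.
have H2 : (vb - va) * (w * r) <= du * (w * r) by rewrite ler_wpM2r ?mulr_ge0.
move: H1 H2; lra.
Qed.

(** Where [u x] is nonzero, [d x >= 2 delta]; hence for [h <= delta] the truncation is inactive at
    [x] and at [x + h z], and the mean value inequality applies. *)
Let superharmonic_pairs h : 0 < h -> h <= delta -> 0 <= W h Phi1 - W h Phi2.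
Proof.
move=> h0 hd.
rewrite -W_sub //.
have cs := pair_cc_sub c_Phi1 c_Phi2.
rewrite /W; apply: I_ge0; first exact: (cc_pair_outer h cs).
move=> x.
have -> : (fun z => K z * (Phi1 x (h *: z + x) - Phi2 x (h *: z + x))) =
  (fun z => psi x * (D x * K z - K z * D (h *: z + x))).
  apply/funext => z; rewrite /Phi1 /Phi2 -mulrBr -[D (h *: z + x) - D x]opprB posB; ring.
have cD : continuous (fun z : V => D (h *: z + x)) by exact: cont_affine.
rewrite I_scale; last by apply: cc_sub; [exact: cc_scale cc_K|exact: cc_K_mul].
have [ux|ux] := eqVneq (u x) 0; first by rewrite /psi /v ux normr0 !mul0r.
have dx := udelta ux.
rewrite mulr_ge0 ?mulr_ge0 ?powR_ge0 // I_sub; [|exact: cc_scale cc_K|exact: cc_K_mul].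
rewrite I_scale; last exact: cc_K.
rewrite subr_ge0 DE; last lra.
have -> : (fun z => K z * D (h *: z + x)) = (fun z => K z * d (h *: z + x)).
  apply/funext => z; have [->|Kz] := eqVneq (K z) 0; first by rewrite !mul0r.
  rewrite DE //; have := @dist_shift h z x h0 (K_supp Kz).
  rewrite ler_norml; lra.
by apply: dist_mean_value => //; lra.
Qed.

(** After exchanging the points in [Phi1] and in [B], every term carries a power of
    [pos (D y - D x)], and the inequality holds pair by pair. *)
Let weighted_pairs h : 0 < h -> h <= delta -> (s - 1) * W h B <= W h A.
Proof.
move=> h0 hd.
have cB' := pair_cc_swap c_B; have c1' := pair_cc_swap c_Phi1.
have := superharmonic_pairs h0 hd.
rewrite (W_swap h c_Phi1) (W_swap h c_B) -W_scale // => H.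
rewrite -subr_ge0; apply: le_trans H _.
have c3 : pair_cc (fun x y => (s - 1) * B y x).
  exact: (@pair_cc_scale _ _ _ (fun x y => B y x)).
apply: (W_sub_le h c1' c_Phi2 c_A c3) => x y.
by apply: pair_pointwise => //; apply: le_trans (ler_norm _) _; exact: ler_dist_dist.
Qed.

Let X := I (fun x => v x * D x `^ (- s)).
Let Y := I (fun x => D x `^ (1 - s) * gradnorm u x).

Let cc_v : cc v.
Proof.
split=> //; have [M HM] := usupp; exists M => x Mx.
by rewrite /v HM // normr0.
Qed.

Let cc_X : cc (fun x => v x * D x `^ (- s)).
Proof. exact: cc_mull. Qed.

Let cc_Y : cc (fun x => D x `^ (1 - s) * gradnorm u x).
Proof. by apply: cc_mulr => //; exact: cc_gradnorm Cu. Qed.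

Let IK := I (@K R n).

Let IK_ge0 : 0 <= IK.
Proof. by apply: I_ge0; [exact: cc_K|exact: K_ge0]. Qed.

(** When [h q >= r], squaring costs at most [2 h r] because [q <= 1]; when [h q < r], the left-hand
    side is not positive. *)
Let sq_lower (p q r h : R) : 0 <= p -> 0 <= q <= 1 -> 0 <= r -> 0 <= h -> h * q - r <= p ->
  h ^+ 2 * q ^+ 2 - 2 * h * r <= p ^+ 2.
Proof.
move=> p0 /andP[q0 q1] r0 h0 H.
have hq : 0 <= h * q by exact: mulr_ge0.
have hr : h * q * r <= h * r by rewrite -mulrA ler_wpM2l // ler_piMl.
have hr0 : 0 <= h * r by exact: mulr_ge0.
rewrite -exprMn; have [qr|qr] := leP r (h * q).
  have : (h * q - r) ^+ 2 <= p ^+ 2 by rewrite ler_pXn2r ?nnegrE // subr_ge0.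
  have := sqr_ge0 r; rewrite sqrrB -mulr_natl; lra.
have : (h * q) ^+ 2 <= h * q * r by rewrite expr2 ler_wpM2l // ltW.
have := sqr_ge0 p; lra.
Qed.

(** [dist_upper] gives [D x - D (x + h z) >= - h e.z - h^2 / (4 delta)], as [d x >= 2 delta].
    Squaring costs [2 h] times the remainder, that is [h^3 / (2 delta)]. *)
Let pair_lower h x : 0 < h -> h <= delta -> u x != 0 ->
  h ^+ 2 * (cK n / 2) - h ^+ 3 / (2 * delta) * IK <=
  I (fun z => K z * pos (D x - D (h *: z + x)) ^+ 2).
Proof.
move=> h0 hd ux; have dx := udelta ux.
have dx0 : 0 < d x by lra.
have [e e1 He] := dist_upper oO OT dx0.
have cpos (f : V -> R) : continuous f -> continuous (fun z => pos (f z) ^+ 2).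
  move=> cf; apply: (@cont_comp R _ (fun z => pos (f z)) (fun r => r ^+ 2)); last exact: exprn_continuous.
  exact: cont_pos.
have c1 : cc (fun z => K z * pos (- dot e z) ^+ 2).
  apply: cc_K_mul; apply: cpos; apply: (@cont_comp R _ (dot e) -%R); first exact: dot_continuous.
  exact: opp_continuous.
have c2 : cc (fun z => K z * pos (D x - D (h *: z + x)) ^+ 2).
  apply: cc_K_mul; apply: cpos; apply: cont_sub; first exact: cont_cst.
  exact: cont_affine.
rewrite -(I_K_half_sq e1) -!I_scale //; [|exact: cc_K].
rewrite -I_sub; [|exact: cc_scale|exact: cc_scale cc_K].
apply: I_le => // [|z]; first by apply: cc_sub; [exact: cc_scale|exact: cc_scale cc_K].
have -> : h ^+ 2 * (K z * pos (- dot e z) ^+ 2) - h ^+ 3 / (2 * delta) * K z =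
  K z * (h ^+ 2 * pos (- dot e z) ^+ 2 - 2 * h * (h ^+ 2 / (4 * delta))).
  by field; rewrite gt_eqF.
have [->|Kz] := eqVneq (K z) 0; first by rewrite !mul0r.
have z1 := K_supp Kz.
rewrite ler_wpM2l ?K_ge0 //; apply: sq_lower => //; last 2 first.
- exact: ltW.
- apply: (@le_trans _ _ (pos (h * - dot e z - h ^+ 2 / (4 * delta)))); last first.
    apply: pos_mono; rewrite DE; last lra.
    rewrite DE; last by have := @dist_shift h z x h0 z1; rewrite ler_norml; lra.
    have := He (h *: z); rewrite [x + _]addrC dotZr sqnZ.
    have : h ^+ 2 * sqn z / (2 * d x) <= h ^+ 2 / (4 * delta).
      rewrite -mulrA ler_wpM2l ?sqr_ge0 //.
      rewrite ler_pdivrMr ?mulr_gt0 // mulrC ler_pdivlMr ?mulr_gt0 //.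
      have : sqn z <= 1 by rewrite -enorm_sq expr_le1 ?enorm_ge0.
      have := sqn_ge0 z; nra.
    lra.
  rewrite [pos (- _)]/pos; have [r0|/ltW r0] := leP 0 (- dot e z).
    exact: pos_ge.
  rewrite mulr0 sub0r; apply: le_trans (pos_ge0 _).
  by rewrite oppr_le0 divr_ge0 ?sqr_ge0 // ltW // mulr_gt0.
- rewrite pos_ge0 /= ge_max ler01 /=.
  by apply: le_trans (ler_norm _) _; rewrite normrN -e1; exact: dot_abs_le.
- by rewrite divr_ge0 ?sqr_ge0 // ltW // mulr_gt0.
Qed.

Let lower_bound h : 0 < h -> h <= delta ->
  (h ^+ 2 * (cK n / 2) - h ^+ 3 / (2 * delta) * IK) * X <= W h B.
Proof.
move=> h0 hd; rewrite -I_scale //.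
apply: I_le => [||x]; [exact: cc_scale|exact: cc_pair_outer|].
have -> : (fun z => K z * B x (h *: z + x)) =
  (fun z => (v x * D x `^ (- s)) * (K z * pos (D x - D (h *: z + x)) ^+ 2)).
  by apply/funext => z; rewrite /B; ring.
rewrite I_scale; last first.
  apply: cc_K_mul; apply: (@cont_comp R _ (fun z : V => pos (D x - D (h *: z + x))) (fun r => r ^+ 2)).
    apply: cont_pos; apply: cont_sub; first exact: cont_cst.
    exact: cont_affine.
  exact: exprn_continuous.
have [ux|ux] := eqVneq (u x) 0; first by rewrite /v ux normr0 !mul0r mulr0.
by rewrite mulrC ler_wpM2l ?mulr_ge0 ?powR_ge0 // pair_lower.
Qed.

(** What remains after division by [h^2]: the Taylor remainder [eps], and the curvature term
    [h / (2 delta)] multiplied by a bound for the increment of [u]. The bump makes it integrable. *)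
Let err (M eps h : R) (x : V) : R :=
  eps * bump M x + h / (2 * delta) * (gradnorm u x + eps * bump M x).

(** The increment of [u] is at most [h (|grad u . z| + eps)], the positive increment of [D] at most
    [h ((e.z)^+ + h / (2 delta))]; [I_K_half_abs] integrates the leading product. If [d x < delta]
    or [|x| > M + 1], then [u] vanishes at both points. *)
Let pair_upper M eps eta h x : (forall x, M < `|x| -> u x = 0) -> 0 < eps ->
  (forall x w, enorm w < eta -> `|u (w + x) - u x - dot (grad u x) w| <= eps * enorm w) ->
  0 < h -> h < eta -> h <= delta -> h <= 1 ->
  I (fun z => K z * A x (h *: z + x)) <=
  D x `^ (1 - s) * (h ^+ 2 * (cK n / 2 * gradnorm u x) + h ^+ 2 * (err (M + 1) eps h x * IK)).
Proof.
move=> HM e0 Taylor_u h0 heta hd h1.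
have b0 := bump_ge0 (M + 1) x.
have g0 : 0 <= gradnorm u x by exact: sqrtr_ge0.
have D0 : 0 <= D x `^ (1 - s) by exact: powR_ge0.
have hdelta : 0 <= h / (2 * delta) by rewrite divr_ge0 ?ltW // mulr_gt0.
have err0 : 0 <= err (M + 1) eps h x.
  rewrite /err; apply: addr_ge0; first by rewrite mulr_ge0 // ltW.
  by apply: mulr_ge0 => //; apply: addr_ge0 => //; rewrite mulr_ge0 // ltW.
have RHS0 : 0 <= D x `^ (1 - s) * (h ^+ 2 * (cK n / 2 * gradnorm u x) + h ^+ 2 * (err (M + 1) eps h x * IK)).
  rewrite mulr_ge0 // addr_ge0 // mulr_ge0 ?sqr_ge0 ?mulr_ge0 //.
  exact: (ltW (cK_gt0 i0)).
have triv : (forall z, K z != 0 -> A x (h *: z + x) = 0) ->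
  I (fun z => K z * A x (h *: z + x)) <=
  D x `^ (1 - s) * (h ^+ 2 * (cK n / 2 * gradnorm u x) + h ^+ 2 * (err (M + 1) eps h x * IK)).
  move=> H; suff -> : (fun z => K z * A x (h *: z + x)) = (fun=> 0) by rewrite I_0.
  by apply/funext => z; have [->|/H ->] := eqVneq (K z) 0; rewrite ?mul0r ?mulr0.
have [dx|dx] := ltP (d x) delta.
  apply: triv => z Kz; rewrite /A.
  have := @dist_shift h z x h0 (K_supp Kz); rewrite ler_norml => dz.
  have -> : u x = 0 by apply/eqP; apply: contrapT => /negP/udelta; lra.
  have -> : u (h *: z + x) = 0 by apply/eqP; apply: contrapT => /negP/udelta; lra.
  by rewrite subrr normr0 !mul0r.
have [xM|xM] := ltP (M + 1) `|x|.
  apply: triv => z Kz; rewrite /A.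
  have z1 : `|z| <= 1 by apply: le_trans (norm_le_enorm z) _; exact: K_supp.
  have xz : `|x| <= `|h *: z + x| + 1.
    have -> : `|x| = `|(h *: z + x) - h *: z| by rewrite addrAC subrr add0r.
    apply: le_trans (ler_normB _ _) _; rewrite lerD2l normrZ gtr0_norm //.
    by rewrite mulr_ile1 // ltW.
  rewrite !HM; [by rewrite subrr normr0 !mul0r|lra|lra].
have b1 : 1 <= bump (M + 1) x by exact: bump_ge1.
have dx0 : 0 < d x by lra.
have [e e1 He] := dist_upper oO OT dx0.
have c1 : cc (fun z => K z * (`|dot (grad u x) z| * pos (dot e z))).
  apply: cc_K_mul; apply: cont_mul; first by apply: cont_norm; exact: dot_continuous.
  by apply: cont_pos; exact: dot_continuous.
apply: (@le_trans _ _ (I (fun z => D x `^ (1 - s) *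
   (h ^+ 2 * (K z * (`|dot (grad u x) z| * pos (dot e z))) + h ^+ 2 * (err (M + 1) eps h x * K z))))).
  apply: I_le => [||z]; first exact: (cc_pair_inner h x c_A).
    by apply: cc_scale; apply: cc_add; apply: cc_scale => //; exact: cc_scale cc_K.
  have -> : D x `^ (1 - s) * (h ^+ 2 * (K z * (`|dot (grad u x) z| * pos (dot e z))) +
      h ^+ 2 * (err (M + 1) eps h x * K z)) =
    K z * (D x `^ (1 - s) * (h ^+ 2 * (`|dot (grad u x) z| * pos (dot e z) + err (M + 1) eps h x))).
    by ring.
  have [->|Kz] := eqVneq (K z) 0; first by rewrite !mul0r.
  have z1 := K_supp Kz.
  rewrite ler_wpM2l ?K_ge0 // /A mulrAC mulrC ler_wpM2l //.
  set G := dot (grad u x) z; set E := dot e z; set b := bump _ x in b0 b1 *.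
  have G1 : `|G| <= gradnorm u x by rewrite gradnormE; exact: dot_abs_le.
  have E1 : pos E <= 1.
    rewrite ge_max ler01 /= -e1; apply: le_trans (ler_norm _) _; exact: dot_abs_le.
  have E0 := pos_ge0 E; have G0 := normr_ge0 G.
  have H1 : `|u (h *: z + x) - u x| <= h * (`|G| + eps * b).
    have hz : enorm (h *: z) <= h.
      by rewrite enormZ gtr0_norm //; apply: ler_piMr => //; exact: ltW.
    have := Taylor_u x (h *: z) (le_lt_trans hz heta); rewrite dotZr -/G => T1.
    have T2 : `|u (h *: z + x) - u x| <= `|u (h *: z + x) - u x - h * G| + `|h * G|.
      by rewrite -{1}(subrK (h * G) (u (h *: z + x) - u x)) ler_normD.
    rewrite normrM (gtr0_norm h0) in T2.
    have T3 : eps * enorm (h *: z) <= eps * h by rewrite ler_pM2l.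
    have T4 : eps * h <= h * (eps * b).
      by rewrite mulrCA mulrA; apply: ler_peMr => //; rewrite mulr_ge0 // ltW.
    lra.
  have H2 : pos (D (h *: z + x) - D x) <= h * (pos E + h / (2 * delta)).
    have R0 : 0 <= h * (pos E + h / (2 * delta)) by rewrite mulr_ge0 ?addr_ge0 // ltW.
    rewrite {1}/pos ge_max R0 /= (DE dx) lerBlDr ge_max; apply/andP; split; last lra.
    have := He (h *: z); rewrite [x + _]addrC dotZr sqnZ -/E.
    have : h ^+ 2 * sqn z / (2 * d x) <= h * (h / (2 * delta)).
      have -> : h * (h / (2 * delta)) = h ^+ 2 / (2 * delta) by ring.
      rewrite -mulrA ler_wpM2l ?sqr_ge0 //.
      rewrite ler_pdivrMr ?mulr_gt0 // mulrC ler_pdivlMr ?mulr_gt0 //.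
      have : sqn z <= 1 by rewrite -enorm_sq expr_le1 ?enorm_ge0.
      have := sqn_ge0 z; nra.
    have : h * E <= h * pos E by rewrite ler_pM2l // pos_ge.
    lra.
  apply: (@le_trans _ _ ((h * (`|G| + eps * b)) * (h * (pos E + h / (2 * delta))))).
    exact: ler_pM.
  have -> : h * (`|G| + eps * b) * (h * (pos E + h / (2 * delta))) =
    h ^+ 2 * (`|G| * pos E + (eps * b * pos E + h / (2 * delta) * (`|G| + eps * b))) by ring.
  rewrite ler_wpM2l ?sqr_ge0 // lerD2l /err -/b; apply: lerD.
    by apply: ler_piMr => //; rewrite mulr_ge0 // ltW.
  by rewrite ler_wpM2l // lerD2r.
rewrite I_scale; last by apply: cc_add; apply: cc_scale => //; exact: cc_scale cc_K.
rewrite I_add; [|exact: cc_scale|by apply: cc_scale; exact: cc_scale cc_K].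
rewrite !I_scale //; [|exact: cc_K|exact: cc_scale cc_K].
by rewrite ler_wpM2l // lerD2r ler_wpM2l ?sqr_ge0 // gradnormE; exact: I_K_half_abs.
Qed.

(** The lower and the upper bound share the factor [h^2 * (cK n / 2)]. After division by [h^2] the
    errors sum to at most [eps * C], with [C] independent of [eps] and [h]. *)
Lemma Hardy_truncated :
  (s - 1) * I (fun x => `|u x| * D x `^ (- s)) <= I (fun x => D x `^ (1 - s) * gradnorm u x).
Proof.
rewrite -/X -/Y.
have [M HM] := usupp.
pose b := @bump R V (M + 1).
have cb : cc b := @cc_bump R V (M + 1).
have cB1 : cc (fun x => D x `^ (1 - s) * b x) by exact: cc_mulr.
pose B1 := I (fun x => D x `^ (1 - s) * b x).
have B10 : 0 <= B1 by apply: I_ge0 => // x; rewrite mulr_ge0 ?powR_ge0 ?bump_ge0.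
have Y0 : 0 <= Y by apply: I_ge0 => // x; rewrite mulr_ge0 ?powR_ge0 // sqrtr_ge0.
have X0 : 0 <= X by apply: I_ge0 => // x; rewrite mulr_ge0 ?powR_ge0.
have c0 : 0 < cK n :> R := cK_gt0 i0.
have s10 : 0 <= s - 1 by rewrite subr_ge0 ltW.
pose C := (s - 1) * IK * X / (2 * delta) + IK * (B1 + (Y + B1) / (2 * delta)).
have C0 : 0 <= C.
  have d2 : 0 <= 2 * delta by rewrite ltW // mulr_gt0.
  apply: addr_ge0; first by apply: divr_ge0 => //; do 2 apply: mulr_ge0 => //.
  apply: mulr_ge0 => //; apply: addr_ge0 => //.
  by apply: divr_ge0 => //; exact: addr_ge0.
suff H eps : 0 < eps -> eps <= 1 -> (s - 1) * X * (cK n / 2) <= cK n / 2 * Y + eps * C.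
  have cc2 : 0 < cK n / 2 :> R by rewrite divr_gt0.
  rewrite -(ler_pM2r cc2) [Y * _]mulrC; apply/ler_addgt0Pl => e e0.
  pose eps := Num.min 1 (e / (C + 1)).
  have eps0 : 0 < eps by rewrite lt_min ltr01 divr_gt0 // ltr_wpDl.
  apply: le_trans (H eps eps0 _) _; first by rewrite ge_min lexx.
  rewrite addrC lerD2r; apply: (@le_trans _ _ (eps * (C + 1))).
    by rewrite ler_wpM2l ?(ltW eps0) // lerDl.
  by rewrite -ler_pdivlMr ?ltr_wpDl // ge_min lexx orbT.
move=> eps0 eps1.
have [eta eta0 Heta] := Taylor Cu eps0.
(* [h <= eps] turns the errors of order [h] into errors of order [eps]; the other two bounds serve
   the truncation and the Taylor expansion. *)
pose h := Num.min eps (Num.min delta (eta / 2)).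
have h0 : 0 < h by rewrite !lt_min eps0 delta0 divr_gt0.
have heps : h <= eps by rewrite ge_min lexx.
have hd : h <= delta by rewrite !ge_min lexx orbT.
have heta : h < eta.
  by apply: (@le_lt_trans _ _ (eta / 2)); [rewrite !ge_min lexx !orbT|lra].
have up : W h A <= h ^+ 2 * (cK n / 2 * Y + IK * (eps * B1 + h / (2 * delta) * (Y + eps * B1))).
  have -> : h ^+ 2 * (cK n / 2 * Y + IK * (eps * B1 + h / (2 * delta) * (Y + eps * B1))) =
    (h ^+ 2 * (cK n / 2) + h ^+ 2 * IK * (h / (2 * delta))) * Y +
    (h ^+ 2 * IK * (eps + h / (2 * delta) * eps)) * B1 by ring.
  rewrite /Y /B1 -(I_scale _ cc_Y) -(I_scale _ cB1) -I_add; [|exact: cc_scale..].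
  apply: I_le => [||x]; [exact: (cc_pair_outer h c_A)|by apply: cc_add; exact: cc_scale|].
  apply: le_trans (pair_upper x HM eps0 Heta h0 heta hd (le_trans heps eps1)) _.
  by rewrite /err -/(b x) le_eqVlt; apply/orP; left; apply/eqP; ring.
have := le_trans (ler_wpM2l (ltW (ltac:(by rewrite subr_gt0) : 0 < s - 1)) (lower_bound h0 hd))
  (le_trans (weighted_pairs h0 hd) up).
have h2 : 0 < h ^+ 2 by rewrite exprn_gt0.
have -> : (s - 1) * ((h ^+ 2 * (cK n / 2) - h ^+ 3 / (2 * delta) * IK) * X) =
  h ^+ 2 * ((s - 1) * X * (cK n / 2) - h * ((s - 1) * IK * X / (2 * delta))) by ring.
rewrite ler_pM2l // => H.
have d2 : 0 < 2 * delta by rewrite mulr_gt0.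
have T1 : h * ((s - 1) * IK * X / (2 * delta)) <= eps * ((s - 1) * IK * X / (2 * delta)).
  by rewrite ler_wpM2r // !mulr_ge0 ?invr_ge0 // ltW.
have T2 : IK * (eps * B1 + h / (2 * delta) * (Y + eps * B1)) <= eps * (IK * (B1 + (Y + B1) / (2 * delta))).
  have -> : eps * (IK * (B1 + (Y + B1) / (2 * delta))) =
     IK * (eps * B1 + eps / (2 * delta) * (Y + B1)) by ring.
  rewrite ler_wpM2l // lerD2l; apply: ler_pM.
  - by rewrite divr_ge0 // ltW.
  - by rewrite addr_ge0 // mulr_ge0 // ltW.
  - by rewrite ler_wpM2r // invr_ge0 ltW.
  - by rewrite lerD2l ler_piMl.
rewrite /C mulrDr; lra.
Qed.

End HardyInequality.

(** * Sharpness *)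

Section HalfSpace.
Context {R : realType} {n : nat}.
Local Notation V := 'rV[R]_n.
Variables (e : V) (i0 : 'I_n).
Hypotheses (e1 : enorm e = 1) (ei0 : e ord0 i0 != 0).

(** The lateral variables are all coordinates but [i0], rather than the orthogonal complement of
    [e]. Since [e ord0 i0] is nonzero they are coordinates together with [dot e x], which avoids
    rotating an iterated integral. *)
Definition lateral (x : V) : R := \sum_(j < n | j != i0) x ord0 j ^+ 2.

Lemma lateral_ge0 x : 0 <= lateral x.
Proof. by apply: sumr_ge0 => j _; exact: sqr_ge0. Qed.

Lemma lateralE x : lateral x = \sum_(j < n) (j != i0)%:R * (x ord0 j * x ord0 j).
Proof.
rewrite /lateral big_mkcond; apply: eq_bigr => j _.
by case: ifP => _; rewrite ?mul1r ?mul0r ?expr2.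
Qed.

Lemma Sm_lateral : Sm lateral.
Proof.
apply: (Sm_ext (f := fun x => \sum_(j < n) (j != i0)%:R * (x ord0 j * x ord0 j))).
  by move=> x; rewrite lateralE.
apply: Sm_sum => j; apply: Sm_mul; first exact: Sm_cst.
by apply: Sm_mul; exact: Sm_coord.
Qed.

Lemma Sm_dot : Sm (dot e).
Proof. by apply: Sm_sum => i; apply: Sm_mul; [exact: Sm_cst|exact: Sm_coord]. Qed.

Lemma lateralZ a x : lateral (a *: x) = a ^+ 2 * lateral x.
Proof. by rewrite /lateral mulr_sumr; apply: eq_bigr => j _; rewrite mxE exprMn. Qed.

Lemma slab_bounded (N M : R) : 0 <= M -> exists L : R, forall x,
  `|dot e x| <= N -> lateral x <= M ^+ 2 -> enorm x <= L.
Proof.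
move=> M0.
exists (n%:R * (M + (N + n%:R * M) / `|e ord0 i0|)) => x xN xM.
have ae : 0 < `|e ord0 i0| by rewrite normr_gt0.
have xj j : j != i0 -> `|x ord0 j| <= M.
  move=> ji; rewrite -(ler_pXn2r (n := 2)) ?nnegrE // real_normK ?num_real //.
  apply: le_trans xM; rewrite /lateral (bigD1 j) //= lerDl.
  by apply: sumr_ge0 => k _; exact: sqr_ge0.
have N0 : 0 <= N by apply: le_trans xN.
have xi0 : `|x ord0 i0| <= (N + n%:R * M) / `|e ord0 i0|.
  rewrite ler_pdivlMr // mulrC -normrM.
  have -> : e ord0 i0 * x ord0 i0 = dot e x - \sum_(j < n | j != i0) e ord0 j * x ord0 j.
    by rewrite /dot (bigD1 i0) //= addrK.
  apply: le_trans (ler_normB _ _) _; apply: lerD => //.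
  apply: le_trans (ler_norm_sum _ _ _) _.
  apply: (@le_trans _ _ (\sum_(j < n | j != i0) M)).
    apply: ler_sum => j ji; rewrite normrM; apply: le_trans (xj j ji).
    by apply: ler_piMl => //; rewrite -e1; apply: le_trans (norm_le_enorm e); exact: rV_coord_le.
  rewrite sumr_const -[leLHS]mulr_natl; apply: ler_wpM2r => //.
  rewrite ler_nat; apply: leq_trans (max_card _) _; by rewrite card_ord.
have A0 : 0 <= (N + n%:R * M) / `|e ord0 i0| by rewrite divr_ge0 // addr_ge0 // mulr_ge0.
apply: le_trans (enorm_le_norm x) _; rewrite ler_wpM2l // rV_norm_le; last by rewrite addr_ge0.
apply/forallP => j; have [->|/xj H] := eqVneq j i0; first by apply: le_trans xi0 _; rewrite lerDr.
by apply: le_trans H _; rewrite lerDl.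
Qed.

Lemma cc_slab (f : R -> R) (chi : V -> R) (M : R) : 0 <= M -> cc f -> continuous chi ->
  (forall x, M ^+ 2 <= lateral x -> chi x = 0) -> cc (fun x => f (dot e x) * chi x).
Proof.
move=> M0 cf cchi chi0; split.
  by apply: cont_mul => //; apply: (@cont_comp R _ (dot e) f); [exact: dot_continuous|exact: cf.1].
have [N fN] := cf.2; have [L HL] := slab_bounded N M0.
exists L => x xL.
have [xM|xM] := leP (M ^+ 2) (lateral x); first by rewrite chi0 // mulr0.
have [xN|xN] := leP `|dot e x| N; last by rewrite fN // mul0r.
have := le_lt_trans (norm_le_enorm x) (le_lt_trans (HL x xN (ltW xM)) xL).
by rewrite ltxx.
Qed.

(* A function of [dot e x] times a lateral cut-off integrates like a function
   of one variable: when it has mean zero it is a derivative in the direction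
   [i0], along which the cut-off is constant. *)
Section Slab.
Variables (chi : V -> R) (M : R).
Hypotheses (M0 : 0 <= M) (cchi : continuous chi)
  (chi0 : forall x, M ^+ 2 <= lateral x -> chi x = 0)
  (dchi : forall x, is_derive x (ebasis R i0) chi 0).

Lemma slab_mean_zero (p : R -> R) : cc p -> J p = 0 -> I (fun x => p (dot e x) * chi x) = 0.
Proof.
move=> cp Jp.
have [N N0 pN] := cc_bound_gt0 cp.
have [P [dP P0]] := cc_primitive (- N - 1) cp.
have PN : P (N + 1) = 0.
  have := J_FTC2 cp pN (ltW N0) dP (a := - N - 1) (b := N + 1).
  by rewrite P0 subr0 Jp => <- //; lra.
have cP : cc P.
  split; first exact: is_derive_continuous dP.
  exists (N + 1) => r; rewrite ltr_normr => /orP[] rN.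
    rewrite -PN; apply/esym; apply: (derivative_constant dP) (ltW rN) => y yr.
    by apply: pN; rewrite ger0_norm; lra.
  rewrite -P0; apply: (derivative_constant dP); last lra.
  by move=> y yr; apply: pN; rewrite ler0_norm; lra.
have c1 := cc_slab M0 cP cchi chi0.
have c2 := cc_slab M0 cp cchi chi0.
have := I_derive (v := ebasis R i0) c1 (cc_scale (e ord0 i0) c2).
rewrite I_scale // => H; have := H _; move/(_ _)/eqP.
rewrite mulf_eq0 (negbTE ei0) /= => H'; apply/eqP/H' => x.
have d1 : is_derive x (ebasis R i0) (fun x => P (dot e x)) (p (dot e x) * e ord0 i0).
  apply: (@is_derive_comp R _ P (dot e)); first exact: dP.
  rewrite -[e ord0 i0]dot_ebasis; apply: is_deriveP_eps => eps eps0; exists 1 => // k _.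
  have -> : dot e (x + k *: ebasis R i0) - dot e x - k * dot e (ebasis R i0) = 0.
    by rewrite dotDr dotZr; ring.
  by rewrite normr0 mulr_ge0 // ltW.
have := @is_deriveM R _ _ _ x (ebasis R i0) _ _ d1 (dchi x).
congr is_derive; rewrite /GRing.scale /=; ring.
Qed.

(** [p - J p * beta] has mean zero, because [beta] has integral 1. *)
Lemma slab_integral (p : R -> R) : cc p ->
  I (fun x => p (dot e x) * chi x) = J p * I (fun x => beta (dot e x) * chi x).
Proof.
move=> cp.
have cb : cc (fun r => J p * beta r) by exact: cc_scale cc_beta.
have cq : cc (fun r => p r - J p * beta r) by exact: cc_sub.
have := slab_mean_zero cq; rewrite J_sub // J_scale ?J_beta ?mulr1 ?subrr; last exact: cc_beta.
move=> /(_ erefl).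
have -> : (fun x => (p (dot e x) - J p * beta (dot e x)) * chi x) =
  (fun x => p (dot e x) * chi x - J p * (beta (dot e x) * chi x)).
  by apply/funext => x; ring.
have c1 := cc_slab M0 cp cchi chi0.
have c2 := cc_slab M0 cc_beta cchi chi0.
rewrite I_sub // ?I_scale //; last exact: cc_scale.
by move/eqP; rewrite subr_eq0 => /eqP.
Qed.

End Slab.

Definition chi (M : R) (x : V) : R := 1 - theta (lateral x / M ^+ 2).

Lemma Sm_chi M : Sm (chi M).
Proof.
apply: Sm_sub; first exact: Sm_cst.
by apply: Sm_theta; apply: Sm_mul; [exact: Sm_lateral|exact: Sm_cst].
Qed.

Lemma chi_ge0 M x : 0 <= chi M x.
Proof. by rewrite subr_ge0 theta_le1. Qed.

Lemma chi_outside M x : 0 < M -> M ^+ 2 <= lateral x -> chi M x = 0.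
Proof.
by move=> M0 H; rewrite /chi theta_right ?subrr // ler_pdivlMr ?exprn_gt0 // mul1r.
Qed.

Lemma chi_inside M x : 0 < M -> lateral x <= M ^+ 2 / 4 -> chi M x = 1.
Proof.
move=> M0 H; rewrite /chi theta_left ?subr0 // ler_pdivrMr ?exprn_gt0 //; lra.
Qed.

(** Half the gradient of [lateral]. *)
Definition trunc (x : V) : V := \row_j if j == i0 then 0 else x ord0 j.

Lemma dot_trunc x v : dot (trunc x) v = \sum_(j < n | j != i0) x ord0 j * v ord0 j.
Proof.
rewrite [RHS]big_mkcond; apply: eq_bigr => j _.
by rewrite mxE; case: eqP => _; rewrite ?mul0r.
Qed.

Lemma sqn_trunc x : sqn (trunc x) = lateral x.
Proof.
rewrite /lateral [RHS]big_mkcond; apply: eq_bigr => j _.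
by rewrite mxE; case: eqP => _ //; rewrite expr0n.
Qed.

Lemma is_derive_lateral x v : is_derive x v lateral (2 * dot (trunc x) v).
Proof.
apply: is_deriveP_eps => eps eps0.
have s0 : 0 < lateral v + 1 by rewrite ltr_wpDl // lateral_ge0.
exists (eps / (lateral v + 1)); first exact: divr_gt0.
move=> k kd.
have -> : lateral (x + k *: v) - lateral x - k * (2 * dot (trunc x) v) = `|k| * (`|k| * lateral v).
  rewrite [RHS]mulrA -[`|k| * `|k|]expr2 real_normK ?num_real //.
  rewrite dot_trunc /lateral !mulr_sumr -!sumrB; apply: eq_bigr => j _.
  by rewrite !mxE; ring.
have sv := lateral_ge0 v.
rewrite ger0_norm ?mulr_ge0 // mulrC ler_wpM2r //.
apply: (@le_trans _ _ (`|k| * (lateral v + 1))); first by rewrite ler_wpM2l // lerDl.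
by rewrite -ler_pdivlMr // ltW.
Qed.

Lemma is_derive_chi M x v :
  is_derive x v (chi M) (- (beta (lateral x / M ^+ 2) / M ^+ 2 * (2 * dot (trunc x) v))).
Proof.
have d1 := is_derive_lateral x v.
have d2 : is_derive (lateral x) 1 (fun r : R => theta (r / M ^+ 2)) (beta (lateral x / M ^+ 2) / M ^+ 2).
  have := @primitive_comp R theta beta (M ^+ 2)^-1 0 theta_primitive (lateral x).
  have -> : (fun r => theta ((M ^+ 2)^-1 * r + 0)) = (fun r => theta (r / M ^+ 2)).
    by apply/funext => r; rewrite addr0 mulrC.
  by congr is_derive; rewrite addr0 mulrC [(M ^+ 2)^-1 * _]mulrC.
have d3 := @is_derive_comp R _ (fun r : R => theta (r / M ^+ 2)) lateral x v _ _ d2 d1.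
have := @is_deriveB R V R (cst (1 : R)) _ x v 0 _ (is_derive_cst _ _ _) d3.
by rewrite sub0r; apply.
Qed.

Lemma is_derive_chi0 M x : is_derive x (ebasis R i0) (chi M) 0.
Proof.
by have := is_derive_chi M x (ebasis R i0); rewrite dot_ebasis mxE eqxx !mulr0 oppr0.
Qed.

(** The factor that the cut-off contributes to every slab integral, by [slab_chi]. *)
Definition kappa M := I (fun x => beta (dot e x) * chi M x).

Lemma cc_beta_chi M : 0 < M -> cc (fun x => beta (dot e x) * chi M x).
Proof.
move=> M0; apply: (cc_slab (ltW M0) cc_beta); first exact: Sm_continuous (Sm_chi M).
by move=> x; exact: chi_outside.
Qed.

Lemma slab_chi M (p : R -> R) : 0 < M -> cc p ->
  I (fun x => p (dot e x) * chi M x) = J p * kappa M.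
Proof.
move=> M0 cp; apply: (slab_integral (ltW M0)) => //.
- exact: Sm_continuous (Sm_chi M).
- by move=> x; exact: chi_outside.
- by move=> x; exact: is_derive_chi0.
Qed.

Lemma kappa_gt0 M : 0 < M -> 0 < kappa M.
Proof.
(* A point of the axis [i0]: [lateral] vanishes and [dot e x = 1/2]. *)
move=> M0; pose x := (2 * e ord0 i0)^-1 *: ebasis R i0.
apply: (@I_gt0 _ _ _ x); first exact: cc_beta_chi.
  by move=> y; rewrite mulr_ge0 ?beta_ge0 ?chi_ge0.
have -> : dot e x = 2^-1.
  by rewrite dotZr dot_ebasis invfM mulfVK.
rewrite chi_inside //; last first.
  rewrite /x lateralZ /lateral big1 ?mulr0 ?divr_ge0 ?exprn_ge0 ?(ltW M0) //.
  by move=> j ji; rewrite ebasisE eq_sym (negbTE ji) expr0n.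
by rewrite mulr1 beta_gt0 //; lra.
Qed.

(** Dilation by 2, with [beta (2 r)] of integral 1/2. The gradient of [chi M] will be dominated by
    [chi (2 M)], so the ratio of the two masses must not depend on [M]. *)
Lemma kappa_double M : 0 < M -> kappa (2 * M) = 2 ^+ n / 2 * kappa M.
Proof.
move=> M0; have M20 : 0 < 2 * M by rewrite mulr_gt0.
have cb2 : cc (fun r : R => beta (2 * r + 0)).
  apply: (cc_comp (f := beta) (A := 1) (B := 0)) => //; first exact: cc_beta.
    apply: cont_add; last exact: cont_cst.
    by apply: cont_mul => r; [exact: cvg_cst|exact: cvg_id].
  by move=> r; rewrite !addr0 mul1r normrM ger0_norm // ler_peMl //; lra.
have two0 : (2 : R) != 0 by rewrite gt_eqF.
have := I_affine 0 (cc_beta_chi M20) (_ : 2 != 0 :> R).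
have -> : (fun x => beta (dot e (2 *: x + 0)) * chi (2 * M) (2 *: x + 0)) =
          (fun x => beta (2 * dot e x + 0) * chi M x).
  apply/funext => x; rewrite !addr0 dotZr /chi lateralZ exprMn; congr (_ * (1 - theta _)).
  by field; rewrite gt_eqF.
rewrite (slab_chi M0 cb2) (J_affine _ cc_beta) // J_beta mulr1 ger0_norm // => /(_ two0).
rewrite -/(kappa _) => H.
have -> : kappa (2 * M) = 2 ^+ n * (2 ^- n * kappa (2 * M)).
  by rewrite mulrA divff ?mul1r // expf_neq0.
by rewrite -H; ring.
Qed.

Variables (s C : R).
Hypotheses (s1 : 1 < s) (sC : s - 1 < C).

(** The truncation at 1/8 is inactive on the support of the profile, which starts at 1/4. *)
Let w1 (r : R) : R := (Num.max r 8^-1) `^ (1 - s).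
Let w0 (r : R) : R := (Num.max r 8^-1) `^ (- s).

Let eighth : 0 < 8^-1 :> R. Proof. by rewrite invr_gt0. Qed.

Let w1_continuous : continuous w1. Proof. exact: cont_pow_max. Qed.

Let w0_continuous : continuous w0. Proof. exact: cont_pow_max. Qed.

Let w1_gt0 r : 0 < w1 r. Proof. by rewrite powR_gt0 // lt_max eighth orbT. Qed.

Let w0_gt0 r : 0 < w0 r. Proof. by rewrite powR_gt0 // lt_max eighth orbT. Qed.

Section Profile.
Variable T : R.
Hypothesis T4 : 4 <= T.

Let T0 : 0 < T. Proof. exact: lt_le_trans T4. Qed.

Definition profile (r : R) : R := theta r * (1 - theta (r / T)).

Definition dprofile (r : R) : R := beta r - beta (r / T) / T.

Lemma profile_ge0 r : 0 <= profile r.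
Proof. by rewrite mulr_ge0 ?theta_ge0 // subr_ge0 theta_le1. Qed.

Lemma profile_left r : r <= 4^-1 -> profile r = 0.
Proof. by move=> r4; rewrite /profile theta_left // mul0r. Qed.

Lemma profile_right r : T <= r -> profile r = 0.
Proof.
move=> Tr; have rT : 1 <= r / T by rewrite ler_pdivlMr // mul1r.
by rewrite /profile (@theta_right R (r / T)) // subrr mulr0.
Qed.

(** As [T >= 4], the rise ends before the fall begins: in the product rule each factor equals 1
    where the other one varies. *)
Lemma profile_primitive : primitive profile dprofile.
Proof.
move=> r.
have d2 : is_derive r 1 (fun r : R => theta (r / T)) (beta (r / T) / T).
  have := @primitive_comp R theta beta T^-1 0 theta_primitive r.
  have -> : (fun r => theta (T^-1 * r + 0)) = (fun r => theta (r / T)).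
    by apply/funext => x; rewrite addr0 mulrC.
  by congr is_derive; rewrite addr0 mulrC [T^-1 * _]mulrC.
have d3 := @is_deriveB R R R (cst (1 : R)) _ r 1 0 _ (is_derive_cst _ _ _) d2.
have := @is_deriveM R R _ _ r 1 _ _ (theta_primitive r) d3.
congr is_derive; rewrite /GRing.scale /= /dprofile sub0r -[(cst 1 - _) r]/(1 - theta (r / T)).
have [r1|r1] := leP r 1.
  have rT : r / T <= 4^-1 by rewrite ler_pdivrMr //; have := T4; lra.
  by rewrite (theta_left rT) (beta_left rT); ring.
by rewrite (theta_right (ltW r1)) (beta_right (ltW r1)); ring.
Qed.

Lemma cc_profile : cc profile.
Proof.
split; first exact: is_derive_continuous profile_primitive.
exists T => r; rewrite ltr_normr => /orP[] Tr; first by rewrite profile_right // ltW.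
by rewrite profile_left //; have := T4; lra.
Qed.

Let cc_betaT : cc (fun r : R => beta (r / T) / T).
Proof.
split.
  apply: cont_mul; last exact: cont_cst.
  apply: (@cont_comp R R (fun r => r / T) beta); last exact: cc_beta.1.
  by apply: cont_mul => r; [exact: cvg_id|exact: cvg_cst].
exists T => r; rewrite ltr_normr => /orP[] Tr.
  by rewrite beta_right ?mul0r // ler_pdivlMr // mul1r ltW.
by rewrite beta_left ?mul0r // ler_pdivrMr //; have := T4; lra.
Qed.

Let J_betaT : J (fun r => beta (r / T) / T) = 1.
Proof.
have -> : (fun r => beta (r / T) / T) = (fun r => T^-1 * beta (T^-1 * r + 0)).
  by apply/funext => r; rewrite addr0 mulrC [r / T]mulrC.
have Ti0 : T^-1 != 0 by rewrite invr_eq0 gt_eqF.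
rewrite J_scale; last first.
  have -> : (fun r => beta (T^-1 * r + 0)) = (fun r => T * (beta (r / T) / T)).
    by apply/funext => r; rewrite addr0 [T^-1 * r]mulrC; field; rewrite gt_eqF.
  exact: cc_scale.
by rewrite (J_affine _ cc_beta) // J_beta mulr1 normfV invrK gtr0_norm // mulVf // gt_eqF.
Qed.

Lemma cc_dprofile : cc dprofile.
Proof. by apply: cc_sub cc_betaT; exact: cc_beta. Qed.

Let a := J (fun r => beta r * w1 r).
Let b := J (fun r => beta (r / T) / T * w1 r).

Let a_ge1 : 1 <= a.
Proof.
rewrite -J_beta; apply: J_le => [||r]; [exact: cc_beta|exact: cc_mull cc_beta _|].
have [r4|r4] := leP r (4^-1); first by rewrite beta_left // mul0r.
have [r1|r1] := leP 1 r; first by rewrite beta_right // mul0r.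
rewrite ler_peMr ?beta_ge0 // /w1 (_ : Num.max r 8^-1 = r); last by apply/max_idPl; lra.
have r0 : 0 < r by lra.
have := @powR_tangent R (s - 1) r 1 (ltac:(by rewrite subr_gt0)) r0 ltr01.
rewrite !powR1 opprB; apply: le_trans.
by rewrite lerDl oppr_ge0 mulr1 mulr_ge0_le0 //; [rewrite subr_ge0 ltW|lra].
Qed.

Let b_le : b <= (T / 4) `^ (1 - s).
Proof.
have -> : (T / 4) `^ (1 - s) = J (fun r => (T / 4) `^ (1 - s) * (beta (r / T) / T)).
  by rewrite J_scale ?J_betaT ?mulr1.
apply: J_le => [||r]; [exact: cc_mull cc_betaT _|exact: cc_scale cc_betaT|].
have [r4|r4] := leP (r / T) (4^-1); first by rewrite beta_left // !mul0r mulr0.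
rewrite mulrC; apply: ler_wpM2r.
  by rewrite divr_ge0 ?beta_ge0 // ltW.
have rT : T / 4 < r by move: r4; rewrite ltr_pdivlMr //; lra.
rewrite /w1 (_ : Num.max r 8^-1 = r); last by apply/max_idPl; have := T4; lra.
have T40 : 0 < T / 4 by rewrite divr_gt0.
rewrite -[1 - s]opprB !powRN lef_pV2 ?posrE ?powR_gt0 //; last lra.
have s10 := s1; have rp : 0 < r by lra.
by apply: ge0_ler_powR; rewrite ?nnegrE ?subr_ge0; lra.
Qed.

Let J_profile : (s - 1) * J (fun r => profile r * w0 r) = a - b.
Proof.
have c1 : cc (fun r => dprofile r * w1 r) by apply: cc_mull w1_continuous; exact: cc_dprofile.
have c0 : cc (fun r => profile r * w0 r) by apply: cc_mull => //; exact: cc_profile.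
have -> : a - b = J (fun r => dprofile r * w1 r).
  rewrite -J_sub; [|exact: cc_mull cc_beta _|exact: cc_mull cc_betaT _].
  by congr J; apply/funext => r; rewrite /dprofile; ring.
apply/eqP; rewrite eq_sym -subr_eq0; apply/eqP.
rewrite -J_scale // -J_sub //; last exact: cc_scale.
have dP : primitive (fun r => profile r * w1 r)
    (fun r => dprofile r * w1 r - (s - 1) * (profile r * w0 r)).
  move=> r; have [r4|r4] := ltP r (4^-1).
    rewrite /dprofile profile_left ?(ltW r4) // beta_left ?(ltW r4) // beta_left; last first.
      by rewrite ler_pdivrMr //; have := T4; lra.
    rewrite !mul0r subrr mul0r mulr0 subrr.
    apply: (@near_eq_is_derive R R R (cst 0) _ r 1 0 _ (is_derive_cst _ _ _)).
    by near=> x; rewrite profile_left ?mul0r //; apply: ltW; near: x; exact: lt_nbhsl.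
  have r0 : 0 < r by lra.
  have wE (p x : R) : 8^-1 < x -> (Num.max x 8^-1) `^ p = x `^ p.
    by move=> x8; congr powR; apply/max_idPl; exact: ltW.
  have dw : is_derive r 1 w1 ((1 - s) * w0 r).
    have := @is_derive1_powR R (1 - s) r r0.
    have -> : 1 - s - 1 = - s by ring.
    rewrite -(wE (- s)); last lra.
    apply: near_eq_is_derive; near=> x; rewrite /w1 wE //.
    by near: x; apply: lt_nbhsr; lra.
  have := @is_deriveM R R _ _ r 1 _ _ (profile_primitive r) dw.
  congr is_derive; rewrite /GRing.scale /=; ring.
have T10 : 0 < T + 1 by have := T0; lra.
rewrite (@J_FTC _ _ _ (T + 1) _ _ T10 dP).
- rewrite (profile_right (r := T + 1)) ?lerDl // (profile_left (r := - (T + 1))).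
    by rewrite !mul0r subrr.
  by have := T0; lra.
- by apply: cc_sub => //; exact: cc_scale.
- move=> r; rewrite ltr_normr /dprofile => /orP[] Tr.
    rewrite profile_right; last lra.
    have rT : 1 <= r / T by rewrite ler_pdivlMr // mul1r; lra.
    rewrite (beta_right rT) beta_right; last by have := T4; lra.
    by rewrite mul0r subrr mul0r mul0r mulr0 subrr.
  have Tp := T4.
  have rT : r / T <= 4^-1 by rewrite ler_pdivrMr //; lra.
  rewrite profile_left; last lra.
  by rewrite (beta_left rT) beta_left ?mul0r ?subrr ?mul0r ?mulr0 ?subrr //; lra.
Unshelve. all: by end_near. Qed.

(** The left side is at most [a + b], and [(s - 1)] times the integral on the right is [a - b]. The
    claim reduces to [(s - 1 + C) b < (C - (s - 1)) a], where [a >= 1] and [b <= (T / 4)^(1-s)]. *)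
Lemma profile_almost_sharp : (s - 1 + C) * (T / 4) `^ (1 - s) < C - (s - 1) ->
  J (fun r => `|dprofile r| * w1 r) < C * J (fun r => profile r * w0 r).
Proof.
move=> HT.
have s10 : 0 < s - 1 by rewrite subr_gt0.
have up : J (fun r => `|dprofile r| * w1 r) <= a + b.
  rewrite -J_add; [|exact: cc_mull cc_beta _|exact: cc_mull cc_betaT _].
  apply: J_le => [||r].
  - apply: cc_mull => //; split; first by apply: cont_norm; exact: cc_dprofile.1.
    by have [N HN] := cc_dprofile.2; exists N => x /HN ->; rewrite normr0.
  - by apply: cc_add; [exact: cc_mull cc_beta _|exact: cc_mull cc_betaT _].
  rewrite -mulrDl; apply: ler_wpM2r; first exact: ltW (w1_gt0 _).
  rewrite /dprofile; apply: le_trans (ler_normB _ _) _.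
  by rewrite (ger0_norm (beta_ge0 r)) ger0_norm // divr_ge0 ?beta_ge0 ?ltW.
apply: le_lt_trans up _.
rewrite -(ltr_pM2l s10) mulrCA J_profile.
have : (s - 1 + C) * b <= (s - 1 + C) * (T / 4) `^ (1 - s).
  by apply: ler_wpM2l b_le; have := sC; lra.
have : C - (s - 1) <= (C - (s - 1)) * a by rewrite ler_peMr // subr_ge0 ltW.
lra.
Qed.

End Profile.

Let beta_bounded : exists2 B : R, 0 <= B & forall r, beta r <= B :> R.
Proof.
have cb : {within `[0, 1], continuous (beta : R -> R)}.
  by apply: continuous_subspaceT; exact: (cc_beta).1.
have [c _ Hc] := EVT_max (ler01 : (0 : R) <= 1) cb.
exists (beta c); first exact: beta_ge0.
move=> r; have [r0|r0] := leP 0 r; last by rewrite beta_left ?beta_ge0 //; lra.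
have [r1|r1] := leP r 1; last by rewrite beta_right ?beta_ge0 // ltW.
by apply: Hc; rewrite in_itv /= r0.
Qed.

Let large_profile : exists2 T : R, 4 <= T & (s - 1 + C) * (T / 4) `^ (1 - s) < C - (s - 1).
Proof.
have p0 : 0 < s - 1 by rewrite subr_gt0.
have q0 : 0 < C - (s - 1) by rewrite subr_gt0.
have a0 : 0 < s - 1 + C by have := sC; lra.
(* [T] is chosen so that [(T / 4)^(1-s) = 1 / Y]. *)
pose Y := (s - 1 + C) / (C - (s - 1)) + 1.
have Y1 : 1 < Y by rewrite ltrDr divr_gt0.
have Y0 : 0 < Y by lra.
exists (4 * Y `^ (s - 1)^-1).
  rewrite ler_peMr //; apply: (@le_trans _ _ (1 `^ (s - 1)^-1)); first by rewrite powR1.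
  by apply: ge0_ler_powR; rewrite ?nnegrE ?invr_ge0; lra.
rewrite mulrAC divff // mul1r -powRrM.
have -> : (s - 1)^-1 * (1 - s) = - 1 by field; rewrite gt_eqF.
rewrite powR_inv1 ?(ltW Y0) // ltr_pdivrMr //.
rewrite /Y mulrDr mulrCA divff ?mulr1 ?gt_eqF //; lra.
Qed.

Let plateau (T M : R) (x : V) : R := profile T (dot e x) * chi M x.

Let Sm_plateau T M : Sm (plateau T M).
Proof.
apply: Sm_mul (Sm_chi M); apply: Sm_mul; first exact: Sm_theta Sm_dot.
apply: Sm_sub; first exact: Sm_cst.
by apply: Sm_theta; apply: Sm_mul; [exact: Sm_dot|exact: Sm_cst].
Qed.

Let is_derive_dot x v : is_derive x v (dot e) (dot e v).
Proof.
apply: is_deriveP_eps => eps eps0; exists 1 => // k _.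
have -> : dot e (x + k *: v) - dot e x - k * dot e v = 0 by rewrite dotDr dotZr; ring.
by rewrite normr0 mulr_ge0 // ltW.
Qed.

Let grad_plateau (T M : R) x : 4 <= T -> grad (plateau T M) x =
  (dprofile T (dot e x) * chi M x) *: e -
  (profile T (dot e x) * (2 * beta (lateral x / M ^+ 2) / M ^+ 2)) *: trunc x.
Proof.
move=> T4; apply/rowP => i; rewrite !mxE /dpartial.
have d1 : is_derive x (ebasis R i) (fun x => profile T (dot e x)) (dprofile T (dot e x) * e ord0 i).
  by rewrite -dot_ebasis; apply: is_derive_comp (is_derive_dot _ _); exact: profile_primitive.
have d2 := is_derive_chi M x (ebasis R i).
have [_ ->] := @is_deriveM R _ _ _ x (ebasis R i) _ _ d1 d2.
rewrite dot_ebasis [trunc x ord0 i]mxE (_ : e 0 i = e ord0 i) // /GRing.scale /=.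
by case: (i == i0); ring.
Qed.

(** The cut-off varies only where [lateral x < M^2]: there [|trunc x| <= M] bounds its gradient by
    [2 B / M], and [chi (2 M)] equals 1. *)
Let gradnorm_plateau (T M B : R) x : 4 <= T -> 0 < M -> 0 <= B -> (forall r, beta r <= B) ->
  gradnorm (plateau T M) x <= `|dprofile T (dot e x)| * chi M x +
    2 * B / M * (profile T (dot e x) * chi (2 * M) x).
Proof.
move=> T4 M0 B0 HB; rewrite gradnormE grad_plateau //.
have M20 : 0 < M ^+ 2 by rewrite exprn_gt0.
have p0 := profile_ge0 T (dot e x).
apply: le_trans (enormD _ _) _; rewrite enormN !enormZ e1 mulr1; apply: lerD.
  by rewrite normrM (ger0_norm (chi_ge0 M x)).
have b0 := beta_ge0 (lateral x / M ^+ 2).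
rewrite ger0_norm; last by rewrite mulr_ge0 // divr_ge0 ?(ltW M20) // mulr_ge0.
have RHS0 : 0 <= 2 * B / M * (profile T (dot e x) * chi (2 * M) x).
  apply: mulr_ge0; last by rewrite mulr_ge0 ?chi_ge0.
  by rewrite divr_ge0 ?(ltW M0) // mulr_ge0.
have [xM|xM] := leP (M ^+ 2) (lateral x).
  by rewrite beta_right ?ler_pdivlMr ?mul1r // mulr0 mul0r mulr0 mul0r.
rewrite chi_inside ?mulr_gt0 //; last by rewrite exprMn; lra.
have tM : enorm (trunc x) <= M.
  rewrite -(ler_pXn2r (n := 2)) ?nnegrE ?enorm_ge0 ?(ltW M0) //.
  by rewrite enorm_sq sqn_trunc ltW.
rewrite mulr1 [leRHS]mulrC -[leLHS]mulrA; apply: ler_wpM2l => //.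
have -> : 2 * B / M = 2 * B / M ^+ 2 * M by field; rewrite gt_eqF.
apply: ler_pM => //; first by rewrite divr_ge0 ?(ltW M20) // mulr_ge0.
  exact: enorm_ge0.
by rewrite ler_wpM2r ?invr_ge0 ?(ltW M20) // ler_wpM2l.
Qed.

(** The support is at height at least 1/4, so that a slightly perturbed distance still exceeds the
    truncation level 1/8. *)
Lemma half_space_almost_sharp : exists u0 : V -> R,
  [/\ Sm u0, forall x, 0 <= u0 x,
      exists L : R, forall x, u0 x != 0 -> 4^-1 <= dot e x /\ enorm x <= L &
      I (fun x => gradnorm u0 x * (Num.max (dot e x) 8^-1) `^ (1 - s)) <
      C * I (fun x => u0 x * (Num.max (dot e x) 8^-1) `^ (- s))].
Proof.
have [T T4 HT] := large_profile; have [B B0 HB] := beta_bounded.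
have sharp := profile_almost_sharp T4 HT.
set A := J _ in sharp; set D := J _ in sharp.
pose E := J (fun r => profile T r * w1 r).
have c1 : cc (fun r => `|dprofile T r| * w1 r).
  apply: cc_mull w1_continuous; have [cd [N HN]] := cc_dprofile T4.
  by split; [exact: cont_norm|exists N => x /HN ->; rewrite normr0].
have cE : cc (fun r => profile T r * w1 r) by apply: cc_mull w1_continuous; exact: cc_profile.
have cD : cc (fun r => profile T r * w0 r) by apply: cc_mull w0_continuous; exact: cc_profile.
have E0 : 0 <= E by apply: J_ge0 => // r; rewrite mulr_ge0 ?profile_ge0 // ltW.
have gap : 0 < C * D - A by rewrite subr_gt0.
(* By [kappa_double] the lateral gradient costs [B E 2^n / M] times [kappa M], which must stay below
   the gap [C D - A] of the profile. *)
pose M := B * E * 2 ^+ n / (C * D - A) + 1.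
have M0 : 0 < M.
  have P : 0 <= B * E * 2 ^+ n by apply: mulr_ge0; [exact: mulr_ge0|exact: exprn_ge0].
  by have := divr_ge0 P (ltW gap); rewrite /M; lra.
have M20 : 0 < 2 * M by rewrite mulr_gt0.
have HM : B * E * 2 ^+ n < (C * D - A) * M.
  by rewrite /M mulrDr mulr1 [(C * D - A) * _]mulrC divfK ?gt_eqF // ltrDl.
have [L HL] := slab_bounded T (ltW M0).
have supp x : plateau T M x != 0 -> 4^-1 <= dot e x /\ enorm x <= L.
  move=> ux.
  have t4 : 4^-1 <= dot e x.
    rewrite leNgt; apply: contraNN ux => /ltW H.
    by rewrite /plateau profile_left // mul0r.
  split=> //; apply: HL; last first.
    rewrite leNgt; apply: contraNN ux => /ltW H.
    by rewrite /plateau chi_outside // mulr0.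
  rewrite ger0_norm; last lra.
  rewrite leNgt; apply: contraNN ux => /ltW H.
  by rewrite /plateau profile_right // mul0r.
exists (plateau T M); split=> //.
- by move=> x; rewrite mulr_ge0 ?profile_ge0 ?chi_ge0.
- by exists L.
have Cu : Cc_infty setT (plateau T M).
  split; first exact: Sm_smooth (Sm_plateau T M).
  have [|cs _] := fsupport_sub (f := plateau T M) (@closed_ball_compact R n 0 L); last by split.
  move=> y yL; apply/eqP; apply: contrapT => /negP/supp[_].
  by move=> H; apply: yL; rewrite /= subr0.
have w1e : continuous (fun x : V => w1 (dot e x)).
  by apply: (@cont_comp R _ (dot e) w1) => //; exact: dot_continuous.
have chiC N : continuous (chi N) := Sm_continuous (Sm_chi N).
have chiN N : 0 < N -> forall x, N ^+ 2 <= lateral x -> chi N x = 0.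
  by move=> N0 x; exact: chi_outside.
have c1' := cc_slab (ltW M0) c1 (chiC M) (chiN M M0).
have cE' := cc_slab (ltW M20) cE (chiC _) (chiN _ M20).
have up : I (fun x => gradnorm (plateau T M) x * w1 (dot e x)) <=
    A * kappa M + 2 * B / M * (E * kappa (2 * M)).
  rewrite -(slab_chi M0 c1) -(slab_chi M20 cE) -I_scale // -I_add //; last exact: cc_scale.
  apply: I_le => [||x].
  - by apply: cc_mull w1e; exact: cc_gradnorm Cu.
  - by apply: cc_add => //; exact: cc_scale.
  apply: le_trans (ler_wpM2r (ltW (w1_gt0 _)) (gradnorm_plateau x T4 M0 B0 HB)) _.
  by rewrite le_eqVlt; apply/orP; left; apply/eqP; ring.
apply: le_lt_trans up _.
have -> : I (fun x => plateau T M x * w0 (dot e x)) = D * kappa M.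
  rewrite -(slab_chi M0 cD); congr I; apply/funext => x; rewrite /plateau; ring.
rewrite kappa_double //.
have -> : A * kappa M + 2 * B / M * (E * (2 ^+ n / 2 * kappa M)) =
  (A + B * E * 2 ^+ n / M) * kappa M by field; rewrite gt_eqF.
rewrite mulrA ltr_pM2r ?kappa_gt0 // addrC -ltrBrDr ltr_pdivrMr //.
Qed.

End HalfSpace.

(** * Affine changes of variables *)

Section AffineChange.
Context {R : realType} {n : nat}.
Local Notation V := 'rV[R]_n.

Lemma Sm_affine (f : V -> R) (a : R) (b : V) : Sm f -> Sm (fun x => f (a *: x + b)).
Proof.
elim=> {f}.
- by move=> c; exact: Sm_cst.
- move=> i; apply: (Sm_ext (f := fun x => a * x ord0 i + b ord0 i)).
    by move=> x; rewrite !mxE.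
  by apply: Sm_add; [apply: Sm_mul; [exact: Sm_cst|exact: Sm_coord]|exact: Sm_cst].
- by move=> f g _ Hf _ Hg; exact: Sm_add.
- by move=> f g _ Hf _ Hg; exact: Sm_mul.
- by move=> p f _ Hf f0; apply: Sm_pow.
- by move=> k f _ Hf; exact: Sm_flat.
- by move=> F h f dF _ Hh _ Hf; exact: Sm_prim dF Hh Hf.
Qed.

Lemma gradnorm_affine (f : V -> R) (a : R) (b x : V) : Sm f ->
  gradnorm (fun x => f (a *: x + b)) x = `|a| * gradnorm f (a *: x + b).
Proof.
move=> sf; rewrite !gradnormE -enormZ; congr enorm; apply/rowP => i; rewrite !mxE.
have [g _ dg] := Sm_derive sf (ebasis R i).
have [_ fE] := dg (a *: x + b); rewrite /dpartial fE.
pose h (s : R) := f (s *: ebasis R i + (a *: x + b)).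
have dh : is_derive (a * 0 : R) 1 h (g (a *: x + b)).
  by refine ((@is_derive_line R V f h (a *: x + b) (ebasis R i) _ _ _).1 (dg _)) => k; rewrite /h mulr0 addr0.
have da : is_derive (0 : R) 1 (fun s : R => a * s) a.
  have := @is_deriveZ R R R id a (0 : R) 1 1 (is_derive_id _ _).
  by congr is_derive; rewrite -[_ *: _]/(_ * _) mulr1.
have := @is_derive1_comp R h (fun s => a * s) 0 _ _ dh da.
move=> /((@is_derive_line R V (fun x => f (a *: x + b)) _ x (ebasis R i) 0 _ _).2) H.
have [|_ ->] := H _; last by rewrite mulrC.
by move=> k; rewrite /h /= addr0 scalerDr scalerA addrA.
Qed.

Lemma cc_bounded (f : V -> R) : cc f -> exists2 B : R, 0 <= B & forall x, f x <= B.
Proof.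
move=> [cf [M fM]].
have N0 : [set x : V | `|x| <= Num.max M 0] !=set0.
  by exists 0; rewrite /= normr0 le_max lexx orbT.
have [c _ Hc] := EVT_max_rV N0 (@proper_rV R n _) (continuous_subspaceT cf).
exists (Num.max (f c) 0); first by rewrite le_max lexx orbT.
move=> x; rewrite le_max; have [xM|xM] := leP `|x| (Num.max M 0).
  by rewrite Hc //; exact/mem_set.
by rewrite fM ?lexx ?orbT //; apply: le_lt_trans xM; rewrite le_max lexx.
Qed.

End AffineChange.

(** * Blow-up at a boundary point touched by an interior ball *)

Section BlowUp.
Context {R : realType} {n : nat}.
Local Notation V := 'rV[R]_n.
Variable Omega : set V.
Hypotheses (oO : open Omega) (OT : Omega != setT).
Hypothesis superharmonic : neg_laplacian_dist_ge0 Omega.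
Variables (y e : V) (r : R).
Hypotheses (Oy : ~ Omega y) (e1 : enorm e = 1) (r0 : 0 < r).
Local Notation d := (dist_compl Omega).
Hypothesis dr : d (y + r *: e) = r.

(** [d (y + v) >= r - |r e - v|] since [d] is 1-Lipschitz, and [sqrt (r^2 + a) <= r + a / (2 r)]. *)
Let ball_lower v : dot e v - sqn v / (2 * r) <= d (y + v).
Proof.
have := dist_triangle OT (y + r *: e) (y + v); rewrite dr.
have -> : y + r *: e - (y + v) = r *: e - v by rewrite opprD addrACA subrr add0r.
set a := - (2 * r * dot e v) + sqn v.
have S : sqn (r *: e - v) = r ^+ 2 + a.
  by rewrite sqnD sqnZ sqnN -enorm_sq e1 dotZl dotNr /a; ring.
have a0 : 0 <= r ^+ 2 + a by rewrite -S sqn_ge0.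
have E : a / (2 * r) = - dot e v + sqn v / (2 * r).
  by rewrite /a; field; rewrite gt_eqF.
suff : enorm (r *: e - v) <= r + a / (2 * r) by rewrite E; lra.
have pE : 2 * r * (a / (2 * r)) = a by field; rewrite gt_eqF.
move: (a / (2 * r)) pE => p pE.
have rp : 0 <= r + p.
  by rewrite -(pmulr_rge0 _ r0); have := sqr_ge0 r; lra.
rewrite -(ler_pXn2r (n := 2)) ?nnegrE ?enorm_ge0 // enorm_sq S.
have := sqr_ge0 p; rewrite sqrrD -mulr_natl; lra.
Qed.

Let segment tau : 0 <= tau -> tau <= r -> d (y + tau *: e) = tau.
Proof.
move=> t0 tr; apply/eqP; rewrite eq_le; apply/andP; split.
  apply: le_trans (dist_le OT _ Oy) _.
  by rewrite [y + _]addrC addrK enormZ e1 mulr1 ger0_norm.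
have := dist_triangle OT (y + r *: e) (y + tau *: e); rewrite dr.
have -> : y + r *: e - (y + tau *: e) = (r - tau) *: e.
  by rewrite opprD addrACA subrr add0r scalerBl.
by rewrite enormZ e1 mulr1 ger0_norm ?subr_ge0 //; lra.
Qed.

(* The rescaled distance exceeds the distance to the tangent half-space by a
   superharmonic function which is nearly nonnegative and vanishes at [t0 e]. *)
Lemma blow_up (L : R) (g : V -> R) : cc g -> (forall x, 0 <= g x) ->
  (forall x, g x != 0 -> 4^-1 <= dot e x /\ enorm x <= L) ->
  exists2 C0 : R, 0 <= C0 & forall eta, 0 < eta -> eta <= 1 -> exists lambda : R,
    [/\ 0 < lambda,
        forall x, enorm x <= L -> dot e x - eta <= d (lambda *: x + y) / lambda &
        I (fun x => g x * (d (lambda *: x + y) / lambda - dot e x)) <= C0 * eta].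
Proof.
move=> cg g0 gS.
have IK0 : 0 <= I (@K R n) by apply: I_ge0; [exact: cc_K|exact: K_ge0].
pose L1 := Num.max L 1.
have L11 : 1 <= L1 by rewrite le_max lexx orbT.
have LL1 : L <= L1 by rewrite le_max lexx.
have L2 : L1 <= L1 ^+ 2 by rewrite expr2 ler_peMl //; lra.
(* On the support of [g], [1/4 <= dot e x <= L1 <= t0 / 10], so [sqn (x - t0 e)] lies between
   [4/5 t0^2] and [t0^2 - 4 L1^2]. Divided by [rho^2 = t0^2 - 5/4 L1^2] it falls in [[1/2, q2]] with
   [q2 < 1], where [ker] has a positive minimum. Also [rho < t0], as the mean value inequality at
   [t0 e] requires. *)
pose t0 := 10 * L1 ^+ 2.
have t01 : 1 <= t0 by rewrite /t0; lra.
have t0L : 10 * L1 <= t0 by rewrite /t0; lra.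
have t00 : 0 < t0 by lra.
have tt : t0 <= t0 ^+ 2 by rewrite expr2 ler_peMl //; lra.
pose rho := Num.sqrt (t0 ^+ 2 - t0 / 8).
have rhosq : rho ^+ 2 = t0 ^+ 2 - t0 / 8 by rewrite sqr_sqrtr //; lra.
have rho0 : 0 < rho by rewrite sqrtr_gt0; lra.
have rho20 : 0 < rho ^+ 2 by rewrite exprn_gt0.
have rhot : rho < t0.
  by rewrite -(ltr_pXn2r (n := 2)) ?nnegrE ?ltW // rhosq; lra.
pose q2 := (t0 ^+ 2 - 4 * L1 ^+ 2) / rho ^+ 2.
have q21 : q2 < 1 by rewrite ltr_pdivrMr // mul1r rhosq; have := t0L; rewrite /t0; lra.
have q22 : 2^-1 <= q2.
  rewrite ler_pdivlMr // rhosq.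
  have : 4 * L1 ^+ 2 <= t0 by rewrite /t0; lra.
  have : 10 * t0 <= t0 ^+ 2 by rewrite expr2 ler_wpM2r ?(ltW t00) //; lra.
  lra.
have ck : {within `[2^-1, q2], continuous (@ker R n)}.
  by apply: continuous_subspaceT; exact: ker_continuous.
have [q qI kmin] := EVT_min q22 ck.
pose k0 := ker n q.
have k00 : 0 < k0.
  by move: qI; rewrite in_itv /= => /andP[qa qb]; apply: ker_gt0; lra.
have [G G0 HG] := cc_bounded cg.
have gk x : g x <= G / k0 * ker n (sqn (x - t0 *: e) / rho ^+ 2).
  have [->|gx] := eqVneq (g x) 0; first by rewrite mulr_ge0 ?ker_ge0 // divr_ge0 // ltW.
  have [tx xL] := gS x gx.
  have S : sqn (x - t0 *: e) = sqn x - 2 * t0 * dot e x + t0 ^+ 2.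
    by rewrite sqnD sqnN sqnZ -[sqn e]enorm_sq e1 dotNr dotZr [dot x e]dotC; ring.
  have xL1 : enorm x <= L1 by lra.
  have sx : sqn x <= L1 ^+ 2.
    by rewrite -enorm_sq ler_pXn2r ?nnegrE ?enorm_ge0 //; lra.
  have tL : dot e x <= L1.
    have := Cauchy_Schwarz e x; rewrite e1 mul1r; have := ler_norm (dot e x); lra.
  have t1 : t0 * 4^-1 <= t0 * dot e x by rewrite ler_pM2l.
  have t2 : t0 * (10 * dot e x) <= t0 * t0 by rewrite ler_pM2l //; lra.
  have sx0 := sqn_ge0 x.
  rewrite mulrAC ler_pdivlMr //; apply: ler_pM => //; first exact: ltW.
  apply: kmin; rewrite in_itv /=; apply/andP; split.
    by rewrite ler_pdivlMr // S rhosq; move: t2; rewrite -[t0 * t0]expr2; lra.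
  rewrite ler_pM2r ?invr_gt0 // S; move: t1; rewrite /t0; lra.
pose C0 := G / k0 * rho ^+ n * I (@K R n).
have C00 : 0 <= C0.
  by rewrite !mulr_ge0 ?invr_ge0 ?exprn_ge0 // ltW.
exists C0 => // eta eta0 eta1.
(* For [|x| <= 2 t0] the error [lambda * sqn x / (2 r)] of [ball_lower] is then at most [eta];
   moreover [lambda t0 <= r], so that [segment] applies at [t0 e]. *)
pose lambda := eta * r / (2 * t0 ^+ 2).
have t020 : 0 < 2 * t0 ^+ 2 by rewrite mulr_gt0 // exprn_gt0.
have l0 : 0 < lambda by rewrite divr_gt0 // mulr_gt0.
have lt0 : lambda * t0 <= r.
  rewrite /lambda mulrAC ler_pdivrMr // mulrAC [r * _]mulrC ler_wpM2r ?(ltW r0) //.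
  have : eta * t0 <= 1 * t0 by rewrite ler_wpM2r // ltW.
  lra.
pose D x := d (lambda *: x + y) / lambda.
have Dlow x : enorm x <= 2 * t0 -> dot e x - eta <= D x.
  move=> xt; rewrite /D ler_pdivlMr // [lambda *: x + y]addrC.
  apply: le_trans (ball_lower _); rewrite dotZr sqnZ.
  have : sqn x <= (2 * t0) ^+ 2.
    by rewrite -enorm_sq ler_pXn2r ?nnegrE ?enorm_ge0 // mulr_ge0 // ltW.
  move=> /(ler_wpM2l (_ : 0 <= lambda / (2 * r))) H.
  have P : 0 <= lambda / (2 * r) by rewrite divr_ge0 ?(ltW l0) // mulr_ge0 // ltW.
  have := ler_wpM2l (ltW l0) (H P).
  have -> : lambda * (lambda / (2 * r) * sqn x) = lambda ^+ 2 * sqn x / (2 * r).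
    by rewrite expr2; ring.
  have -> : lambda * (lambda / (2 * r) * (2 * t0) ^+ 2) = eta * lambda.
    by rewrite {2}/lambda; field; rewrite !gt_eqF.
  lra.
have cd := dist_continuous OT.
have cD : continuous D.
  by apply: cont_mul; [exact: cont_affine|exact: cont_cst].
have ct : continuous (dot e : V -> R) by exact: dot_continuous.
pose w x := D x - dot e x.
have cw : continuous w by exact: cont_sub.
exists lambda; split=> // [x xL|].
  by apply: Dlow; apply: le_trans xL _; lra.
(* [w] vanishes at [t0 e], and the odd part of [dot e] integrates to zero against [K]. *)
have mv : I (fun z => K z * w (rho *: z + t0 *: e)) <= 0.
  have dt : d (lambda * t0 *: e + y) = lambda * t0.
    by rewrite addrC segment // mulr_ge0 // ltW.
  have h0 : 0 < lambda * rho by rewrite mulr_gt0.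
  have hd : lambda * rho < d (lambda * t0 *: e + y) by rewrite dt ltr_pM2l.
  have := dist_mean_value OT superharmonic h0 hd; rewrite dt.
  set F := (fun z => _) => HF.
  have cF : cc F by apply: cc_K_mul; exact: cont_affine.
  have cKe : cc (fun z => K z * dot e z) by exact: cc_K_mul.
  have -> : (fun z => K z * w (rho *: z + t0 *: e)) =
     (fun z => lambda^-1 * F z - (t0 * K z + rho * (K z * dot e z))).
    apply/funext => z; rewrite /w /D /F dotDr !dotZr dotxx -enorm_sq e1 expr1n.
    by rewrite scalerDr !scalerA addrA; ring.
  rewrite I_sub; [|exact: cc_scale|by apply: cc_add; apply: cc_scale => //; exact: cc_K].
  rewrite I_add; [|by apply: cc_scale; exact: cc_K|exact: cc_scale].
  rewrite !I_scale //; last exact: cc_K.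
  rewrite I_K_dot mulr0 addr0 subr_le0 -ler_pdivlMl ?invr_gt0 // invrK mulrA //.
(* Nonnegative on the ball of radius [2 t0], which contains the support of the rescaled kernel;
   there [g] can be replaced by its kernel majorant. *)
pose w' x := w x + eta.
have cw' : continuous w' by apply: cont_add => //; exact: cont_cst.
apply: (@le_trans _ _ (I (fun x => G / k0 * rho ^+ n *
    (w' x * (rho ^- n * ker n (sqn (x - t0 *: e) / rho ^+ 2)))))).
  have cR : cc (fun x => w' x * (rho ^- n * ker n (sqn (x - t0 *: e) / rho ^+ 2))).
    by apply: cc_mulr => //; apply: cc_scale; exact: cc_scaled_kernel.
  apply: I_le => [||x]; [exact: cc_mull|exact: cc_scale|].
  have -> : G / k0 * rho ^+ n * (w' x * (rho ^- n * ker n (sqn (x - t0 *: e) / rho ^+ 2))) =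
    G / k0 * ker n (sqn (x - t0 *: e) / rho ^+ 2) * w' x.
    rewrite -[rho ^- n]/((rho ^+ n)^-1).
    have : rho ^+ n != 0 by rewrite gt_eqF // exprn_gt0.
    by move: (rho ^+ n) (ker n _) => A B A0; field; rewrite A0 gt_eqF.
  apply: (@le_trans _ _ (g x * w' x)).
    by rewrite ler_wpM2l // /w' lerDl ltW.
  have [xt|xt] := leP (enorm x) (2 * t0).
    by apply: ler_wpM2r => //; have := Dlow x xt; rewrite /w' /w; lra.
  have -> : g x = 0.
    by apply/eqP; apply: contraTT xt => /gS[_]; rewrite -leNgt; lra.
  rewrite ker_right ?mulr0 ?mul0r // ler_pdivlMr // mul1r rhosq.
  have : t0 ^+ 2 <= sqn (x - t0 *: e).
    rewrite -enorm_sq ler_pXn2r ?nnegrE ?enorm_ge0 ?(ltW t00) //.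
    have := enormD (x - t0 *: e) (t0 *: e); rewrite subrK enormZ e1 mulr1 gtr0_norm //; lra.
  lra.
rewrite I_scale; last by apply: cc_mulr => //; apply: cc_scale; exact: cc_scaled_kernel.
rewrite I_scaled_kernel // /C0 -[leRHS]mulrA ler_wpM2l //.
  by rewrite mulr_ge0 ?exprn_ge0 ?divr_ge0 // ltW.
have -> : (fun z => K z * w' (rho *: z + t0 *: e)) =
    (fun z => K z * w (rho *: z + t0 *: e) + eta * K z).
  by apply/funext => z; rewrite /w'; ring.
rewrite I_add ?I_scale; [|exact: cc_K|by apply: cc_K_mul; exact: cont_affine|by apply: cc_scale; exact: cc_K].
rewrite [leRHS]mulrC; lra.
Qed.

End BlowUp.

Lemma gradnorm_support {R : realType} {n : nat} (u : 'rV[R]_n -> R) (A : set 'rV[R]_n) :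
  closed A -> (forall x, u x != 0 -> A x) -> forall x, gradnorm u x != 0 -> A x.
Proof.
move=> cA uA x /eqP gx; apply: contrapT => Ax; apply: gx.
have ux : ~ fsupport u x.
  have sub : [set x | u x != 0] `<=` A by move=> z; exact: uA.
  by move=> /(closure_subset sub); rewrite -(closure_id _).1.
by rewrite /gradnorm big1 ?sqrtr0 // => i _; rewrite (dpartial_outside _ ux) expr0n.
Qed.

(** * Transfer to the given domain *)

Section Main.
Context {R : realType} {n : nat}.
Local Notation V := 'rV[R]_n.
Variable Omega : set V.
Hypotheses (oO : open Omega) (OT : Omega != setT).
Local Notation d := (dist_compl Omega).

(** Any [c] in [Omega] is the centre of such a ball, and [y] is a nearest point to it. The unit
    vector [e] has a nonzero coordinate, so the dimension is positive. *)
Lemma touching_ball : Omega != set0 -> exists (y e : V) (r : R) (i0 : 'I_n),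
  [/\ ~ Omega y, enorm e = 1, 0 < r, d (y + r *: e) = r & e ord0 i0 != 0].
Proof.
move=> /set0P[c Oc]; have r0 := dist_gt0 oO OT Oc.
have [y Oy E] := dist_nearest oO OT c.
pose e := (d c)^-1 *: (c - y).
have ye : y + d c *: e = c by rewrite scalerA divff ?gt_eqF // scale1r addrC subrK.
have e1 : enorm e = 1 by rewrite enormZ -E gtr0_norm ?invr_gt0 // mulVf ?gt_eqF.
have [i0 ei0] : exists i0, e ord0 i0 != 0.
  apply: contrapT => /forallNP H; have e0 : e = 0.
    by apply/rowP => i; rewrite [RHS]mxE; apply/eqP/negPn/negP; exact: H.
  by move/eqP: e1; rewrite e0 enorm0 eq_sym oner_eq0.
by exists y, e, (d c), i0; split; rewrite ?ye.
Qed.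

(** Where [f] is nonzero the point lies in [Omega] and the truncation is inactive; elsewhere both
    integrands vanish. *)
Lemma iint_weight (f : V -> R) (p delta : R) : cc f -> 0 < delta ->
  (forall x, f x != 0 -> delta <= d x) ->
  iint (fun x => if x \in Omega then (f x / d x `^ p)%:E else 0%E) =
  (I (fun x => f x * (Num.max (d x) delta) `^ (- p)))%:E.
Proof.
move=> cf delta0 fd; rewrite -iintE; last first.
  apply: cc_mull => //; apply: cont_pow; last by move=> x; rewrite lt_max delta0 orbT.
  by apply: cont_max; [exact: dist_continuous|exact: cont_cst].
congr iint; apply/funext => x.
have [->|fx] := eqVneq (f x) 0; first by rewrite !mul0r if_same.
have dx := fd x fx; rewrite (max_idPl dx) powRN mem_set //.
by apply: (dist_gt0_in OT); exact: lt_le_trans dx.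
Qed.

Lemma closed_dist_ge delta : closed [set x | delta <= d x].
Proof.
by apply: (proj1 (continuous_closedP _) (dist_continuous OT) [set r : R | delta <= r]); exact: closed_ge.
Qed.

Hypothesis superharmonic : neg_laplacian_dist_ge0 Omega.

Lemma Hardy (i0 : 'I_n) (u : V -> R) (s : R) : Cc_infty Omega u -> 1 < s ->
  ((s - 1)%:E * iint (fun x => if x \in Omega then (`|u x| / d x `^ s)%:E else 0%E)
   <= iint (fun x => if x \in Omega then (gradnorm u x / d x `^ (s - 1))%:E else 0%E))%E.
Proof.
move=> Cu s1; have [delta delta0 ud] := Cc_dist_gt Cu oO OT.
have ud' x : u x != 0 -> delta <= d x by move=> /ud; lra.
have cu : cc (fun x => `|u x|).
  have [cu [M HM]] := cc_Cc Cu; split; first exact: cont_norm.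
  by exists M => x /HM ->; rewrite normr0.
rewrite (iint_weight _ cu delta0) => [|x]; last by rewrite normr_eq0; exact: ud'.
rewrite (iint_weight _ (cc_gradnorm Cu) delta0 (gradnorm_support (@closed_dist_ge _) ud')).
rewrite -EFinM lee_fin; have := Hardy_truncated oO OT superharmonic i0 Cu s1 delta0 ud.
by rewrite opprB; congr (_ <= I _); apply/funext => x; rewrite mulrC.
Qed.

Lemma Hardy_almost_sharp (s C : R) : Omega != set0 -> 1 < s -> s - 1 < C ->
  exists u : V -> R, Cc_infty Omega u /\
  (iint (fun x => if x \in Omega then (gradnorm u x / d x `^ (s - 1))%:E else 0%E)
   < C%:E * iint (fun x => if x \in Omega then (`|u x| / d x `^ s)%:E else 0%E))%E.
Proof.
move=> O0 s1 sC.
have [y [e [r [i0 [Oy e1 r0 dr ei0]]]]] := touching_ball O0.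
have [u0 [su0 u00 [L HL] sharp]] := half_space_almost_sharp e1 ei0 s1 sC.
have p0 : 0 < s - 1 by rewrite subr_gt0.
have C0 : 0 < C by lra.
have eighth : 0 < 8^-1 :> R by [].
have Cu0 : Cc_infty setT u0.
  split; first exact: Sm_smooth.
  have [|cs _] := fsupport_sub (f := u0) (@closed_ball_compact R n 0 L); last by split.
  move=> x xL; apply/eqP; apply: contrapT => /negP/HL[_].
  by move=> H; apply: xL; rewrite /= subr0.
have cu0 := cc_Cc Cu0; have cgr := cc_gradnorm Cu0.
have cgr0 x : 0 <= gradnorm u0 x by exact: sqrtr_ge0.
have ct : continuous (dot e : V -> R) by exact: dot_continuous.
have gL x : gradnorm u0 x != 0 -> 4^-1 <= dot e x /\ enorm x <= L.
  apply: (gradnorm_support (A := [set x | 4^-1 <= dot e x] `&` [set x | enorm x <= L])) => // {x}.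
  apply: closedI.
    by apply: (proj1 (continuous_closedP _) ct [set r : R | 4^-1 <= r]); exact: closed_ge.
  by apply: (proj1 (continuous_closedP _) (@enorm_continuous R n) [set r : R | r <= L]); exact: closed_le.
have cw p : continuous (fun x : V => (Num.max (dot e x) 8^-1) `^ p).
  exact: (@cont_comp R _ (dot e) (fun t => (Num.max t 8^-1) `^ p) ct (cont_pow_max eighth)).
set N := I _ in sharp; set D := I _ in sharp.
have cN : cc (fun x => gradnorm u0 x * (Num.max (dot e x) 8^-1) `^ (1 - s)) by exact: cc_mull.
have cD : cc (fun x => u0 x * (Num.max (dot e x) 8^-1) `^ (- s)) by exact: cc_mull.
have N0 : 0 <= N by apply: I_ge0 => // x; rewrite mulr_ge0 ?powR_ge0.
have D0 : 0 < D by rewrite -(pmulr_rgt0 _ C0); exact: le_lt_trans N0 sharp.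
(* The slope of the tangent to [r^(-s)] at [t = dot e x]: it dominates the loss in the integral of
   [u0] when [t] is replaced by the rescaled distance. *)
pose g x := u0 x * (Num.max (dot e x) 8^-1) `^ (- s - 1).
have cg : cc g by exact: cc_mull.
have g0 x : 0 <= g x by rewrite mulr_ge0 ?powR_ge0.
have gS x : g x != 0 -> 4^-1 <= dot e x /\ enorm x <= L.
  by rewrite mulf_eq0 negb_or => /andP[/HL].
have [C1 C10 blow] := blow_up OT superharmonic Oy e1 r0 dr cg g0 gS.
pose B := C * (s * C1) + 8 * (s - 1) * (C * D).
have s0 : 0 < s by lra.
have B0 : 0 <= B.
  by apply: addr_ge0; do !apply: mulr_ge0 => //; exact: ltW.
have gap : 0 < C * D - N by rewrite subr_gt0.
(* The first bound keeps the rescaled distance above [1/4 - 1/16 >= 1/8], the second keeps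
   [1 - 8 (s - 1) eta] at least 1/2, the third keeps the total loss [eta * B] below the gap. *)
pose eta := Num.min (16^-1) (Num.min ((16 * (s - 1))^-1) ((C * D - N) / (B + 1) / 2)).
have eta0 : 0 < eta.
  rewrite !lt_min invr_gt0 ltr0n invr_gt0 mulr_gt0 //= !divr_gt0 //.
  by rewrite ltr_wpDl.
have eta16 : eta <= 16^-1 by rewrite ge_min lexx.
have etap : eta * (16 * (s - 1)) <= 1.
  by rewrite -ler_pdivlMr ?mulr_gt0 // mul1r !ge_min lexx orbT.
have etaB : eta * B < C * D - N.
  apply: (@le_lt_trans _ _ (eta * (B + 1))); first by rewrite ler_wpM2l ?lerDl // ltW.
  apply: (@le_lt_trans _ _ ((C * D - N) / 2)); last lra.
  by rewrite -ler_pdivlMr ?ltr_wpDl // mulrAC !ge_min lexx !orbT.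
have [lambda [l0 Dlow Iw]] := blow eta eta0 (ltac:(lra)).
pose delta x := d (lambda *: x + y) / lambda.
have deltal x : 4^-1 <= dot e x -> enorm x <= L -> dot e x - eta <= delta x /\ 8^-1 <= delta x.
  by move=> tx xL; have := Dlow x xL; rewrite /delta; lra.
have cdel : continuous delta.
  apply: cont_mul; last exact: cont_cst.
  by apply: cont_affine; exact: dist_continuous.
have cm p : continuous (fun x => (Num.max (delta x) 8^-1) `^ p).
  apply: cont_pow; last by move=> x; rewrite lt_max eighth orbT.
  by apply: cont_max => //; exact: cont_cst.
pose Nl := I (fun x => gradnorm u0 x * (Num.max (delta x) 8^-1) `^ (1 - s)).
pose Dl := I (fun x => u0 x * (Num.max (delta x) 8^-1) `^ (- s)).
have cNl : cc (fun x => gradnorm u0 x * (Num.max (delta x) 8^-1) `^ (1 - s)) by exact: cc_mull.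
have cDl : cc (fun x => u0 x * (Num.max (delta x) 8^-1) `^ (- s)) by exact: cc_mull.
have Dl_lower : D - s * (C1 * eta) <= Dl.
  have cgw : cc (fun x => g x * (delta x - dot e x)).
    by apply: cc_mull => //; exact: cont_sub.
  apply: (@le_trans _ _ (D - s * I (fun x => g x * (delta x - dot e x)))).
    by rewrite lerD2l lerN2 ler_wpM2l //; lra.
  rewrite -I_scale // -I_sub //; last exact: cc_scale.
  apply: I_le => // [|x]; first by apply: cc_sub => //; exact: cc_scale.
  have [ux|ux] := eqVneq (u0 x) 0; first by rewrite /g ux !mul0r mulr0 subrr.
  have [tx xL] := HL x ux; have [_ dx] := deltal x tx xL.
  rewrite /g (max_idPl dx) (_ : Num.max (dot e x) 8^-1 = dot e x); last by apply/max_idPl; lra.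
  have t0 : 0 < dot e x by lra.
  have d0 : 0 < delta x by lra.
  have := ler_wpM2l (u00 x) (powR_tangent s0 d0 t0); rewrite mulrBr.
  by congr (_ - _ <= _); ring.
have q0 : 0 < 1 - 8 * (s - 1) * eta by lra.
have Nl_upper : Nl * (1 - 8 * (s - 1) * eta) <= N.
  rewrite mulrC -I_scale //; apply: I_le => // [|x]; first exact: cc_scale.
  have [gx|gx] := eqVneq (gradnorm u0 x) 0; first by rewrite gx !mul0r mulr0.
  have [tx xL] := gL x gx; have [lo dx] := deltal x tx xL.
  rewrite (max_idPl dx) (_ : Num.max (dot e x) 8^-1 = dot e x); last by apply/max_idPl; lra.
  rewrite mulrCA ler_wpM2l //.
  have t0 : 0 < dot e x by lra.
  have d0 : 0 < delta x by lra.
  (* From [t <= delta + eta] and [delta >= 1/8]. *)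
  have td : dot e x / delta x <= 1 + 8 * eta.
    rewrite ler_pdivrMr // mulrDl mul1r.
    have : eta * 8^-1 <= eta * delta x by rewrite ler_pM2l.
    lra.
  have := powR_tangent p0 (divr_gt0 t0 d0) ltr01.
  rewrite !opprB (_ : 1 `^ (1 - s) = 1); last by rewrite powR1.
  rewrite (_ : 1 `^ _ = 1); last by rewrite powR1.
  rewrite mulr1 => T1.
  have -> : dot e x `^ (1 - s) = (dot e x / delta x) `^ (1 - s) * delta x `^ (1 - s).
    by rewrite -powRM ?(ltW d0) ?(ltW (divr_gt0 t0 d0)) // divfK // gt_eqF.
  rewrite ler_wpM2r ?powR_ge0 //; apply: le_trans T1.
  have : (s - 1) * (dot e x / delta x - 1) <= (s - 1) * (8 * eta).
    by rewrite ler_pM2l //; lra.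
  lra.
have Nl_Dl : Nl < C * Dl.
  rewrite -(ltr_pM2r q0); apply: le_lt_trans Nl_upper _.
  apply: (@lt_le_trans _ _ (C * (D - s * (C1 * eta)) * (1 - 8 * (s - 1) * eta))); last first.
    by rewrite ler_pM2r // ler_pM2l.
  have : 0 <= C * (s * (C1 * eta)) * (8 * (s - 1) * eta).
    by do !apply: mulr_ge0 => //; exact: ltW.
  move: etaB; rewrite /B; lra.
pose u (x : V) : R := u0 (lambda^-1 *: x + - (lambda^-1 *: y)).
have ln0 : lambda != 0 by rewrite gt_eqF.
have uE x : lambda^-1 *: (lambda *: x + y) + - (lambda^-1 *: y) = x.
  by rewrite scalerDr scalerA mulVf // scale1r addrK.
have Eu x : lambda *: (lambda^-1 *: x + - (lambda^-1 *: y)) + y = x.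
  by rewrite scalerDr scalerN !scalerA divff // !scale1r subrK.
have supp x : u x != 0 -> enorm (x - y) <= lambda * L /\ lambda / 8 <= d x.
  rewrite /u; set z := _ + _ => uz; have [tz zL] := HL z uz.
  have [_] := deltal z tz zL; rewrite /delta ler_pdivlMr // mulrC Eu => dz.
  split=> //; have -> : x - y = lambda *: z by rewrite -[x](Eu x) addrK.
  by rewrite enormZ gtr0_norm // ler_pM2l.
have ud x : u x != 0 -> lambda / 8 <= d x by case/supp.
have l8 : 0 < lambda / 8 by rewrite divr_gt0.
have Cu : Cc_infty Omega u.
  split; first by apply: Sm_smooth; exact: Sm_affine.
  pose A := [set x | enorm (x - y) <= lambda * L] `&` [set x | lambda / 8 <= d x].
  have cA : compact A.
    apply: (subclosed_compact _ (@closed_ball_compact R n y (lambda * L))); last by move=> x [].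
    apply: closedI; last exact: closed_dist_ge.
    exact: compact_closed (@closed_ball_compact R n y (lambda * L)).
  have [|cs sub] := fsupport_sub (f := u) cA.
    by move=> x Ax; apply/eqP; apply: contrapT => /negP/supp.
  split=> // x /sub[_ /= dx]; apply: (dist_gt0_in OT); exact: lt_le_trans dx.
exists u; split=> //.
have u_ge0 x : `|u x| = u x by rewrite ger0_norm //; exact: u00.
under [X in (_ < _ * iint X)%E]eq_fun do rewrite u_ge0.
rewrite (iint_weight _ (cc_Cc Cu) l8 ud).
rewrite (iint_weight _ (cc_gradnorm Cu) l8 (gradnorm_support (@closed_dist_ge _) ud)).
rewrite -EFinM lte_fin opprB.
set FN := (fun x => gradnorm u x * _); set FD := (fun x => u x * _).
have cM p : continuous (fun x => (Num.max (d x) (lambda / 8)) `^ p).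
  apply: cont_pow; last by move=> x; rewrite lt_max l8 orbT.
  by apply: cont_max; [exact: dist_continuous|exact: cont_cst].
have cFN : cc FN by apply: cc_mull (cM _); exact: cc_gradnorm Cu.
have cFD : cc FD by apply: cc_mull (cM _); exact: cc_Cc Cu.
have ME p x : (Num.max (d (lambda *: x + y)) (lambda / 8)) `^ p =
    lambda `^ p * (Num.max (delta x) 8^-1) `^ p.
  have -> : d (lambda *: x + y) = lambda * delta x by rewrite /delta mulrC divfK.
  rewrite -maxr_pMr ?(ltW l0) // powRM ?(ltW l0) // le_max.
  by rewrite (ltW eighth) orbT.
have lp : 0 < `|lambda| ^- n by rewrite invr_gt0 exprn_gt0 // gtr0_norm.
rewrite -(ltr_pM2l lp) mulrCA -!(I_affine y _ ln0) //.
have ls : 0 < lambda `^ (- s) by exact: powR_gt0.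
(* Both integrands scale by [lambda^(-s)]: in the second, the gradient gives [lambda^(-1)] and the
   weight [lambda^(1-s)]. The common factor cancels. *)
have -> : (fun x => FD (lambda *: x + y)) =
    (fun x => lambda `^ (- s) * (u0 x * (Num.max (delta x) 8^-1) `^ (- s))).
  by apply/funext => x; rewrite /FD ME /u uE mulrCA.
have -> : (fun x => FN (lambda *: x + y)) =
    (fun x => lambda `^ (- s) * (gradnorm u0 x * (Num.max (delta x) 8^-1) `^ (1 - s))).
  apply/funext => x; rewrite /FN ME /u (gradnorm_affine _ _ _ su0) uE.
  rewrite gtr0_norm ?invr_gt0 // [1 - s]addrC powRD ?ln0 ?implybT // powRr1 ?(ltW l0) //.
  by field.
by rewrite !I_scale // mulrCA ltr_pM2l.
Qed.

End Main.

Theorem theorem2p9 (R : realType) (n : nat) (Omega : set 'rV[R]_n) :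
  open Omega -> Omega != set0 -> Omega != setT ->
  neg_laplacian_dist_ge0 Omega ->
  (forall (u : 'rV[R]_n -> R) (s : R), Cc_infty Omega u -> 1 < s ->
     ((s - 1)%:E *
        iint (fun x => if x \in Omega
                       then (`|u x| / dist_compl Omega x `^ s)%:E else 0%E)
      <= iint (fun x => if x \in Omega
                        then (gradnorm u x / dist_compl Omega x `^ (s - 1))%:E
                        else 0%E))%E)
  /\
  (forall (s C : R), 1 < s -> s - 1 < C ->
     exists u : 'rV[R]_n -> R, Cc_infty Omega u /\
       (iint (fun x => if x \in Omega
                       then (gradnorm u x / dist_compl Omega x `^ (s - 1))%:E
                       else 0%E)
        < C%:E *
          iint (fun x => if x \in Omega
                         then (`|u x| / dist_compl Omega x `^ s)%:E else 0%E))%E).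
Proof.
move=> oO O0 OT sh; split=> [u s Cu s1|s C s1 sC].
  by have [_ [_ [_ [i0 _]]]] := touching_ball oO OT O0; exact: Hardy.
exact: Hardy_almost_sharp.
Qed.
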